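(* There is an absolute constant $K>0$ (the constant hidden in $n^{O(m)}$) such that the following holds. Let $m\ge 1$ and $n \geq 100(m+1)$ be integers, let $b \in \mathbb{R}^m$, and let $A\in\mathbb{R}^{m\times n}$, $c\in\mathbb{R}^n$ be random such that the matrix $W := \begin{bmatrix} c^{\mathsf T} \\ A \end{bmatrix} \in \mathbb{R}^{(m+1)\times n}$ has columns that are independent logconcave random vectors with identity covariance. Then, for all $G \geq 0$ and $\delta\in(0,1)$, with probability at least $$1-\Pr_{A,c}\left[\mathsf{IPGAP}(A,b,c) \geq G\right]-\delta-e^{-n/5},$$ the best bound first branch-and-bound algorithm applied to the binary integer program $\max\{c^{\mathsf T}x : Ax\le b,\ x\in\{0,1\}^n\}$ produces a tree of size at most $$n^{K m}\, e^{2\sqrt{2nG}}/\delta .$$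
   Context: A random vector in $\mathbb{R}^d$ is logconcave if it has a probability density $f:\mathbb{R}^d\to\mathbb{R}_+$ such that $\log f:\mathbb{R}^d\to\mathbb{R}\cup\{-\infty\}$ is concave. Identity covariance means $\mathbb{E}[XX^{\mathsf T}]-\mathbb{E}[X]\mathbb{E}[X]^{\mathsf T}=I$. $\mathrm{val}_{\mathsf{LP}}(A,b,c) := \max\{c^{\mathsf T}x : Ax\le b,\ x\in[0,1]^n\}$, $\mathrm{val}_{\mathsf{IP}}(A,b,c) := \max\{c^{\mathsf T}x : Ax\le b,\ x\in\{0,1\}^n\}$, $\mathsf{IPGAP}(A,b,c) := \mathrm{val}_{\mathsf{LP}}(A,b,c)-\mathrm{val}_{\mathsf{IP}}(A,b,c)$, with the convention $\mathsf{IPGAP}(A,b,c)=+\infty$ if the integer program is infeasible. Best bound first branch-and-bound: the algorithm maintains a rooted binary tree whose nodes correspond to subproblems obtained from the LP relaxation $\max\{c^{\mathsf T}x: Ax\le b, x\in[0,1]^n\}$ by fixing a subset of the variables to $0$ or $1$ (the root fixes none). At each step it selects, among the unprocessed leaves, one whose LP relaxation value is largest, and processes it: if the LP of the node is infeasible, or its value is at most the value of the best integer solution found so far, the node is pruned; if the optimal basic LP solution found is integral, it is recorded as an integer solution and the node becomes a leaf; otherwise the algorithm picks an arbitrary variable $x_i$ that is fractional in that solution and creates two children, additionally fixing $x_i=0$ and $x_i=1$ respectively. The algorithm stops when no unprocessed leaves remain. The size of the tree is its number of nodes. *)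

(* Defs.v *)
From HB Require Import structures.
From mathcomp Require Import all_boot all_order all_algebra.
From mathcomp Require Import all_classical all_reals all_analysis.
Set Implicit Arguments.
Unset Strict Implicit.
Unset Printing Implicit Defensive.
Import Order.TTheory GRing.Theory Num.Theory.
Import numFieldNormedType.Exports.
Local Open Scope classical_set_scope.
Local Open Scope ring_scope.

(* R^d is represented by d.-tuple R, whose library sigma-algebra is generated
   by the coordinates, i.e. is the Borel sigma-algebra. *)

Section cons_measure.
Context {R : realType} (d : nat).
Variable mu : {sigma_finite_measure set (d.-tuple R) -> \bar R}.

(* lebesgue_measure lives on measurableTypeR R, which has the same measurable
   sets as R but a different display. *)
Definition tuple_cons (p : measurableTypeR R * d.-tuple R) : d.+1.-tuple R :=
  [tuple of p.1 :: p.2].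

Lemma measurable_tuple_cons : measurable_fun setT tuple_cons.
Proof.
have mfst : measurable_fun setT
    (fun p : measurableTypeR R * d.-tuple R => (p.1 : R)).
  by move=> mT Y mY; exact: (@measurable_fst _ _ (measurableTypeR R) (d.-tuple R) mT Y mY).
exact: (measurable_cons mfst measurable_snd).
Qed.

Definition cons_measure : set (d.+1.-tuple R) -> \bar R :=
  pushforward ((@lebesgue_measure R) \x mu)%E tuple_cons.

Let cons_measure0 : cons_measure set0 = 0%E.
Proof. by rewrite /cons_measure /pushforward preimage_set0 measure0. Qed.

Let cons_measure_ge0 B : (0 <= cons_measure B)%E.
Proof. by rewrite /cons_measure /pushforward measure_ge0. Qed.

Let cons_measure_sigma_additive : semi_sigma_additive cons_measure.
Proof.
move=> F mF tF mUF; rewrite /cons_measure /pushforward preimage_bigcup.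
apply: measure_semi_sigma_additive.
- by move=> i; rewrite -[X in measurable X]setTI; exact: measurable_tuple_cons.
- apply/trivIsetP => /= i j _ _ ij; rewrite -preimage_setI.
  by move/trivIsetP : tF => /(_ _ _ _ _ ij) ->//; rewrite preimage_set0.
- rewrite -preimage_bigcup -[X in measurable X]setTI.
  exact: measurable_tuple_cons.
Qed.

HB.instance Definition _ := isMeasure.Build _ _ _ cons_measure
  cons_measure0 cons_measure_ge0 cons_measure_sigma_additive.

Let cons_measure_sigma_finite : sigma_finite [set: d.+1.-tuple R] cons_measure.
Proof.
have /sigma_finiteP[F [TF ndF Foo]] := sigma_finiteT (@lebesgue_measure R).
have /sigma_finiteP[G [TG ndG Goo]] := sigma_finiteT mu.
pose bt (t : d.+1.-tuple R) : d.-tuple R := [tuple of behead t].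
exists (fun k => (fun t : d.+1.-tuple R => thead t) @^-1` F k `&` bt @^-1` G k).
  apply/seteqP; split=> // t _.
  have [i _ Fi] : (\bigcup_i F i) (thead t) by rewrite -TF.
  have [j _ Gj] : (\bigcup_i G i) (bt t) by rewrite -TG.
  exists (maxn i j) => //; split => /=.
    by move: (thead t) Fi; exact/subsetPset/ndF/leq_maxl.
  by move: (bt t) Gj; exact/subsetPset/ndG/leq_maxr.
move=> k; have [mF Fk] := Foo k; have [mG Gk] := Goo k; split.
  apply: measurableI; rewrite -[X in measurable X]setTI.
    exact: (@measurable_tnth _ R d.+1 ord0).
  exact: measurable_behead.
rewrite /cons_measure /pushforward.
rewrite (_ : _ @^-1` _ = F k `*` G k); last first.
  apply/seteqP; split=> -[x t] /=.
    by move=> [Fx]; rewrite (_ : bt _ = t) //; exact: val_inj.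
  by move=> [Fx Gt]; split => //; rewrite (_ : bt _ = t) //; exact: val_inj.
by rewrite product_measure1E// lte_mul_pinfty// ge0_fin_numE.
Qed.

HB.instance Definition _ := Measure_isSigmaFinite.Build _ _ _ cons_measure
  cons_measure_sigma_finite.

End cons_measure.

(* Lebesgue measure on R^d, as an iterated product of lebesgue_measure. *)
Fixpoint lebesgue_tuple (R : realType) (d : nat) :
    {sigma_finite_measure set (d.-tuple R) -> \bar R} :=
  match d with
  | 0 => dirac ([tuple] : 0.-tuple R)
  | d'.+1 => cons_measure (lebesgue_tuple R d')
  end.

Lemma lebesgue_tuple_box (R : realType) (d : nat) (B : 'I_d -> set R) :
  (forall i, measurable (B i)) ->
  lebesgue_tuple R d [set t | forall i, B i (tnth t i)] =
    (\prod_(i < d) lebesgue_measure (B i))%E.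
Proof.
elim: d B => [|d IHd] B mB.
  by rewrite big_ord0 /= diracE mem_set// => -[].
rewrite big_ord_recl -IHd => [|i]; last exact: mB.
set D := [set t : d.-tuple R | _].
have mD : measurable D.
  rewrite (_ : D = \bigcap_(i in [set: 'I_d])
      (fun t => tnth t i) @^-1` B (lift ord0 i)).
    apply: fin_bigcap_measurable => // i _.
    by rewrite -[X in measurable X]setTI; exact: measurable_tnth.
  by apply/seteqP; split=> [t Dt i _|t Dt i]; [exact: Dt|exact: (Dt i)].
rewrite /= /cons_measure /pushforward.
rewrite (_ : _ @^-1` _ = B ord0 `*` D) ?product_measure1E//; first exact: mB.
apply/seteqP; split=> -[x t] /=.
  move=> Bt; split; first exact: (Bt ord0).
  by move=> i; have := Bt (lift ord0 i); rewrite tnthS.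
by move=> [Bx Dt] i; case: (unliftP ord0 i) => [j ->|->//]; rewrite tnthS.
Qed.

Section random_vectors.
Context {dO : measure_display} {Omega : measurableType dO} {R : realType}.
Variable P : probability Omega R.

Definition has_density (d : nat) (X : {RV P >-> d.-tuple R})
    (f : d.-tuple R -> R) : Prop :=
  [/\ measurable_fun setT f, forall x, 0 <= f x
    & forall B : set (d.-tuple R), measurable B ->
        distribution P X B = (\int[lebesgue_tuple R d]_(x in B) (f x)%:E)%E].

(* Concavity of log f with values in R \cup {-oo}: lne maps 0 to -oo, and
   0 * -oo = 0, so the cases t = 0 and t = 1 are trivial as they should be. *)
Definition logconcave_fun (d : nat) (f : d.-tuple R -> R) : Prop :=
  forall (t : R) (x y : d.-tuple R), 0 <= t <= 1 ->
    (t%:E * lne (f x)%:E + (1 - t)%:E * lne (f y)%:E <=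
     lne (f [tuple t * tnth x i + (1 - t) * tnth y i | i < d])%:E)%E.

Definition logconcave_vector (d : nat) (X : {RV P >-> d.-tuple R}) : Prop :=
  exists2 f : d.-tuple R -> R, has_density X f & logconcave_fun f.

Definition identity_covariance (d : nat) (X : {RV P >-> d.-tuple R}) : Prop :=
  forall i j : 'I_d,
    ('E_P[fun w => (tnth (X w) i * tnth (X w) j)%R] -
     'E_P[fun w => tnth (X w) i] * 'E_P[fun w => tnth (X w) j])%E =
    ((i == j)%:R)%:E.

Definition mutually_independent (d n : nat)
    (X : 'I_n -> {RV P >-> d.-tuple R}) : Prop :=
  forall (J : {set 'I_n}) (B : 'I_n -> set (d.-tuple R)),
    (forall j, measurable (B j)) ->
    P (\bigcap_(j in [set` J]) (X j @^-1` B j)) =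
      (\prod_(j in J) P (X j @^-1` B j))%E.

End random_vectors.

Section integer_program.
Context {R : realType} {m n : nat}.
Variables (A : 'M[R]_(m, n)) (b : 'cV[R]_m) (c : 'cV[R]_n).

Definition objective (x : 'cV[R]_n) : R := (c^T *m x) 0 0.

Definition satisfies_constraints (x : 'cV[R]_n) : Prop :=
  forall k, (A *m x) k 0 <= b k 0.

Definition in_unit_cube (x : 'cV[R]_n) : Prop := forall i, 0 <= x i 0 <= 1.

Definition binary_vector (x : 'cV[R]_n) : Prop :=
  forall i, x i 0 = 0 \/ x i 0 = 1.

(* A node of the branch-and-bound tree is the list of branching decisions on
   the path from it to the root (most recent first): (i, beta) stands for
   x_i = beta. The root is [::] and the parent of h :: N is N. *)
Definition node : Type := seq ('I_n * bool).

Definition LP_feasible (N : node) : set 'cV[R]_n :=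
  [set x | [/\ in_unit_cube x, satisfies_constraints x
             & forall i beta, (i, beta) \in N -> x i 0 = beta%:R]].

Definition IP_feasible : set 'cV[R]_n :=
  [set x | binary_vector x /\ satisfies_constraints x].

(* The feasible sets are compact, so these suprema are maxima, except that
   they are -oo when the program is infeasible. *)
Definition node_value (N : node) : \bar R :=
  ereal_sup [set (objective x)%:E | x in LP_feasible N].

Definition val_LP : \bar R := node_value [::].

Definition val_IP : \bar R :=
  ereal_sup [set (objective x)%:E | x in IP_feasible].

Definition IPGAP : \bar R :=
  if `[< IP_feasible !=set0 >] then (val_LP - val_IP)%E else +oo%E.

(* The normals of the constraints that are tight at x, the others being
   replaced by zero rows. A fixing x_i = beta forces a bound on x_i to be
   tight, so it needs no separate row. *)
Definition tight_constraints (x : 'cV[R]_n) : 'M[R]_(m + n, n) :=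
  col_mx
    (\matrix_(k < m, j < n) (if (A *m x) k 0 == b k 0 then A k j else 0))
    (diag_mx (\row_(i < n) ((x i 0 == 0) || (x i 0 == 1))%:R)).

Definition optimal_basic_solution (N : node) (x : 'cV[R]_n) : Prop :=
  [/\ LP_feasible N x,
      forall y, LP_feasible N y -> objective y <= objective x
    & \rank (tight_constraints x) = n].

Record bb_state := BBState {
  bb_tree : seq node;
  bb_unprocessed : seq node;
  bb_solutions : seq 'cV[R]_n }.

Definition bb_init : bb_state := BBState [:: [::]] [:: [::]] [::].

Definition best_value (S : seq 'cV[R]_n) : \bar R :=
  (\big[maxe/-oo]_(x <- S) (objective x)%:E)%E.

Definition bb_select (U : seq node) (N : node) : Prop :=
  N \in U /\ forall N', N' \in U -> (node_value N' <= node_value N)%E.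

Inductive bb_step : bb_state -> bb_state -> Prop :=
| bb_prune T U S N :
    bb_select U N ->
    (LP_feasible N = set0 \/ (node_value N <= best_value S)%E) ->
    bb_step (BBState T U S) (BBState T (rem N U) S)
| bb_integral T U S N x :
    bb_select U N ->
    LP_feasible N !=set0 -> (best_value S < node_value N)%E ->
    optimal_basic_solution N x -> binary_vector x ->
    bb_step (BBState T U S) (BBState T (rem N U) (x :: S))
| bb_branch T U S N x i :
    bb_select U N ->
    LP_feasible N !=set0 -> (best_value S < node_value N)%E ->
    optimal_basic_solution N x -> 0 < x i 0 < 1 ->
    bb_step (BBState T U S)
      (BBState [:: (i, false) :: N, (i, true) :: N & T]
               [:: (i, false) :: N, (i, true) :: N & rem N U] S).

Inductive bb_reachable : bb_state -> Prop :=
| bb_reachable_init : bb_reachable bb_init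
| bb_reachable_step s s' :
    bb_reachable s -> bb_step s s' -> bb_reachable s'.

(* The bound holds whatever choices the algorithm makes (ties, optimal basic
   solutions, branching variables). It is required of the tree at every stage
   and not only when no unprocessed leaf remains: the tree never shrinks, and
   in this way no run escapes the bound by failing to stop. *)
Definition bb_tree_size_le (B : R) : Prop :=
  forall s, bb_reachable s -> (size (bb_tree s))%:R <= B.

End integer_program.

Section columns.
Context {R : realType} {m n : nat}.
Variable W : 'I_n -> m.+1.-tuple R.

Definition objective_of : 'cV[R]_n := \col_j tnth (W j) ord0.

Definition constraints_of : 'M[R]_(m, n) :=
  \matrix_(k < m, j < n) tnth (W j) (lift ord0 k).

End columns.

(* Main.v *)
Require Import Defs.
From HB Require Import structures.
From mathcomp Require Import all_boot all_order all_algebra.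
From mathcomp Require Import all_classical all_reals all_analysis.
From mathcomp Require Import measurable_realfun ring lra zify.

(* Branched nodes of the tree carry pairwise distinct optimal vertices of the
   root relaxation, each of value at least val_IP, hence within G of val_LP as
   soon as IPGAP < G. If u is an optimal dual solution with reduced costs r,
   such a vertex x satisfies sum_i |r_i| |x_i - [r_i > 0]| <= G. A vertex has at
   most m fractional coordinates and is recovered from these, its tight rows and
   the set of coordinates where it differs from [r_i > 0], so that up to a
   factor n^O(m) the tree is bounded by the number of sets of columns of total
   |r_i| at most G.

   An optimal u can be chosen basic, i.e. as the solution of a nonsingular m x m
   system given by at most m columns of (c; A), so that summing over the
   n^O(m) systems one may treat u as fixed and independent of the other columns
   w_i, for which r_i = (1, -u) . w_i. The expected number of sets of total cost
   at most G is then at most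
   exp(g G) prod_i (1 + E exp(-g |r_i|)) <= exp(g G + 2 n / g),
   that is exp(2 sqrt(2 n G)) for g = sqrt(2 n / G), and Markov's inequality
   concludes.

   The bound E exp(-g |r|) <= 2 / g holds because adding to r an independent
   Laplace variable of parameter g gives a density g / 2 * E exp(-g |r - a|) in
   a, which by Prekopa-Leindler is logconcave; its variance being at least 1, it
   is everywhere at most 1, the extreme case being an exponential law. *)

Set Implicit Arguments.
Unset Strict Implicit.
Unset Printing Implicit Defensive.
Import Order.TTheory GRing.Theory Num.Theory.
Import numFieldNormedType.Exports.
Local Open Scope classical_set_scope.
Local Open Scope ring_scope.

(** * Brunn-Minkowski inequality on the line *)

(** The density bound has to be sharp: a constant C in place of 1 would turn the exponent into 2
    sqrt(2 C n G). Laplace smoothing replaces the density of r, known only almost everywhere, by a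
    positive function phi defined at every point, whose mass and first two moments on a half-line
    are expectations of iterated primitives of the kernel. Logconcavity then enters only through
    phi(0) phi(x + u) <= phi(x) phi(u), integrated in x and u, so that neither derivatives nor a
    comparison with an exponential density are involved. This inequality at two successive levels,
    on both half-lines, leaves a polynomial inequality in seven real numbers.

    The optimal basis depends on all the columns, and conditioning on it would destroy their
    independence. All systems of m equations are therefore summed over, singular ones included, and
    the columns of a system get a trivial weight. This sum is a measurable function of the data,
    unlike what is known of the tree size, and so it carries the Markov inequality. *)

Section brunn_minkowski_line.
Context {R : realType}.
Local Notation mu := (@lebesgue_measure R).
Implicit Types A B C : set (measurableTypeR R).

Lemma measurable_affine (c d : R) :
  measurable_fun setT (fun x : measurableTypeR R => c * x + d : measurableTypeR R).
Proof.
apply: continuous_measurable_fun => x.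
by apply: cvgD; [apply: cvgM; [exact: cvg_cst|exact: cvg_id]|exact: cvg_cst].
Qed.

Lemma lebesgue_measure_affine (c d : R) A : 0 < c -> measurable A ->
  mu ((fun x => c * x + d) @^-1` A) = (c^-1%:E * mu A)%E.
Proof.
move=> c0 mA.
pose f := fun x : measurableTypeR R => c * x + d : measurableTypeR R.
pose nu : {measure set (measurableTypeR R) -> \bar R} :=
  mscale (NngNum (ltW c0)) (pushforward mu f).
have mf : measurable_fun setT f := measurable_affine c d.
have -> : mu A = nu mf A.
  apply: lebesgue_measure_unique => // _ [[a b]] _ <-.
  rewrite /nu /= /mscale /= /pushforward.
  have -> : f @^-1` `]a, b] = `](a - d) / c, (b - d) / c]%classic.
    by apply/seteqP; split => x /=; rewrite !in_itv/= ltr_pdivrMr// ler_pdivlMr//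
      /f (mulrC c) ltrBlDr lerBrDr.
  rewrite !lebesgue_measure_itv/= !lte_fin ltr_pM2r ?invr_gt0// ltrD2r.
  case: ifPn => // _; last by rewrite mule0.
  rewrite -EFinM; congr EFin; field; exact: lt0r_neq0.
by rewrite /nu /= /mscale /= /pushforward muleA -EFinM mulVf ?gt_eqF// mul1e.
Qed.

(** Replaces the maximum of [A], which need not be attained, in the classical argument where two
    sets are slid until they touch. *)
Lemma lebesgue_measure_sup_left A (r : R) : measurable A ->
  A !=set0 -> (r%:E < mu A)%E ->
  exists2 a, A a & (r%:E <= mu (A `&` `]-oo, a]))%E.
Proof.
move=> mA A0 rA; apply: contrapT => /forall2NP H.
(* Under the negated goal, half-lines ending below points of [A] cut off measure at most [r]. If
   they exhaust [A] up to a null set, continuity from below contradicts [rA]. The null set is the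
   point [sup A] when [A] is bounded above. *)
have key (q : R^nat) (N : set (measurableTypeR R)) :
    (forall n, exists2 a, A a & q n <= a) ->
    {homo q : x y / (x <= y)%N >-> x <= y} ->
    measurable N -> mu N = 0%E ->
    (forall x, A x -> N x \/ exists n, x <= q n) -> False.
  move=> qA ndq mN N0 cov.
  pose F n := A `&` `]-oo, q n].
  have mF n : measurable (F n) by exact: measurableI.
  have FR n : (mu (F n) <= r%:E)%E.
    have [a Aa qa] := qA n; have [//|/negP] := H a.
    rewrite -ltNge => /ltW; apply: le_trans; apply: le_measure; rewrite ?inE//.
      exact: measurableI.
    apply: setIS => x /=; rewrite !in_itv/= => /le_trans; exact.
  have ndF : nondecreasing_seq F.
    move=> n1 n2 n12; apply/subsetPset; apply: setIS => x /=.
    by rewrite !in_itv/= => /le_trans; apply; exact: ndq.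
  have cF := nondecreasing_cvg_mu (mu := mu) mF (bigcup_measurable (fun k _ => mF k)) ndF.
  have : (mu (\bigcup_n F n) <= r%:E)%E.
    rewrite -(cvg_lim _ cF)//; apply: lime_le; first exact: cvgP cF.
    by apply: nearW => n; exact: FR.
  apply/negP; rewrite -ltNge; apply: (lt_le_trans rA).
  apply: (@le_trans _ _ (mu (\bigcup_n F n `|` N))).
    apply: le_measure; rewrite ?inE//.
      by apply: measurableU => //; exact: bigcup_measurable.
    move=> x Ax; have [Nx|[n xq]] := cov _ Ax; first by right.
    by left; exists n => //; split => //=; rewrite in_itv.
  apply: le_trans (measureU2 _ _ _) _ => //; first exact: bigcup_measurable.
  by rewrite [X in (_ + X)%E]N0 adde0.
have [ubA|nubA] := pselect (has_ubound A).
- have supA : has_sup A by [].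
  apply: (key (fun n => sup A - n.+1%:R^-1) [set sup A]).
  + move=> n; have [|a Aa /ltW] := @sup_adherent _ _ n.+1%:R^-1 _ supA.
      by rewrite invr_gt0.
    by exists a.
  + by move=> x y xy; rewrite lerD2l lerN2 lef_pV2 ?posrE// ler_nat ltnS.
  + exact: measurable_set1.
  + exact: lebesgue_measure_set1.
  + move=> x Ax; have := ub_le_sup ubA Ax; rewrite le_eqVlt => /orP[/eqP|xs]; first by left.
    right; exists (Num.truncn (sup A - x)^-1).
    rewrite lerBrDl -lerBrDr; rewrite -subr_gt0 in xs.
    rewrite -[leRHS]invrK lef_pV2 ?posrE// ?invr_gt0//; exact/ltW/truncnS_gt.
- apply: (key (fun n => n%:R) set0) => //.
  + move=> n; apply: contrapT => /forall2NP h; apply: nubA; exists n%:R => x Ax.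
    by have [//|/negP] := h x; rewrite -ltNge => /ltW.
  + by move=> x y; rewrite ler_nat.
  + move=> x _; right; exists (Num.truncn x).+1; exact/ltW/truncnS_gt.
Qed.

Lemma lebesgue_measure_inf_right A (r : R) : measurable A -> A !=set0 ->
  (r%:E < mu A)%E -> exists2 a, A a & (r%:E <= mu (A `&` `[a, +oo[))%E.
Proof.
move=> mA [x Ax] rA.
have mN D : measurable D -> measurable ((-%R : R -> measurableTypeR R) @^-1` D).
  by move=> mD; rewrite -[X in measurable X]setTI; exact: (@oppr_measurable R setT).
have muN D : measurable D -> mu ((-%R : R -> measurableTypeR R) @^-1` D) = mu D.
  exact: lebesgue_measureN.
have [|||a Aa ra] := @lebesgue_measure_sup_left ((-%R : R -> measurableTypeR R) @^-1` A) r.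
- exact: mN.
- by exists (- x) => /=; rewrite opprK.
- by rewrite muN.
- exists (- a) => //; apply: (le_trans ra).
  rewrite -[leRHS]muN; last exact: measurableI.
  by rewrite preimage_setI opp_preimage_itvbndy opprK.
Qed.

(** Scaled copies of the part of [A] left of [a] and of the part of [B] right of [b], translated
    into [C], meet at most at [(1 - s) * a + s * b], so their measures add up. *)
Lemma brunn_minkowski_line (s : R) A B C : 0 < s < 1 ->
  measurable A -> measurable B -> measurable C -> A !=set0 -> B !=set0 ->
  (forall a b, A a -> B b -> C ((1 - s) * a + s * b)) ->
  ((1 - s)%:E * mu A + s%:E * mu B <= mu C)%E.
Proof.
move=> /andP[s0 s1] mA mB mC A0 B0 ABC.
have s1' : 0 < 1 - s by rewrite subr_gt0.
have main r1 r2 : (r1%:E < mu A)%E -> (r2%:E < mu B)%E ->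
    (((1 - s) * r1 + s * r2)%:E <= mu C)%E.
  move=> /(lebesgue_measure_sup_left mA A0)[a Aa r1a].
  move=> /(lebesgue_measure_inf_right mB B0)[b Bb r2b].
  have aff (c d : R) D : 0 < c -> measurable D ->
      measurable ((fun x => c^-1 * x + d) @^-1` D) /\
      mu ((fun x => c^-1 * x + d) @^-1` D) = (c%:E * mu D)%E.
    move=> c0 mD; rewrite lebesgue_measure_affine// ?invr_gt0// invrK; split=> //.
    by rewrite -[X in measurable X]setTI; exact: (@measurable_affine c^-1 d).
  pose p := (1 - s) * a + s * b.
  pose A1 := (fun x => (1 - s)^-1 * x + - ((1 - s)^-1 * (s * b))) @^-1` (A `&` `]-oo, a]).
  pose B1 := (fun x => s^-1 * x + - (s^-1 * ((1 - s) * a))) @^-1` (B `&` `[b, +oo[).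
  have [|mA1 muA1] := aff (1 - s) (- ((1 - s)^-1 * (s * b))) (A `&` `]-oo, a]) s1'.
    exact: measurableI.
  have [|mB1 muB1] := aff s (- (s^-1 * ((1 - s) * a))) (B `&` `[b, +oo[) s0.
    exact: measurableI.
  have EA z : (1 - s) * ((1 - s)^-1 * z - (1 - s)^-1 * (s * b)) + s * b = z.
    by field; exact: lt0r_neq0.
  have EB z : (1 - s) * a + s * (s^-1 * z - s^-1 * ((1 - s) * a)) = z.
    by field; exact: lt0r_neq0.
  have leA z : A1 z -> z <= p.
    move=> [_ /=]; rewrite in_itv/= => za; rewrite -[z]EA lerD2r.
    by rewrite ler_wpM2l// ltW.
  have geB z : B1 z -> p <= z.
    move=> [_ /=]; rewrite in_itv/= andbT => za; rewrite -[leRHS]EB lerD2l.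
    by rewrite ler_wpM2l// ltW.
  have A1C : A1 `<=` C by move=> z [Az _]; rewrite -[z]EA; exact: ABC.
  have B1C : B1 `<=` C by move=> z [Bz _]; rewrite -[z]EB; exact: ABC.
  have mp : measurable [set p : measurableTypeR R] by exact: measurable_set1.
  have mB1p : measurable (B1 `\ p) by exact: measurableD.
  have muB1p : mu (B1 `\ p) = mu B1.
    apply/eqP; rewrite eq_le; apply/andP; split.
      by apply: le_measure; rewrite ?inE//; exact: subDsetl.
    apply: (@le_trans _ _ (mu ((B1 `\ p) `|` [set p]))).
      apply: le_measure; rewrite ?inE//; first exact: measurableU.
      by move=> z Bz; have [->|/eqP zp] := eqVneq z p; [right|left].
    apply: le_trans (measureU2 _ _ _) _ => //.
    by rewrite [X in (_ + X)%E]lebesgue_measure_set1 adde0.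
  apply: (@le_trans _ _ (mu (A1 `|` (B1 `\ p)))); last first.
    apply: le_measure; rewrite ?inE//; first exact: measurableU.
    by move=> z [/A1C//|[/B1C]].
  rewrite measureU//; last first.
    apply/seteqP; split => // z [/leA zp [/geB pz]] /= np; apply: np.
    by apply/eqP; rewrite eq_le zp pz.
  rewrite [X in (_ + X)%E]muB1p [X in (X + _)%E]muA1 [X in (_ + X)%E]muB1 EFinD !EFinM.
  by apply: leeD; apply: lee_wpmul2l => //; rewrite lee_fin ltW.
have [->|Coo] := eqVneq (mu C) +oo%E; first by rewrite leey.
have Cfin : mu C \is a fin_num by rewrite ge0_fin_numE// ltey.
have Afin : mu A \is a fin_num.
  rewrite ge0_fin_numE// ltey; apply/eqP => Aoo.
  (* With these two minorants the left-hand side of [main] is [mu C + 1]. *)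
  have := main ((1 - s)^-1 * (fine (mu C) + 1 + s)) (-1).
  rewrite Aoo ltey//= => /(_ isT); rewrite (@lt_le_trans _ _ 0%E)//.
  move=> /(_ isT); rewrite -[X in (_ <= X)%E -> _]fineK// lee_fin mulrA divff ?lt0r_neq0// .
  lra.
have Bfin : mu B \is a fin_num.
  rewrite ge0_fin_numE// ltey; apply/eqP => Boo.
  have := main (-1) (s^-1 * (fine (mu C) + 1 + (1 - s))).
  rewrite Boo ltey//= (@lt_le_trans _ _ 0%E)// => /(_ isT isT).
  rewrite -[X in (_ <= X)%E -> _]fineK// lee_fin mulrA divff ?lt0r_neq0//.
  lra.
move: main; rewrite -(fineK Afin) -(fineK Bfin) -(fineK Cfin) -!EFinM -EFinD.
set a := fine _; set b := fine _; set c := fine _ => main.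
rewrite lee_fin; apply/ler_addgt0Pr => e e0.
have := main (a - e) (b - e); rewrite !lte_fin !lee_fin !gtrBl => /(_ e0 e0).
lra.
Qed.

End brunn_minkowski_line.

(** * Prekopa-Leindler inequality *)

Section layer_cake.
Context {R : realType} d (T : measurableType d).
Variable mu : {sigma_finite_measure set T -> \bar R}.
Local Notation leb := (@lebesgue_measure R).
Variables (f : T -> \bar R) (K : R).
Hypotheses (mf : measurable_fun setT f) (f0 : forall x, (0 <= f x)%E) (K0 : 0 < K).

(** Heights are measured in units of [K] and cut at 1, so that functions with different suprema have
    their levels indexed by the same interval. *)
Definition subgraph : set (measurableTypeR R * T) :=
  [set p | 0 < p.1 < 1 /\ ((p.1 * K)%:E < f p.2)%E].

Lemma measurable_subgraph : measurable subgraph.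
Proof.
have m1 : measurable_fun setT (fun p : measurableTypeR R * T => (p.1 : R)).
  exact: (@measurable_fst _ _ (measurableTypeR R) T).
have -> : subgraph = ((fun p : measurableTypeR R * T => (p.1 : R)) @^-1` `]0, 1[) `&`
    (setT `&` [set p | ((p.1 * K)%:E < f p.2)%E]).
  by rewrite setTI; apply/seteqP; split => p /=; rewrite in_itv.
apply: measurableI.
  rewrite -[X in measurable X]setTI; apply: m1 => //.
apply: measurable_lte => //.
  by apply/measurable_EFinP; apply: measurable_funM.
exact: measurableT_comp.
Qed.

Lemma xsection_subgraph t : xsection subgraph t =
  if 0 < t < 1 then [set x | ((t * K)%:E < f x)%E] else set0.
Proof.
apply/seteqP; split => x /=; rewrite /xsection /subgraph /= inE.
  by case => /= -> .
by case: ifPn.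
Qed.

Lemma ysection_subgraph_le x : (leb (ysection subgraph x) <= K^-1%:E * f x)%E.
Proof.
have /= := f0 x; case fx : (f x) => [r| |]// r0; last first.
  by rewrite gt0_muley ?lte_fin ?invr_gt0// leey.
have Y0 : ysection subgraph x `<=` `]0, r / K[%classic.
  move=> t; rewrite /ysection /subgraph /= inE /= fx => -[/andP[t0 _]].
  by rewrite lte_fin in_itv /= t0 ltr_pdivlMr.
apply: (@le_trans _ _ (leb `]0, r / K[%classic)).
  apply: le_measure; rewrite ?inE//; apply: measurable_ysection; exact: measurable_subgraph.
rewrite lebesgue_measure_itv/= lte_fin; case: ifPn => _.
  by rewrite -EFinM lee_fin subr0 mulrC.
by rewrite -EFinM lee_fin mulr_ge0// invr_ge0 ltW.
Qed.

Lemma ysection_subgraph_eq x : (f x <= K%:E)%E ->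
  leb (ysection subgraph x) = (K^-1%:E * f x)%E.
Proof.
have /= := f0 x; case fx : (f x) => [r| |]// r0; rewrite lee_fin => rK.
have -> : ysection subgraph x = `]0, r / K[%classic.
  apply/seteqP; split => t; rewrite /ysection /subgraph /= inE /= fx lte_fin in_itv/=.
    by move=> [/andP[-> _]]; rewrite ltr_pdivlMr.
  move=> /andP[-> tr]; split; last by rewrite -ltr_pdivlMr.
  by rewrite (lt_le_trans tr)// ler_pdivrMr// mul1r.
rewrite lebesgue_measure_itv/= lte_fin; case: ifPn => [_|].
  by rewrite sube0 -EFinM mulrC.
rewrite -leNgt -EFinM => rK0; congr EFin; apply/eqP; rewrite mulrC eq_le rK0 andbT.
by rewrite mulr_ge0// invr_ge0 ltW.
Qed.

Lemma integral_subgraph :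
  (\int[leb]_t mu (xsection subgraph t) = \int[mu]_x leb (ysection subgraph x))%E.
Proof.
have := indic_fubini_tonelli leb mu measurable_subgraph.
rewrite (indic_fubini_tonelli_FE mu measurable_subgraph).
by rewrite (indic_fubini_tonelli_GE leb measurable_subgraph).
Qed.

(** Only an inequality, because values above [K] are cut off. It serves for the dominating function,
    on which no upper bound is available. *)
Lemma integral_subgraph_le :
  (\int[leb]_t mu (xsection subgraph t) <= K^-1%:E * \int[mu]_x f x)%E.
Proof.
rewrite integral_subgraph -ge0_integralZl_EFin//; last by rewrite invr_ge0 ltW.
apply: ge0_le_integral => //.
- exact: (measurable_fun_ysection leb measurable_subgraph).
- exact: measurable_funeM.
- by move=> x _; exact: ysection_subgraph_le.
Qed.

Lemma integral_subgraph_eq : (forall x, f x <= K%:E)%E ->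
  (\int[leb]_t mu (xsection subgraph t) = K^-1%:E * \int[mu]_x f x)%E.
Proof.
move=> fK.
rewrite integral_subgraph -ge0_integralZl_EFin//; last by rewrite invr_ge0 ltW.
by apply: eq_integral => x _; exact: ysection_subgraph_eq.
Qed.

End layer_cake.

Lemma powR_amgm (R : realType) (s x y : R) : 0 < s < 1 -> 0 <= x -> 0 <= y ->
  x `^ (1 - s) * y `^ s <= (1 - s) * x + s * y.
Proof.
move=> /andP[s0 s1] x0 y0; have s10 : 0 < 1 - s by rewrite subr_gt0.
have [->|xN] := eqVneq x 0.
  by rewrite powR0 ?gt_eqF// mul0r mulr0 add0r mulr_ge0// ltW.
have [->|yN] := eqVneq y 0.
  by rewrite powR0 ?gt_eqF// !mulr0 addr0 mulr_ge0// ltW.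
have {}x0 : 0 < x by rewrite lt_neqAle eq_sym xN.
have {}y0 : 0 < y by rewrite lt_neqAle eq_sym yN.
have h : 0 <= 1 - s <= 1 by rewrite (ltW s10) gerBl ltW.
have := @concave_ln R (Itv01 (proj1 (andP h)) (proj2 (andP h))) x y x0 y0.
have es : 1 - (1 - s) = s by ring.
rewrite !convRE /= /unstable.onem es => H.
rewrite /powR (gt_eqF x0) (gt_eqF y0) -expRD -[leRHS]lnK; last first.
  by rewrite posrE addr_gt0// mulr_gt0.
by rewrite ler_expR.
Qed.

Section prekopa_leindler.
Context {R : realType}.
Local Notation leb := (@lebesgue_measure R).

(* w dominates the weighted geometric mean u ^ (1 - s) * v ^ s, stated through
   real minorants of u and v so as to make sense in [0, +oo] *)
Definition geomean_le (s : R) (u v w : \bar R) : Prop :=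
  forall r0 r1 : R, 0 < r0 -> 0 < r1 -> (r0%:E < u)%E -> (r1%:E < v)%E ->
    ((r0 `^ (1 - s) * r1 `^ s)%:E <= w)%E.

(** In units of their suprema [f0] and [f1] have nonempty levels for every [t < 1], as
    Brunn-Minkowski requires, and the level of [h] at [t * c] contains the combination of theirs.
    Integration in [t] bounds an arithmetic mean of normalised integrals, hence their geometric
    mean. *)
Lemma prekopa_leindler_line_bounded (s M0 M1 : R)
    (f0 f1 h : measurableTypeR R -> \bar R) : 0 < s < 1 ->
  measurable_fun setT f0 -> measurable_fun setT f1 -> measurable_fun setT h ->
  (forall x, 0 <= f0 x)%E -> (forall x, 0 <= f1 x)%E -> (forall x, 0 <= h x)%E ->
  0 < M0 -> 0 < M1 ->
  ereal_sup (range f0) = M0%:E -> ereal_sup (range f1) = M1%:E ->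
  (forall x y, geomean_le s (f0 x) (f1 y) (h ((1 - s) * x + s * y))) ->
  geomean_le s (\int[leb]_x f0 x)%E (\int[leb]_x f1 x)%E (\int[leb]_x h x)%E.
Proof.
move=> s01 mf0 mf1 mh f00 f10 h0 M00 M10 supf0 supf1 H.
have /andP[s0 s1] := s01.
have s10 : 0 < 1 - s by rewrite subr_gt0.
pose c := M0 `^ (1 - s) * M1 `^ s.
have c0 : 0 < c by rewrite mulr_gt0// powR_gt0.
have leM0 x : (f0 x <= M0%:E)%E by rewrite -supf0; apply: ereal_sup_ubound; exists x.
have leM1 x : (f1 x <= M1%:E)%E by rewrite -supf1; apply: ereal_sup_ubound; exists x.
have nonempty (f : R -> \bar R) (M t : R) : 0 < M -> ereal_sup (range f) = M%:E ->
    t < 1 -> [set x | ((t * M)%:E < f x)%E] !=set0.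
  move=> M_gt0 supf t1; have : ((t * M)%:E < ereal_sup (range f))%E.
    by rewrite supf lte_fin gtr_pMl.
  by move=> /ereal_sup_gt[_ [x _ <-] tx]; exists x.
have lev t : ((1 - s)%:E * leb (xsection (subgraph f0 M0) t) +
    s%:E * leb (xsection (subgraph f1 M1) t) <= leb (xsection (subgraph h c) t))%E.
  rewrite !xsection_subgraph; case: ifPn => [/andP[t0 t1]|_]; last first.
    by rewrite !measure0 !mule0 adde0.
  have mlev (f : measurableTypeR R -> \bar R) (r : R) : measurable_fun setT f ->
      measurable [set x | (r%:E < f x)%E].
    by move=> mf; rewrite -[X in measurable X]setTI; exact: measurable_lte.
  apply: brunn_minkowski_line => //; [exact: mlev..|exact: nonempty|exact: nonempty|].
  move=> a b /= fa fb.
  (* A real strictly between the level and the value makes the lower bound on [h] strict, as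
     membership in its level demands. *)
  have getr (f : \bar R) (r : R) : 0 < r -> (r%:E < f)%E ->
      exists2 r' : R, r < r' & (r'%:E < f)%E.
    move=> r_gt0; case: f => [q| |]//; rewrite ?lte_fin => rq.
      by exists ((r + q) / 2); rewrite ?lte_fin; lra.
    by exists (r + 1); rewrite ?ltey// ltrDl.
  have tM0 : 0 < t * M0 by rewrite mulr_gt0.
  have tM1 : 0 < t * M1 by rewrite mulr_gt0.
  have [r0 tr0 r0f] := getr _ _ tM0 fa.
  have [r1 tr1 r1f] := getr _ _ tM1 fb.
  have := H a b r0 r1 (lt_trans tM0 tr0) (lt_trans tM1 tr1) r0f r1f.
  apply: lt_le_trans; rewrite lte_fin.
  have -> : t * c = (t * M0) `^ (1 - s) * (t * M1) `^ s.
    rewrite !powRM ?ltW// mulrACA -powRD; last by apply/implyP => _; rewrite gt_eqF.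
    by rewrite subrK powRr1// ltW.
  by apply: ltr_pM; rewrite ?powR_ge0// gt0_ltr_powR// nnegrE ltW// (lt_trans _ tr0, lt_trans _ tr1).
have mlev (f : measurableTypeR R -> \bar R) M : measurable_fun setT f ->
    measurable_fun setT (fun t => leb (xsection (subgraph f M) t)).
  by move=> mf; apply: measurable_fun_xsection; exact: measurable_subgraph.
have key : ((1 - s)%:E * (M0^-1%:E * \int[leb]_x f0 x) +
    s%:E * (M1^-1%:E * \int[leb]_x f1 x) <= c^-1%:E * \int[leb]_x h x)%E.
  apply: (le_trans _ (integral_subgraph_le leb mh h0 c0)).
  rewrite -(integral_subgraph_eq leb mf0)// -(integral_subgraph_eq leb mf1)//.
  rewrite -!ge0_integralZl_EFin// ?(ltW s0) ?(ltW s10)//; [|exact: mlev..].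
  rewrite -ge0_integralD//; last 4 first.
  - by move=> t _; rewrite mule_ge0// lee_fin ltW.
  - by apply: measurable_funeM; exact: mlev.
  - by move=> t _; rewrite mule_ge0// lee_fin ltW.
  - by apply: measurable_funeM; exact: mlev.
  apply: ge0_le_integral => //.
  - by move=> t _; rewrite adde_ge0// mule_ge0// lee_fin ltW.
  - by apply: emeasurable_funD; apply: measurable_funeM; exact: mlev.
  - exact: mlev.
  - by move=> t _; exact: lev.
move=> r0 r1 r0_gt0 r1_gt0 /ltW r0f /ltW r1f.
have : (((1 - s) * (M0^-1 * r0) + s * (M1^-1 * r1))%:E <= c^-1%:E * \int[leb]_x h x)%E.
  apply: le_trans key; rewrite EFinD !EFinM.
  have pos (a : R) : 0 < a -> (0 <= a%:E)%E by move=> /ltW.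
  apply: leeD; apply: lee_wpmul2l => //; try exact: pos.
    by apply: lee_wpmul2l => //; apply: pos; rewrite invr_gt0.
  by apply: lee_wpmul2l => //; apply: pos; rewrite invr_gt0.
rewrite lee_pdivlMl// -EFinM; apply: le_trans; rewrite lee_fin.
have -> : r0 `^ (1 - s) * r1 `^ s =
    c * ((M0^-1 * r0) `^ (1 - s) * (M1^-1 * r1) `^ s).
  rewrite /c mulrACA -!powRM ?mulr_ge0 ?invr_ge0 ?ltW//.
  by rewrite !mulrA !mulfV ?gt_eqF// !mul1r.
rewrite ler_pM2l//; apply: powR_amgm => //; rewrite mulr_ge0// ?invr_ge0 ltW//.
Qed.

(** Truncation at a large [n] makes the suprema finite, while by monotone convergence the integrals
    still exceed the given minorants. *)
Lemma prekopa_leindler_line (s : R) (f0 f1 h : measurableTypeR R -> \bar R) :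
  0 < s < 1 ->
  measurable_fun setT f0 -> measurable_fun setT f1 -> measurable_fun setT h ->
  (forall x, 0 <= f0 x)%E -> (forall x, 0 <= f1 x)%E -> (forall x, 0 <= h x)%E ->
  (forall x y, geomean_le s (f0 x) (f1 y) (h ((1 - s) * x + s * y))) ->
  geomean_le s (\int[leb]_x f0 x)%E (\int[leb]_x f1 x)%E (\int[leb]_x h x)%E.
Proof.
move=> s01 mf0 mf1 mh f00 f10 h0 H r0 r1 r0_gt0 r1_gt0 r0f r1f.
have trunc (f : measurableTypeR R -> \bar R) (r : R) : 0 < r -> measurable_fun setT f ->
    (forall x, 0 <= f x)%E -> (r%:E < \int[leb]_x f x)%E ->
    exists g : measurableTypeR R -> \bar R, exists2 M : R, 0 < M &
    [/\ measurable_fun setT g, (forall x, 0 <= g x <= f x)%E,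
       ereal_sup (range g) = M%:E & (r%:E < \int[leb]_x g x)%E].
  move=> r_gt0 mf f_ge0 rf.
  pose g n x := mine (f x) n%:R%:E.
  have mg n : measurable_fun setT (g n) by apply: measurable_mine.
  have g0 n x : (0 <= g n x)%E by rewrite le_min f_ge0 lee_fin /=.
  have ndg x : {homo g^~ x : n m / (n <= m)%N >-> (n <= m)%E}.
    move=> n m nm; rewrite le_min ge_min lexx/= ge_min.
    by rewrite lee_fin ler_nat nm orbT.
  have gf x : limn (g^~ x) = f x.
    apply/cvg_lim => //; case fx : (f x) => [q| |].
    - apply: (@cvg_near_cst) => //; near=> n; rewrite /g fx; apply/min_idPl.
      by rewrite lee_fin; near: n; exact: nbhs_infty_ger.
    - rewrite /g (_ : (fun n => _) = (fun n => n%:R%:E)).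
        by apply/cvgenyP; exact: cvg_id.
      by apply/funext => n; rewrite fx minye.
    - by have := f_ge0 x; rewrite fx.
  have := @cvg_monotone_convergence _ _ R leb setT measurableT g mg
    (fun n x _ => g0 n x) (fun x _ => ndg x).
  under eq_integral do rewrite gf.
  move=> cg.
  have [n rgn] : exists n, (r%:E < \int[leb]_x g n x)%E.
    apply: contrapT => /forallNP h'.
    have : (\int[leb]_x f x <= r%:E)%E.
      rewrite -(cvg_lim _ cg)//; apply: lime_le; first exact: cvgP cg.
      by apply: nearW => n; rewrite leNgt; exact/negP/h'.
    by rewrite leNgt rf.
  have supge : (0 <= ereal_sup (range (g n)))%E.
    by apply: (@le_trans _ _ (g n 0)) => //; apply: ereal_sup_ubound; exists 0.
  have supfin : ereal_sup (range (g n)) \is a fin_num.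
    rewrite ge0_fin_numE//; apply: (@le_lt_trans _ _ n%:R%:E); last exact: ltry.
    by apply: ge_ereal_sup => _ [x _ <-]; rewrite ge_min lexx orbT.
  exists (g n), (fine (ereal_sup (range (g n)))); last first.
    split => //; last by rewrite fineK.
    by move=> x; rewrite g0/= ge_min lexx.
  (* A zero supremum would make the truncated integral vanish, although it exceeds [r > 0]. *)
  rewrite lt_neqAle fine_ge0// andbT; apply/eqP => M0.
  move: rgn; rewrite (_ : \int[leb]_x g n x = 0)%E; first by rewrite lte_fin ltNge ltW.
  apply: integral0_eq => x _; apply/eqP; rewrite eq_le g0 andbT.
  have : (g n x <= ereal_sup (range (g n)))%E by apply: ereal_sup_ubound; exists x.
  by rewrite -(fineK supfin) -M0.
have [g0 [M0 M0_gt0 [mg0 g0P supg0 rg0]]] := trunc _ _ r0_gt0 mf0 f00 r0f.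
have [g1 [M1 M1_gt0 [mg1 g1P supg1 rg1]]] := trunc _ _ r1_gt0 mf1 f10 r1f.
apply: (prekopa_leindler_line_bounded s01 mg0 mg1 mh _ _ h0 M0_gt0 M1_gt0 supg0 supg1) => //.
- by move=> x; have /andP[] := g0P x.
- by move=> x; have /andP[] := g1P x.
move=> x y q0 q1 q0_gt0 q1_gt0 gx gy; apply: (H x y q0 q1) => //.
- by apply: (lt_le_trans gx); have /andP[] := g0P x.
- by apply: (lt_le_trans gy); have /andP[] := g1P y.
Unshelve. all: by end_near. Qed.

End prekopa_leindler.

Section prekopa_leindler_tuple.
Context {R : realType}.
Local Notation leb := (@lebesgue_measure R).
Local Notation lebt := (lebesgue_tuple R).

Lemma integral_lebesgue_tupleS d (F : d.+1.-tuple R -> \bar R) :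
  measurable_fun setT F -> (forall x, 0 <= F x)%E ->
  (\int[lebt d.+1]_x F x = \int[leb]_a \int[lebt d]_t F (tuple_cons (a, t)))%E.
Proof.
move=> mF F0.
have mc := @measurable_tuple_cons R d.
have -> : (\int[lebt d.+1]_x F x =
    \int[pushforward (leb \x lebt d)%E (@tuple_cons R d)]_x F x)%E.
  by apply: eq_measure_integral => A mA _.
rewrite ge0_integral_pushforward// preimage_setT.
rewrite (fubini_tonelli1 (F \o @tuple_cons R d))//; last first.
  by move=> x; exact: F0.
exact: measurableT_comp.
Qed.

Definition conv_tuple d (s : R) (x y : d.-tuple R) : d.-tuple R :=
  [tuple (1 - s) * tnth x i + s * tnth y i | i < d].

Lemma conv_tuple_cons d (s a b : R) (t u : d.-tuple R) :
  conv_tuple s (tuple_cons (a, t)) (tuple_cons (b, u)) =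
  tuple_cons ((1 - s) * a + s * b, conv_tuple s t u).
Proof.
apply: eq_from_tnth => i; rewrite tnth_mktuple.
by case: (unliftP ord0 i) => [j ->|->]; rewrite ?tnthS ?tnth_mktuple.
Qed.

Lemma measurable_tuple_consr d (a : R) :
  measurable_fun setT (fun t : d.-tuple R => tuple_cons (a, t)).
Proof. exact: (measurable_cons (measurable_cst _) (@measurable_id _ _ _)). Qed.

(** The conclusion for the last [d] coordinates is the pointwise hypothesis of the line case in the
    first one; [geomean_le] keeps its meaning there when an inner integral is infinite. *)
Lemma prekopa_leindler d (s : R) (f0 f1 h : d.-tuple R -> \bar R) : 0 < s < 1 ->
  measurable_fun setT f0 -> measurable_fun setT f1 -> measurable_fun setT h ->
  (forall x, 0 <= f0 x)%E -> (forall x, 0 <= f1 x)%E -> (forall x, 0 <= h x)%E ->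
  (forall x y, geomean_le s (f0 x) (f1 y) (h (conv_tuple s x y))) ->
  geomean_le s (\int[lebt d]_x f0 x)%E (\int[lebt d]_x f1 x)%E
               (\int[lebt d]_x h x)%E.
Proof.
move=> s01; elim: d f0 f1 h => [|d IH] f0 f1 h mf0 mf1 mh f00 f10 h0 H.
  rewrite /= !integral_dirac// !diracT !mul1e.
  have -> : h [tuple] = h (conv_tuple s [tuple] [tuple]) 
    by congr h; apply: eq_from_tnth => -[].
  exact: H.
have mI (F : d.+1.-tuple R -> \bar R) : measurable_fun setT F ->
    (forall x, 0 <= F x)%E ->
    measurable_fun setT (fun a : measurableTypeR R => \int[lebt d]_t F (tuple_cons (a, t)))%E.
  move=> mF F0.
  apply: (@measurable_fun_fubini_tonelli_F _ _ (measurableTypeR R) _ R (lebt d) (F \o @tuple_cons R d)).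
    by apply: measurableT_comp => //; exact: measurable_tuple_cons.
  by move=> x; exact: F0.
rewrite !integral_lebesgue_tupleS//.
apply: prekopa_leindler_line => //; [exact: mI..| | | |]; try by move=> x; apply: integral_ge0.
move=> a b; apply: IH => //.
1-3: by apply: measurableT_comp => //; exact: measurable_tuple_consr.
by move=> t u; rewrite -conv_tuple_cons; exact: H.
Qed.

End prekopa_leindler_tuple.

(** * Marginals of logconcave densities *)

Section logconcave_kernel.
Context {R : realType}.
Local Notation leb := (@lebesgue_measure R).

Definition logconcave_kernel (g : R -> R) : Prop :=
  forall s x y : R, 0 < s < 1 ->
    g x `^ (1 - s) * g y `^ s <= g ((1 - s) * x + s * y).

(** The strict minorants [t * u] and [t * v] lose exactly the factor [t], since the exponents sum to
    1, and [t < 1] is arbitrary. *)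
Lemma geomean_le_powR (s u v : R) (w : \bar R) : 0 < s < 1 -> 0 < u -> 0 < v ->
  geomean_le s u%:E v%:E w -> ((u `^ (1 - s) * v `^ s)%:E <= w)%E.
Proof.
move=> s01 u0 v0 H; apply/lee_mul01Pr.
  by rewrite lee_fin mulr_ge0// powR_ge0.
move=> t /andP[t0 t1]; rewrite -EFinM.
have := H (t * u) (t * v); rewrite !mulr_gt0// !lte_fin !gtr_pMl// t1.
move=> /(_ isT isT isT isT); rewrite !powRM ?(ltW t0) ?(ltW u0) ?(ltW v0)// mulrACA -powRD; last first.
  by apply/implyP => _; rewrite gt_eqF.
by rewrite subrK powRr1 ?(ltW t0).
Qed.

(** Both [x] and [u] are convex combinations of 0 and [x + u], with weights exchanged; in the
    product of the two inequalities the exponents of each factor sum to 1. *)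
Lemma logconcave_kernel_four_points (g : R -> R) (x u : R) :
  (forall y, 0 < g y) -> logconcave_kernel g -> 0 <= x -> 0 <= u ->
  g 0 * g (x + u) <= g x * g u.
Proof.
move=> g0 lg; rewrite le_eqVlt => /orP[/eqP<-|x0]; first by rewrite add0r.
rewrite le_eqVlt => /orP[/eqP<-|u0]; first by rewrite addr0 mulrC.
have xu0 : 0 < x + u by rewrite addr_gt0.
pose s := x / (x + u).
have s01 : 0 < s < 1 by rewrite divr_gt0//= ltr_pdivrMr// mul1r ltrDl.
have s01' : 0 < 1 - s < 1 by case/andP: s01 => *; apply/andP; split; lra.
have H1 := lg s 0 (x + u) s01.
have H2 := lg (1 - s) 0 (x + u) s01'.
have e1 : (1 - s) * 0 + s * (x + u) = x by rewrite /s; field; exact: lt0r_neq0.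
have e2 : (1 - (1 - s)) * 0 + (1 - s) * (x + u) = u.
  by rewrite /s; field; exact: lt0r_neq0.
rewrite e1 in H1; rewrite e2 in H2.
apply: le_trans (ler_pM _ _ H1 H2); rewrite ?mulr_ge0 ?powR_ge0//.
rewrite mulrACA -!powRD ?(gt_eqF (g0 _)) ?implybT//.
by rewrite !subrKC !powRr1 ?(ltW (g0 _)).
Qed.

Context dO (Omega : measurableType dO) (P : probability Omega R) (d : nat).
Variable X : {RV P >-> d.-tuple R}.

(** [has_density] only speaks of sets. The Radon-Nikodym derivative of the law has the same integral
    as [f] over every measurable set, so the two agree almost everywhere. *)
Lemma ge0_integral_density (f : d.-tuple R -> R) (g : d.-tuple R -> \bar R) :
  has_density X f -> measurable_fun setT g -> (forall x, 0 <= g x)%E ->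
  (\int[P]_w g (X w) = \int[lebesgue_tuple R d]_x (g x * (f x)%:E))%E.
Proof.
move=> [mf f0 fE] mg g0.
rewrite -[LHS]/(\int[P]_w (g \o X) w)%E -ge0_integral_distribution//.
pose nu : {finite_measure set (d.-tuple R) -> \bar R} := distribution P X.
pose mu := lebesgue_tuple R d.
have dom : nu `<< mu.
  apply/null_content_dominatesP => A mA A0; rewrite /nu /= fE//.
  by apply: null_set_integral => //; exact/measurable_funTS/measurable_EFinP.
rewrite -(Radon_Nikodym_SigmaFinite.change_of_variables dom)//.
have mrn := Radon_Nikodym_SigmaFinite.f_integrable dom.
apply: ae_eq_integral => //.
- by apply: emeasurable_funM => //; exact: measurable_int mrn.
- by apply: emeasurable_funM => //; exact/measurable_EFinP.
apply: ae_eqe_mul2l; apply: integral_ae_eq => //; first exact/measurable_EFinP.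
by move=> E _ mE; rewrite -fE// -Radon_Nikodym_SigmaFinite.f_integral.
Qed.

Lemma logconcave_funP (f : d.-tuple R -> R) (s : R) (x y : d.-tuple R) :
  (forall z, 0 <= f z) -> logconcave_fun f -> 0 < s < 1 ->
  f x `^ (1 - s) * f y `^ s <= f (conv_tuple s x y).
Proof.
move=> f0 lf /andP[s0 s1].
have s10 : 0 < 1 - s by rewrite subr_gt0.
have [fx|fx] := eqVneq (f x) 0; first by rewrite fx powR0 ?gt_eqF// mul0r.
have [fy|fy] := eqVneq (f y) 0; first by rewrite fy powR0 ?gt_eqF// mulr0.
have {}fx : 0 < f x by rewrite lt_neqAle eq_sym fx f0.
have {}fy : 0 < f y by rewrite lt_neqAle eq_sym fy f0.
have := lf (1 - s) x y; rewrite (ltW s10) gerBl (ltW s0) => /(_ isT).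
have -> : 1 - (1 - s) = s by ring.
rewrite -/(conv_tuple s x y); set z := conv_tuple s x y.
rewrite (lne_EFin fx) (lne_EFin fy) -!EFinM -EFinD.
have [fz|fz] := eqVneq (f z) 0; first by rewrite fz le0_lneNy// leeNy_eq.
have {}fz : 0 < f z by rewrite lt_neqAle eq_sym fz f0.
rewrite lne_EFin// lee_fin => H.
rewrite -[leRHS]lnK ?posrE//; rewrite -ler_expR expRD in H.
by rewrite /powR (gt_eqF fx) (gt_eqF fy).
Qed.

Definition dot (theta : 'I_d -> R) (x : d.-tuple R) : R :=
  \sum_i theta i * tnth x i.

Lemma measurable_dot theta : measurable_fun setT (dot theta).
Proof.
apply: measurable_sum => i; apply: measurable_funM => //; exact: measurable_tnth.
Qed.

Lemma dot_conv_tuple theta s x y :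
  dot theta (conv_tuple s x y) = (1 - s) * dot theta x + s * dot theta y.
Proof.
rewrite /dot !mulr_sumr -big_split/=; apply: eq_bigr => i _.
by rewrite tnth_mktuple; ring.
Qed.

Variables (k : R -> R) (B : R).
Hypotheses (mk : measurable_fun setT k) (k0 : forall y, 0 < k y) (kB : forall y, k y <= B).
Variable theta : 'I_d -> R.

Let mkX a : measurable_fun setT (fun w => (k (dot theta (X w) - a))%:E).
Proof.
apply/measurable_EFinP; apply: measurableT_comp => //; apply: measurable_funB => //.
apply: measurableT_comp => //; exact: measurable_dot.
Qed.

Lemma integral_kernel_fin_num a :
  (\int[P]_w (k (dot theta (X w) - a))%:E)%E \is a fin_num.
Proof.
rewrite ge0_fin_numE; last by apply: integral_ge0 => w _; rewrite lee_fin ltW.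
apply: (@le_lt_trans _ _ (\int[P]_w (B%:E))%E).
  apply: ge0_le_integral => //; first by move=> w _; rewrite lee_fin ltW.
  by move=> w _; rewrite lee_fin.
by rewrite integral_cst// [X in (_ * X)%E]probability_setT mule1 ltry.
Qed.

Lemma integral_kernel_gt0 a : (0 < \int[P]_w (k (dot theta (X w) - a))%:E)%E.
Proof.
rewrite lt_neqAle integral_ge0 ?andbT; last by move=> w _; rewrite lee_fin ltW.
apply/eqP => /esym I0.
have : (\int[P]_w `|(k (dot theta (X w) - a))%:E| = 0)%E.
  by rewrite -[RHS]I0; apply: eq_integral => w _; rewrite gee0_abs// lee_fin ltW.
move=> /(ae_eq_integral_abs P measurableT (mkX a))[N [mN N0 sub]].
have : (P setT <= P N)%E.
  apply: le_measure; rewrite ?inE// => w _; apply: sub => /= /(_ I) /eqP.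
  by rewrite eqe gt_eqF.
by rewrite probability_setT N0 lee_fin ler10.
Qed.

(** Against [f] the integrand is logconcave jointly in the vector and in [a], a linear form being
    affine, and Prekopa-Leindler integrates the vector out. No density of the linear form itself is
    involved. *)
Lemma logconcave_integral_kernel (f : d.-tuple R -> R) :
  has_density X f -> logconcave_fun f -> logconcave_kernel k ->
  logconcave_kernel (fun a => fine (\int[P]_w (k (dot theta (X w) - a))%:E)%E).
Proof.
move=> Xf lf lk s a b s01.
have [mf f0 _] := Xf.
have s0 : 0 <= s by case/andP: s01 => /ltW.
have s10 : 0 <= 1 - s by case/andP: s01 => _ /ltW; rewrite subr_ge0.
rewrite -lee_fin [leRHS]fineK ?integral_kernel_fin_num//.
apply: geomean_le_powR => //; try by rewrite fine_gt0// integral_kernel_gt0/= -ge0_fin_numE ?integral_kernel_fin_num//; apply/ltW/integral_kernel_gt0.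
rewrite !fineK ?integral_kernel_fin_num//.
have mg c : measurable_fun setT (fun x : d.-tuple R => (k (dot theta x - c))%:E).
  apply/measurable_EFinP; apply: measurableT_comp => //; apply: measurable_funB => //.
  exact: measurable_dot.
have E c := ge0_integral_density Xf (mg c) (fun x => ltW (k0 _)).
rewrite (E a) (E b) (E ((1 - s) * a + s * b)).
have mgf c : measurable_fun setT (fun x : d.-tuple R => (k (dot theta x - c))%:E * (f x)%:E)%E.
  by apply: emeasurable_funM => //; exact/measurable_EFinP.
have gf0 c x : (0 <= (k (dot theta x - c))%:E * (f x)%:E)%E.
  by rewrite -EFinM lee_fin mulr_ge0// ltW.
apply: prekopa_leindler => //.
move=> x y r0 r1 r00 r10; rewrite -!EFinM !lte_fin => r0f r1f; rewrite lee_fin.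
apply: (@le_trans _ _ ((k (dot theta x - a) * f x) `^ (1 - s) *
    (k (dot theta y - b) * f y) `^ s)).
  by apply: ler_pM; rewrite ?powR_ge0// ge0_ler_powR// ?nnegrE ?mulr_ge0// ltW.
rewrite !powRM ?f0 ?(ltW (k0 _))// mulrACA.
apply: ler_pM; rewrite ?mulr_ge0 ?powR_ge0//; last exact: logconcave_funP.
rewrite dot_conv_tuple.
have -> : (1 - s) * dot theta x + s * dot theta y - ((1 - s) * a + s * b) =
  (1 - s) * (dot theta x - a) + s * (dot theta y - b) by ring.
exact: lk.
Qed.

End logconcave_kernel.

(** The half-line is convex, so [k (y - u)] restricted to [0 <= u] is logconcave jointly in [y] and
    [u]. This passes logconcavity from [laplace0] to [laplace1]. *)
Lemma logconcave_kernel_tail (R : realType) (k K : R -> R) :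
  measurable_fun setT k -> (forall y, 0 < k y) -> (forall y, 0 < K y) ->
  (forall y, \int[@lebesgue_measure R]_(u in `[0%R, +oo[) (k (y - u))%:E = (K y)%:E)%E ->
  logconcave_kernel k -> logconcave_kernel K.
Proof.
move=> mk k0 K0 kK lk s a b s01.
have s0 : 0 <= s by case/andP: s01 => /ltW.
have s10 : 0 <= 1 - s by case/andP: s01 => _ /ltW; rewrite subr_ge0.
rewrite -lee_fin; apply: geomean_le_powR => //.
have mk' c : measurable_fun setT (fun u : measurableTypeR R => (k (c - u))%:E).
  have mc : measurable_fun setT (fun u : R => c - u).
    by apply: continuous_measurable_fun => u; apply: cvgB; [exact: cvg_cst|exact: cvg_id].
  by apply/measurable_EFinP; exact: (measurableT_comp mk mc).
have E c : (K c)%:E =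
    (\int[@lebesgue_measure R]_u ((fun v => (k (c - v))%:E) \_ (`[0%R, +oo[)) u)%E.
  by rewrite -kK [LHS]integral_mkcond.
rewrite !E.
have mr c : measurable_fun setT ((fun v : measurableTypeR R => (k (c - v))%:E) \_ (`[0%R, +oo[)).
  have mI : measurable (`[0%R, +oo[%classic : set (measurableTypeR R)) by [].
  exact: (measurable_restrictT _ mI).1 (measurable_funTS (mk' c)).
have r0 c u : (0 <= ((fun v : measurableTypeR R => (k (c - v))%:E) \_ (`[0%R, +oo[)) u)%E.
  by rewrite patchE; case: ifPn => // _; rewrite lee_fin ltW.
apply: (prekopa_leindler_line s01 (mr a) (mr b) (mr _)) => //.
move=> x y q0 q1 q00 q10; rewrite !patchE; case: ifPn => [|_]; last first.
  by rewrite lte_fin ltNge ltW.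
rewrite inE/= in_itv/= andbT => x0 qx.
case: ifPn => [|_]; last by rewrite lte_fin ltNge ltW.
rewrite inE/= in_itv/= andbT => y0 qy.
rewrite ifT; last by rewrite inE/= in_itv/= andbT addr_ge0// mulr_ge0.
rewrite !lte_fin in qx qy; rewrite lee_fin.
apply: (@le_trans _ _ (k (a - x) `^ (1 - s) * k (b - y) `^ s)).
  by apply: ler_pM; rewrite ?powR_ge0// ge0_ler_powR// ?nnegrE ?(ltW (k0 _))// ltW.
have -> : (1 - s) * a + s * b - ((1 - s) * x + s * y) =
  (1 - s) * (a - x) + s * (b - y) by ring.
exact: lk.
Qed.

(** * Laplace kernel *)

Section glue.
Context {R : realType}.
Local Notation leb := (@lebesgue_measure R).

(** As [u] grows from 0, [y - u] runs from [y] down to -oo, so the integral is the value at [y] of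
    the primitive vanishing at -oo; [F1] and [F2] are its branches. *)
Lemma integral_left_tail_glue (f1 f2 F1 F2 : R -> R) (y : R) :
  (forall x, is_derive x (1 : R) F1 (f1 x)) -> (forall x, is_derive x (1 : R) F2 (f2 x)) ->
  continuous f1 -> continuous f2 ->
  (forall x, x <= 0 -> 0 <= f1 x) -> (forall x, 0 <= x -> 0 <= f2 x) ->
  f1 0 = f2 0 -> F1 0 = F2 0 ->
  (forall z, F1 (z - u) @[u --> +oo] --> 0) ->
  (\int[leb]_(u in `[0%R, +oo[) (if y - u <= 0 then f1 (y - u) else f2 (y - u))%:E =
   (if y <= 0 then F1 y else F2 y)%:E)%E.
Proof.
move=> dF1 dF2 cf1 cf2 f10 f20 f12 F12 F1oo.
have cB (f : R -> R) : continuous f -> continuous (fun u => f (y - u)).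
  move=> cf u; apply: (@continuous_comp _ _ _ (fun u => y - u) f); last exact: cf.
  by apply: cvgB; [exact: cvg_cst|exact: cvg_id].
have dB (F f : R -> R) : (forall x, is_derive x (1 : R) F (f x)) ->
    forall u, is_derive u (1 : R) (fun u => - F (y - u)) (f (y - u)).
  move=> dF u.
  have d1 : is_derive u (1 : R) (fun u => y - u) (- 1).
    by have := is_deriveB (is_derive_cst y u 1) (is_derive_id u (1 : R)); rewrite sub0r.
  have d2 := @is_derive1_comp R F (fun u => y - u) u _ _ (dF (y - u)) d1.
  have : is_derive u (1 : R) (- (F \o (fun u => y - u))) (- (f (y - u) * -1)).
    exact: is_deriveN.
  by rewrite mulrN1 opprK.
have cG (F f : R -> R) : (forall x, is_derive x (1 : R) F (f x)) ->
    forall u, {for u, continuous (fun u => - F (y - u))}.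
  move=> dF u; apply: differentiable_continuous; apply/derivable1_diffP.
  by case: (dB _ _ dF u).
have tail a : 0 <= a -> y <= a ->
    (\int[leb]_(u in `[a, +oo[) (f1 (y - u))%:E = (F1 (y - a))%:E)%E.
  move=> a0 ya; have dG := dB _ _ dF1.
  rewrite (@ge0_continuous_FTC2y R (fun u => f1 (y - u)) (fun u => - F1 (y - u)) a 0).
  - by rewrite sub0e -EFinN opprK.
  - by move=> x ax; apply: f10; rewrite subr_le0 (le_trans ya).
  - exact/continuous_subspaceT/cB.
  - by rewrite -[X in _ --> X]oppr0; apply: cvgN; exact: F1oo.
  - by move=> x _; case: (dG x).
  - by apply: cvg_at_right_filter; exact: (cG _ _ dF1).
  - by move=> x _; rewrite derive1E; case: (dG x).
have [y0|y0] := leP y 0.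
  rewrite -[in RHS](subr0 y) -tail//; apply: eq_integral => u.
  by rewrite inE/= in_itv/= andbT => u0; rewrite ifT// subr_le0 (le_trans y0).
(* For [0 < y] the integrand changes branch at [u = y], and [F1 0 = F2 0] joins the two
   contributions. *)
have yitv : `[0%R, +oo[%classic = `[0%R, y] `|` `]y, +oo[ :> set R.
  apply/seteqP; split => u /=; rewrite !in_itv/= ?andbT.
    by move=> u0; have [uy|uy] := leP u y; [left; rewrite u0|right].
  by move=> [/andP[]//|/ltW]; apply: le_trans; exact: ltW.
have mf1 : measurable_fun setT (fun u : R => (f1 (y - u))%:E).
  by apply/measurable_EFinP; exact: (continuous_measurable_fun (cB _ cf1)).
have mf2 : measurable_fun setT (fun u : R => (f2 (y - u))%:E).
  by apply/measurable_EFinP; exact: (continuous_measurable_fun (cB _ cf2)).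
rewrite yitv ge0_integral_setU//=; last 3 first.
- apply: measurable_funTS; apply/measurable_EFinP; apply: measurable_fun_ifT => /=.
  + apply: (@measurable_fun_ler _ _ _ _ (fun u : R => y - u) (cst 0)) => //.
    by apply: continuous_measurable_fun => u; apply: cvgB; [exact: cvg_cst|exact: cvg_id].
  + exact/measurable_EFinP.
  + exact/measurable_EFinP.
- move=> u _; rewrite lee_fin; case: ifPn => [/f10//|]; rewrite -ltNge => /ltW.
  exact: f20.
- apply/disj_setPS => u /= []; rewrite !in_itv/= andbT => /andP[_ uy].
  by rewrite ltNge uy.
transitivity ((F2 y - F2 0)%:E + (F2 0)%:E)%E; last by rewrite -EFinD subrK.
congr (_ + _)%E.
- transitivity (\int[leb]_(u in `[0%R, y]) (f2 (y - u))%:E)%E.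
    apply: eq_integral => u; rewrite inE/= in_itv/= => /andP[u0 uy].
    case: ifPn => // yu; have -> : u = y by apply/eqP; rewrite eq_le uy -subr_le0.
    by rewrite subrr f12.
  have dG := dB _ _ dF2.
  rewrite (@continuous_FTC2 R (fun u => f2 (y - u)) (fun u => - F2 (y - u)))//.
  + by rewrite -EFinB subrr subr0; congr EFin; ring.
  + exact/continuous_subspaceT/cB.
  + split; first by move=> u _; case: (dG u).
      by apply: cvg_at_right_filter; exact: (cG _ _ dF2).
    by apply: cvg_at_left_filter; exact: (cG _ _ dF2).
  + by move=> x _; rewrite derive1E; case: (dG x).
- have -> : (F2 0)%:E = (F1 (y - y))%:E by rewrite subrr F12.
  rewrite -tail//; last exact: ltW.
  rewrite -integral_itv_obnd_cbnd; last exact: measurable_funTS.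
  apply: eq_integral => u; rewrite inE/= in_itv/= andbT => /ltW yu.
  by rewrite subr_le0 yu.
Qed.

End glue.

Section laplace.
Context {R : realType}.
Variable g : R.
Hypothesis g0 : 0 < g.
Local Notation leb := (@lebesgue_measure R).

(* laplace0 is the density of a centred Laplace variable, and each of the next
   three functions is the primitive of the previous one that vanishes at -oo *)
Definition laplace0 (y : R) : R :=
  if y <= 0 then g / 2 * expR (g * y) else g / 2 * expR (- g * y).
Definition laplace1 (y : R) : R :=
  if y <= 0 then expR (g * y) / 2 else 1 - expR (- g * y) / 2.
Definition laplace2 (y : R) : R :=
  if y <= 0 then expR (g * y) / (2 * g) else y + expR (- g * y) / (2 * g).
Definition laplace3 (y : R) : R :=
  if y <= 0 then expR (g * y) / (2 * g ^+ 2)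
  else y ^+ 2 / 2 + g ^- 2 - expR (- g * y) / (2 * g ^+ 2).

Lemma is_derive_expRM (a c x : R) :
  is_derive x (1 : R) (fun y => c * expR (a * y)) (c * (a * expR (a * x))).
Proof.
have d1 : is_derive x (1 : R) (fun y => a * y) a.
  have := is_deriveM (is_derive_cst a x 1) (is_derive_id x (1 : R)).
  by rewrite scaler0 addr0 /cst/= [a *: _]mulr1.
have d2 := @is_derive1_comp R expR (fun y => a * y) x _ _ (is_derive_expR (a * x)) d1.
have := is_deriveM (is_derive_cst c x 1) d2.
rewrite scaler0 addr0 /cst/= (mulrC (expR _)); exact.
Qed.

Lemma cvg_expRM_tail (c z : R) : c * expR (g * (z - u)) @[u --> +oo] --> 0.
Proof.
rewrite -[X in _ --> X](mulr0 (c * expR (g * z))).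
have -> : (fun u => c * expR (g * (z - u))) =
    (fun u => (c * expR (g * z)) * expR (- (g * u))).
  by apply/funext => u; rewrite mulrBr expRD mulrA.
apply: cvgM; first exact: cvg_cst.
apply: (@cvg_comp _ _ _ (fun u => g * u) (fun v => expR (- v)) _ +oo); last exact: cvgr_expR.
by apply: gt0_cvgMry => //; exact: cvg_id.
Qed.

Lemma continuous_expRM (a c : R) : continuous (fun y => c * expR (a * y)).
Proof.
move=> x; apply: differentiable_continuous; apply/derivable1_diffP.
by case: (is_derive_expRM a c x).
Qed.

Lemma laplace0_gt0 y : 0 < laplace0 y.
Proof. by rewrite /laplace0; case: ifPn => _; rewrite mulr_gt0 ?divr_gt0 ?expR_gt0. Qed.

Lemma laplace0_le y : laplace0 y <= g / 2.
Proof.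
have g2 : 0 < g / 2 by rewrite divr_gt0.
rewrite /laplace0; case: ifPn => [y0|]; rewrite -?ltNge => *;
  rewrite ger_pMr// -[leRHS]expR0 ler_expR ?mulNr ?oppr_le0 ?pmulr_rle0 ?pmulr_rge0//.
exact: ltW.
Qed.

Lemma laplace0E y : laplace0 y = g / 2 * expR (- (g * `|y|)).
Proof.
rewrite /laplace0; case: ifPn => [y0|]; first by rewrite ler0_norm// mulrN opprK.
by rewrite -ltNge => y0; rewrite gtr0_norm// mulNr.
Qed.

Lemma expR_mul_le1 (a y : R) : a * y <= 0 -> expR (a * y) <= 1.
Proof. by move=> ay; rewrite -[leRHS]expR0 ler_expR. Qed.

Lemma laplace1_gt0 y : 0 < laplace1 y.
Proof.
rewrite /laplace1; case: ifPn => [_|]; first by rewrite divr_gt0 ?expR_gt0.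
rewrite -ltNge => y0; have : expR (- g * y) <= 1.
  by apply: expR_mul_le1; rewrite mulNr oppr_le0 mulr_ge0 ?ltW.
lra.
Qed.

Lemma laplace1_le y : laplace1 y <= 1.
Proof.
rewrite /laplace1; case: ifPn => [y0|_].
  have : expR (g * y) <= 1 by apply: expR_mul_le1; rewrite pmulr_rle0.
  lra.
by have := expR_gt0 (- g * y); lra.
Qed.

Lemma laplace2_ge0 y : 0 <= laplace2 y.
Proof.
have e a : 0 <= expR a / (2 * g) by rewrite divr_ge0 ?expR_ge0// mulr_ge0// ltW.
rewrite /laplace2; case: ifPn => [_|]; first exact: e.
by rewrite -ltNge => /ltW y0; rewrite addr_ge0.
Qed.

(** This and the next two identities add the contributions of both half-lines: they give the mass,
    the mean and half the second moment of [y] plus a Laplace variable, whose variance is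
    [2 / g ^+ 2]. *)
Lemma laplace1D y : laplace1 y + laplace1 (- y) = 1.
Proof.
rewrite /laplace1 oppr_le0 (_ : - g * - y = g * y) ?mulrNN// (_ : g * - y = - g * y) ?mulrN ?mulNr//.
have [y0|y0|->] := ltgtP y 0; [by rewrite subrKC|by rewrite subrK|].
by rewrite !(mulr0, mulNr, oppr0) expR0; lra.
Qed.

Lemma laplace2B y : laplace2 y - laplace2 (- y) = y.
Proof.
rewrite /laplace2 oppr_le0 (_ : - g * - y = g * y) ?mulrNN// (_ : g * - y = - g * y) ?mulrN ?mulNr//.
by have [y0|y0|->] := ltgtP y 0; rewrite ?(mulr0, mulNr, oppr0); ring.
Qed.

Lemma laplace3D y : laplace3 y + laplace3 (- y) = y ^+ 2 / 2 + g ^- 2.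
Proof.
rewrite /laplace3 oppr_le0 (_ : - g * - y = g * y) ?mulrNN// (_ : g * - y = - g * y) ?mulrN ?mulNr//.
have gN := lt0r_neq0 g0.
have [y0|y0|->] := ltgtP y 0; [by rewrite sqrrN subrKC|by rewrite subrK|].
by rewrite !(mulr0, mulNr, oppr0) expR0; field.
Qed.

Let derive_exp (c a b : R) : c * a = b ->
  forall x, is_derive x (1 : R) (fun y => c * expR (a * y)) (b * expR (a * x)).
Proof. by move=> <- x; rewrite -mulrA; exact: is_derive_expRM. Qed.

Let gN : g != 0. Proof. exact: lt0r_neq0. Qed.

Let cexp a c := @continuous_expRM a c.

Lemma integral_laplace0 y :
  (\int[leb]_(u in `[0%R, +oo[) (laplace0 (y - u))%:E = (laplace1 y)%:E)%E.
Proof.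
pose F1 y := 2^-1 * expR (g * y).
pose F2 y := 1 - 2^-1 * expR (- g * y).
have -> : laplace1 y = if y <= 0 then F1 y else F2 y.
  by rewrite /laplace1 /F1 /F2; case: ifPn => _; ring.
have d1 x : is_derive x (1 : R) F1 (g / 2 * expR (g * x)).
  by apply: derive_exp; ring.
have d2 x : is_derive x (1 : R) F2 (g / 2 * expR (- g * x)).
  have := is_deriveB (is_derive_cst (1 : R) x 1) (derive_exp (erefl (2^-1 * - g)) x).
  by rewrite sub0r mulrN mulNr opprK (mulrC _ g).
apply: (integral_left_tail_glue _ d1 d2) => //.
- by move=> x _; rewrite mulr_ge0 ?divr_ge0 ?expR_ge0 ?ltW.
- by move=> x _; rewrite mulr_ge0 ?divr_ge0 ?expR_ge0 ?ltW.
- by rewrite !mulr0.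
- by rewrite /F1 /F2 !mulr0 expR0; lra.
- exact: cvg_expRM_tail.
Qed.

Lemma integral_laplace1 y :
  (\int[leb]_(u in `[0%R, +oo[) (laplace1 (y - u))%:E = (laplace2 y)%:E)%E.
Proof.
pose F1 y := (2 * g)^-1 * expR (g * y).
pose F2 y := y + (2 * g)^-1 * expR (- g * y).
have -> : laplace2 y = if y <= 0 then F1 y else F2 y.
  by rewrite /laplace2 /F1 /F2; case: ifPn => _; ring.
pose f1 y := 2^-1 * expR (g * y).
pose f2 y := 1 + - 2^-1 * expR (- g * y).
transitivity (\int[leb]_(u in `[0%R, +oo[) (if y - u <= 0 then f1 (y - u) else f2 (y - u))%:E)%E.
  by apply: eq_integral => u _; rewrite /laplace1 /f1 /f2; case: ifPn => _; congr EFin; ring.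
have d1 x : is_derive x (1 : R) F1 (f1 x) by apply: derive_exp; field.
have d2 x : is_derive x (1 : R) F2 (f2 x).
  by apply: (is_deriveD (is_derive_id x (1 : R))); apply: derive_exp; field.
apply: (integral_left_tail_glue _ d1 d2) => //.
- exact: cexp.
- by move=> x; apply: cvgD; [exact: cvg_cst|exact: cexp].
- by move=> x _; rewrite mulr_ge0 ?invr_ge0 ?expR_ge0.
- move=> x x0; have : expR (- g * x) <= 1.
    by apply: expR_mul_le1; rewrite mulNr oppr_le0 mulr_ge0 ?(ltW g0).
  by rewrite /f2; lra.
- by rewrite /f1 /f2 !mulr0 expR0; lra.
- by rewrite /F1 /F2 !mulr0 add0r.
- exact: cvg_expRM_tail.
Qed.

Lemma integral_laplace2 y :
  (\int[leb]_(u in `[0%R, +oo[) (laplace2 (y - u))%:E = (laplace3 y)%:E)%E.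
Proof.
pose F1 y := (2 * g ^+ 2)^-1 * expR (g * y).
pose F2 y := 2^-1 * y ^+ 2 + (g ^- 2 + - (2 * g ^+ 2)^-1 * expR (- g * y)).
have -> : laplace3 y = if y <= 0 then F1 y else F2 y.
  by rewrite /laplace3 /F1 /F2; case: ifPn => _; ring.
pose f1 y := (2 * g)^-1 * expR (g * y).
pose f2 y := y + (2 * g)^-1 * expR (- g * y).
transitivity (\int[leb]_(u in `[0%R, +oo[) (if y - u <= 0 then f1 (y - u) else f2 (y - u))%:E)%E.
  by apply: eq_integral => u _; rewrite /laplace2 /f1 /f2; case: ifPn => _; congr EFin; ring.
have c0 : 0 <= (2 * g)^-1 by rewrite invr_ge0 mulr_ge0// ltW.
have d1 x : is_derive x (1 : R) F1 (f1 x) by apply: derive_exp; field.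
have d2 x : is_derive x (1 : R) F2 (f2 x).
  have dx : is_derive x (1 : R) (fun y => y * y) (x + x).
    have := is_deriveM (is_derive_id x (1 : R)) (is_derive_id x (1 : R)).
    by rewrite [_ *: _]mulr1.
  have dx2 := is_deriveM (is_derive_cst (2^-1 : R) x 1) dx.
  have dE : is_derive x (1 : R) (fun y => - (2 * g ^+ 2)^-1 * expR (- g * y))
      ((2 * g)^-1 * expR (- g * x)) by apply: derive_exp; field.
  have := is_deriveD dx2 (is_deriveD (is_derive_cst (g ^- 2) x (1 : R)) dE).
  rewrite scaler0 addr0 add0r /cst/= (_ : 2^-1 *: (x + x) = x)//.
  by rewrite -[_ *: _]/(2^-1 * (x + x)); field.
apply: (integral_left_tail_glue _ d1 d2) => //.
- exact: cexp.
- by move=> x; apply: cvgD; [exact: cvg_id|exact: cexp].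
- by move=> x _; rewrite mulr_ge0 ?expR_ge0.
- by move=> x x0; rewrite addr_ge0// mulr_ge0 ?expR_ge0.
- by rewrite /f1 /f2 !mulr0 add0r.
- by rewrite /F1 /F2 !mulr0 expR0 expr0n/= mulr0 add0r; field.
- exact: cvg_expRM_tail.
Qed.

End laplace.

(** * Anticoncentration of linear forms *)

Section tail_moments.
Context {R : realType} dO (Omega : measurableType dO) (P : probability Omega R).
Local Notation leb := (@lebesgue_measure R).

(** Exchanging the integrals turns a tail integral of the smoothed function into the expectation of
    the next primitive of the kernel. *)
Lemma tonelli_tail (k K : R -> R) (v : Omega -> R) :
  measurable_fun setT k -> (forall y, 0 <= k y) -> measurable_fun setT v ->
  (forall y, \int[leb]_(u in `[0%R, +oo[) (k (y - u))%:E = (K y)%:E)%E ->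
  measurable_fun (setT : set (measurableTypeR R)) (fun u => \int[P]_w (k (v w - u))%:E)%E /\
  (\int[leb]_(u in `[0%R, +oo[) \int[P]_w (k (v w - u))%:E = \int[P]_w (K (v w))%:E)%E.
Proof.
move=> mk k0 mv kK.
have msnd : measurable_fun setT (fun p : Omega * measurableTypeR R => (p.2 : R)).
  exact: (@measurable_snd _ _ Omega (measurableTypeR R)).
pose F (p : Omega * measurableTypeR R) := (k (v p.1 - p.2))%:E.
have mF : measurable_fun setT F.
  apply/measurable_EFinP; apply: measurableT_comp => //; apply: measurable_funB => //.
  exact: measurableT_comp.
have F0 p : (0 <= F p)%E by rewrite lee_fin.
split.
  exact: (@measurable_fun_fubini_tonelli_G _ _ Omega (measurableTypeR R) R P F mF F0).
have mI : measurable (`[0%R, +oo[%classic : set (measurableTypeR R)) by [].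
pose G (p : Omega * measurableTypeR R) := (F p * (\1_(`[0%R, +oo[%classic) (p.2 : R))%:E)%E.
have mG : measurable_fun setT G.
  apply: emeasurable_funM => //; apply/measurable_EFinP.
  apply: measurableT_comp => //; exact: measurable_indic.
have G0 p : (0 <= G p)%E by rewrite mule_ge0// lee_fin.
have patchG (f : R -> \bar R) u :
    (f \_ (`[0%R, +oo[)) u = (f u * (\1_(`[0%R, +oo[%classic) u)%:E)%E.
  by rewrite patchE indicE; case: (_ \in _); rewrite ?mule1 ?mule0.
transitivity (\int[leb]_u \int[P]_w G (w, u))%E.
  rewrite integral_mkcond; apply: eq_integral => u _; rewrite patchG /G /F /=.
  rewrite ge0_integralZr//; first by apply/measurable_EFinP; apply: measurableT_comp => //; exact: measurable_funB.
  by move=> w _; rewrite lee_fin.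
rewrite -(fubini_tonelli (m1 := P) (m2 := leb) G mG G0).
apply: eq_integral => w _; rewrite -kK [RHS]integral_mkcond.
by apply: eq_integral => u _; rewrite patchG.
Qed.

(** Write phi(x) for the expectation of [k (v - x)]. Integrated over [x] and [u] in the half-line,
    phi(x + u) gives the expectation of [L], and phi(x) phi(u) the square of that of [K]. *)
Lemma four_point_tail (k K L : R -> R) (v : Omega -> R) :
  measurable_fun setT k -> measurable_fun setT K ->
  (forall y, 0 <= k y) -> (forall y, 0 <= K y) -> measurable_fun setT v ->
  (forall y, \int[leb]_(u in `[0%R, +oo[) (k (y - u))%:E = (K y)%:E)%E ->
  (forall y, \int[leb]_(u in `[0%R, +oo[) (K (y - u))%:E = (L y)%:E)%E ->
  (forall x u, 0 <= x -> 0 <= u ->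
    (\int[P]_w (k (v w))%:E * \int[P]_w (k (v w - (x + u)))%:E <=
     \int[P]_w (k (v w - x))%:E * \int[P]_w (k (v w - u))%:E)%E) ->
  (\int[P]_w (k (v w))%:E * \int[P]_w (L (v w))%:E <=
   \int[P]_w (K (v w))%:E * \int[P]_w (K (v w))%:E)%E.
Proof.
move=> mk mK k0 K0 mv kK KL H.
pose kb x := (\int[P]_w (k (v w - x))%:E)%E.
pose Kb x := (\int[P]_w (K (v w - x))%:E)%E.
have kb0 x : (0 <= kb x)%E by apply: integral_ge0 => w _; rewrite lee_fin.
have Kb0 x : (0 <= Kb x)%E by apply: integral_ge0 => w _; rewrite lee_fin.
have [mkb tk] := tonelli_tail mk k0 mv kK.
have [mKb tK] := tonelli_tail mK K0 mv KL.
have e0 (f : R -> R) : (\int[P]_w (f (v w))%:E = \int[P]_w (f (v w - 0%R)%R)%:E)%E.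
  by apply: eq_integral => w _; rewrite subr0.
(* Integration in [u] at fixed [x]; the integration in [x] comes last. *)
have step x : 0 <= x -> (kb 0%R * Kb x <= Kb 0%R * kb x)%E.
  move=> x0.
  have mvx : measurable_fun setT (fun w => v w - x) by exact: measurable_funB.
  have [mkx tkx] := tonelli_tail mk k0 mvx kK.
  rewrite /Kb -tkx -(e0 K) -tk.
  have mI : measurable (`[0%R, +oo[%classic : set (measurableTypeR R)) by [].
  have kx0 u : (0 <= \int[P]_w (k (v w - x - u)%R)%:E)%E.
    by apply: integral_ge0 => w _; rewrite lee_fin.
  rewrite -(ge0_integralZl leb mI (measurable_funTS mkx) (fun u _ => kx0 u) (kb0 0)).
  rewrite -(ge0_integralZr leb mI (measurable_funTS mkb) (fun u _ => kb0 u) (kb0 x)).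
  apply: ge0_le_integral => //.
  - by move=> u _; apply: mule_ge0; [exact: kb0|exact: kx0].
  - by apply: measurable_funTS; exact: measurable_funeM.
  - by apply: measurable_funTS; apply: emeasurable_funM => //; exact: measurable_cst.
  - move=> u; rewrite /= in_itv/= andbT => u0.
    rewrite muleC [leRHS]muleC /kb -(e0 k); have := H x u x0 u0.
    by rewrite [leLHS]muleC; under eq_integral do rewrite opprD addrA.
have tk' : (\int[leb]_(u in `[0%R, +oo[) kb u = Kb 0%R)%E by rewrite tk e0.
rewrite (e0 k) (e0 K) -/(kb 0) -/(Kb 0) -tK -[X in (_ <= _ * X)%E]tk'.
have mkbI : measurable_fun (`[0%R, +oo[%classic : set (measurableTypeR R)) kb.
  exact: measurable_funTS.
have mKbI : measurable_fun (`[0%R, +oo[%classic : set (measurableTypeR R)) Kb.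
  exact: measurable_funTS.
have mI : measurable (`[0%R, +oo[%classic : set (measurableTypeR R)) by [].
rewrite -(ge0_integralZl leb mI mKbI (fun u _ => Kb0 u) (kb0 0)).
rewrite -(ge0_integralZl leb mI mkbI (fun u _ => kb0 u) (Kb0 0)).
apply: ge0_le_integral => //.
- by move=> u _; rewrite mule_ge0// Kb0.
- by apply: measurable_funTS; exact: measurable_funeM.
- by apply: measurable_funTS; exact: measurable_funeM.
- by move=> u; rewrite /= in_itv/= andbT; exact: step.
Qed.

End tail_moments.

Section anticoncentration.
Context {R : realType} dO (Omega : measurableType dO) (P : probability Omega R).
Variables (g : R) (g0 : 0 < g).

Let mif (f1 f2 : R -> R) : continuous f1 -> continuous f2 ->
  measurable_fun setT (fun y : R => if y <= 0 then f1 y else f2 y).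
Proof.
move=> /continuous_measurable_fun m1 /continuous_measurable_fun m2.
apply: measurable_fun_ifT => //.
exact: (@measurable_fun_ler _ _ _ _ (fun y : R => y) (cst 0)).
Qed.

Lemma measurable_laplace0 : measurable_fun setT (laplace0 g).
Proof. by apply: mif; exact: continuous_expRM. Qed.

Lemma measurable_laplace1 : measurable_fun setT (laplace1 g).
Proof.
rewrite (_ : laplace1 g = fun y => if y <= 0 then 2^-1 * expR (g * y)
    else 1 - 2^-1 * expR (- g * y)); last first.
  by apply/funext => y; rewrite /laplace1 !(mulrC 2^-1).
apply: mif; first exact: continuous_expRM.
by move=> x; apply: cvgB; [exact: cvg_cst|exact: continuous_expRM].
Qed.

Lemma measurable_laplace2 : measurable_fun setT (laplace2 g).
Proof.
rewrite (_ : laplace2 g = fun y => if y <= 0 then (2 * g)^-1 * expR (g * y)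
    else y + (2 * g)^-1 * expR (- g * y)); last first.
  by apply/funext => y; rewrite /laplace2 !(mulrC (2 * g)^-1).
apply: mif; first exact: continuous_expRM.
by move=> x; apply: cvgD; [exact: cvg_id|exact: continuous_expRM].
Qed.

Lemma laplace0_logconcave : logconcave_kernel (laplace0 g).
Proof.
move=> s x y /andP[s0 s1].
have s10 : 0 < 1 - s by rewrite subr_gt0.
have g2 : 0 < g / 2 by rewrite divr_gt0.
rewrite !laplace0E (powRM _ (ltW g2) (expR_ge0 _)) (powRM _ (ltW g2) (expR_ge0 _)).
rewrite mulrACA -powRD; last first.
  by apply/implyP => _; rewrite gt_eqF.
rewrite subrK powRr1 ?(ltW g2)// ler_pM2l//.
rewrite /powR !gt_eqF ?expR_gt0// -expRD !expRK ler_expR.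
rewrite mulrN mulrN -opprD lerN2.
have := ler_normD ((1 - s) * x) (s * y).
rewrite !normrM (gtr0_norm s0) (gtr0_norm s10).
by move=> /(ler_wpM2l (ltW g0)); rewrite mulrDr !(mulrCA g).
Qed.

Lemma laplace1_logconcave : logconcave_kernel (laplace1 g).
Proof.
apply: (logconcave_kernel_tail measurable_laplace0).
- exact: laplace0_gt0.
- exact: laplace1_gt0.
- exact: integral_laplace0.
- exact: laplace0_logconcave.
Qed.

Variables (d : nat) (X : {RV P >-> d.-tuple R}).
Hypothesis lcX : logconcave_vector X.

Lemma four_points_integral (k : R -> R) (B : R) (theta : 'I_d -> R) (x u : R) :
  measurable_fun setT k -> (forall y, 0 < k y) -> (forall y, k y <= B) ->
  logconcave_kernel k -> 0 <= x -> 0 <= u ->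
  (\int[P]_w (k (dot theta (X w)))%:E * \int[P]_w (k (dot theta (X w) - (x + u))%R)%:E <=
     \int[P]_w (k (dot theta (X w) - x)%R)%:E * \int[P]_w (k (dot theta (X w) - u)%R)%:E)%E.
Proof.
move=> mk k0 kB lk x0 u0.
have [f Xf lf] := lcX.
have fn := integral_kernel_fin_num X mk k0 kB theta.
have lg := logconcave_integral_kernel mk k0 kB theta Xf lf lk.
have gt a : 0 < fine (\int[P]_w (k (dot theta (X w) - a))%:E)%E.
  by rewrite fine_gt0// integral_kernel_gt0//= -ge0_fin_numE ?fn//; apply/ltW/integral_kernel_gt0.
have H := logconcave_kernel_four_points gt lg x0 u0.
have e0 : (\int[P]_w (k (dot theta (X w)))%:E = \int[P]_w (k (dot theta (X w) - 0)%R)%:E)%E.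
  by apply: eq_integral => w _; rewrite subr0.
rewrite e0 -(fineK (fn 0)) -(fineK (fn (x + u))) -(fineK (fn x)) -(fineK (fn u)).
by rewrite -!EFinM lee_fin.
Qed.

(** For Z the linear form plus an independent Laplace variable, the four expectations are the
    density of Z at 0, Pr[Z >= 0], E max(Z, 0) and E max(Z, 0)^2 / 2. An exponential law gives
    equality in both bounds. *)
Lemma laplace_tail_moments (theta : 'I_d -> R) :
  let E k := (\int[P]_w (k (dot theta (X w)))%:E)%E in
  (E (laplace0 g) * E (laplace2 g) <= E (laplace1 g) * E (laplace1 g))%E /\
  (E (laplace1 g) * E (laplace3 g) <= E (laplace2 g) * E (laplace2 g))%E.
Proof.
move=> E.
have mv : measurable_fun setT (fun w => dot theta (X w)).
  by apply: measurableT_comp => //; exact: measurable_dot.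
have m0 := measurable_laplace0.
have m1 := measurable_laplace1.
have m2 := measurable_laplace2.
have p0 := laplace0_gt0 g0.
have p1 := laplace1_gt0 g0.
split.
  apply: (four_point_tail m0 m1 (fun y => ltW (p0 y)) (fun y => ltW (p1 y)) mv
    (integral_laplace0 g0) (integral_laplace1 g0)) => x u x0 u0.
  exact: (four_points_integral theta m0 p0 (laplace0_le g0) laplace0_logconcave x0 u0).
apply: (four_point_tail m1 m2 (fun y => ltW (p1 y)) (laplace2_ge0 g0) mv
  (integral_laplace1 g0) (integral_laplace2 g0)) => x u x0 u0.
exact: (four_points_integral theta m1 p1 (laplace1_le g0) laplace1_logconcave x0 u0).
Qed.

End anticoncentration.

(** * Moments of linear forms under identity covariance *)

Section covariance.
Context {R : realType} dO (Omega : measurableType dO) (P : probability Omega R).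
Variables (d : nat) (X : {RV P >-> d.-tuple R}).
Hypothesis covX : identity_covariance X.

Let mX i : measurable_fun setT (fun w => tnth (X w) i).
Proof. by apply: (measurableT_comp (measurable_tnth i)). Qed.

Let iXX i : P.-integrable setT (fun w => (tnth (X w) i * tnth (X w) i)%:E).
Proof.
have m2 : measurable_fun setT (fun w => (tnth (X w) i * tnth (X w) i)%:E).
  by apply/measurable_EFinP; exact: measurable_funM.
apply/integrableP; split => //.
(* An infinite second moment would make the variance +oo, or -oo by the convention +oo - +oo = -oo,
   but never 1. *)
have := covX i i; rewrite eqxx !unlock.
set a := (\int[P]_w _)%E; set b := (\int[P]_w _)%E => ab.
have -> : (\int[P]_w `|(tnth (X w) i * tnth (X w) i)%:E| = a)%E.
  by apply: eq_integral => w _; rewrite gee0_abs// lee_fin -expr2 sqr_ge0.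
rewrite ltey; apply/eqP => aoo; move: ab; rewrite aoo.
by case: (b * b)%E.
Qed.

Let iXY i j : P.-integrable setT (fun w => (tnth (X w) i * tnth (X w) j)%:E).
Proof.
have iS := integrableD measurableT (iXX i) (iXX j).
apply: (le_integrable _ _ _ iS) => //.
  by apply/measurable_EFinP; exact: measurable_funM.
move=> w _; rewrite -EFinD lee_fin [leRHS]ger0_norm -?expr2 ?addr_ge0 ?sqr_ge0//.
rewrite normrM -[X in _ <= X + _]real_normK ?num_real// -[X in _ <= _ + X]real_normK ?num_real//.
have gen (a b : R) : 0 <= a -> 0 <= b -> a * b <= a ^+ 2 + b ^+ 2.
  move=> a0 b0; have : 0 <= (a - b) ^+ 2 by rewrite sqr_ge0.
  have : 0 <= a * b by rewrite mulr_ge0.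
  rewrite sqrrB; lra.
exact: gen.
Qed.

Let iX i : P.-integrable setT (fun w => (tnth (X w) i)%:E).
Proof.
have iS := integrableD measurableT (finite_measure_integrable_cst P 1 measurableT) (iXX i).
apply: (le_integrable _ _ _ iS) => //; first exact/measurable_EFinP.
move=> w _; rewrite -EFinD lee_fin [leRHS]ger0_norm -?expr2 ?addr_ge0 ?sqr_ge0//.
rewrite -[X in _ <= _ + X]real_normK ?num_real//.
have gen (a : R) : 0 <= a -> a <= 1 + a ^+ 2.
  by move=> a0; have := sqr_ge0 (a - 1); rewrite sqrrB; lra.
exact: gen.
Qed.

Lemma dot_moments (theta : 'I_d -> R) :
  exists e1 e2 : R, [/\ P.-integrable setT (fun w => (dot theta (X w))%:E),
    (\int[P]_w (dot theta (X w))%:E = e1%:E)%E,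
    (\int[P]_w (dot theta (X w) ^+ 2)%:E = e2%:E)%E
    & e2 - e1 ^+ 2 = \sum_i theta i ^+ 2].
Proof.
pose a i := fine (\int[P]_w (tnth (X w) i)%:E)%E.
pose b i j := fine (\int[P]_w (tnth (X w) i * tnth (X w) j)%:E)%E.
have aE i : (\int[P]_w (tnth (X w) i)%:E = (a i)%:E)%E.
  by rewrite fineK//; exact: integrable_fin_num (iX i).
have bE i j : (\int[P]_w (tnth (X w) i * tnth (X w) j)%:E = (b i j)%:E)%E.
  by rewrite fineK//; exact: integrable_fin_num (iXY i j).
have ab i j : b i j - a i * a j = (i == j)%:R.
  have := covX i j; rewrite !unlock bE !aE -EFinM -EFinB; exact: EFin_inj.
exists (\sum_i theta i * a i), (\sum_i \sum_j theta i * theta j * b i j).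
have dE w : (dot theta (X w))%:E = (\sum_i (theta i)%:E * (tnth (X w) i)%:E)%E.
  by rewrite /dot -sumEFin; apply: eq_bigr => i _; rewrite EFinM.
split.
- under eq_fun do rewrite dE.
  by apply: integrable_sum => // i _; exact: integrableZl.
- under eq_integral do rewrite dE.
  rewrite integral_sum//; last by move=> i; exact: integrableZl.
  rewrite -sumEFin; apply: eq_bigr => i _; rewrite integralZl//.
  by rewrite aE EFinM.
- have d2E w : (dot theta (X w) ^+ 2)%:E = (\sum_i \sum_j
      (theta i * theta j)%:E * (tnth (X w) i * tnth (X w) j)%:E)%E.
    rewrite expr2 /dot big_distrlr/= -sumEFin; apply: eq_bigr => i _.
    by rewrite -sumEFin; apply: eq_bigr => j _; rewrite -EFinM mulrACA.
  under eq_integral do rewrite d2E.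
  rewrite integral_sum//; last first.
    by move=> i; apply: integrable_sum => // j _; exact: integrableZl.
  rewrite -sumEFin; apply: eq_bigr => i _.
  rewrite integral_sum//; last by move=> j; exact: integrableZl.
  rewrite -sumEFin; apply: eq_bigr => j _; rewrite integralZl//.
  by rewrite bE -EFinM.
- rewrite expr2 big_distrlr/= -sumrB; apply: eq_bigr => i _.
  rewrite -sumrB (bigD1 i)//= big1 ?addr0.
    rewrite (_ : _ - _ = theta i * theta i * (b i i - a i * a i)); last by ring.
    by rewrite ab eqxx mulr1 expr2.
  move=> j ji.
  rewrite (_ : _ - _ = theta i * theta j * (b i j - a i * a j)); last by ring.
  by rewrite ab eq_sym (negbTE ji) mulr0.
Qed.

End covariance.

(** [M] is a density at 0, and [p], [u], [A] are the mass, first moment and half second moment on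
    the positive side; [q], [v], [B] belong to the negative side. With [U = M * u] and [V = M * v],
    variance at least 1 gives [M ^+ 2 <= 2 U^2 / p + 2 V^2 / q - (U - V)^2], where [U^2], [V^2] and
    [U V] all have nonnegative coefficients. The worst case is thus [U = p^2], [V = q^2], a
    two-sided exponential law. *)
Lemma two_sided_exponential_bound (R : realType) (M p q u v A B : R) :
  0 < M -> 0 < p -> 0 < q -> 0 <= u -> 0 <= v -> p + q = 1 ->
  M * u <= p ^+ 2 -> M * v <= q ^+ 2 -> p * A <= u ^+ 2 -> q * B <= v ^+ 2 ->
  1 + (u - v) ^+ 2 <= 2 * A + 2 * B -> M <= 1.
Proof.
move=> M0 p0 q0 u0 v0 pq Mu Mv pA qB AB.
have p1 : p <= 1 by lra.
have q1 : q <= 1 by lra.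
pose U := M * u; pose V := M * v.
have U0 : 0 <= U by rewrite mulr_ge0// ltW.
have V0 : 0 <= V by rewrite mulr_ge0// ltW.
have le_sq (x y : R) : 0 <= x -> x <= y -> x ^+ 2 <= y ^+ 2.
  by move=> x0 xy; rewrite lerXn2r// nnegrE// (le_trans x0).
have UA : A <= u ^+ 2 / p by rewrite ler_pdivlMr// mulrC.
have VB : B <= v ^+ 2 / q by rewrite ler_pdivlMr// mulrC.
have h1 : M ^+ 2 <= 2 * (U ^+ 2 / p) + 2 * (V ^+ 2 / q) - (U - V) ^+ 2.
  have : M ^+ 2 * (1 + (u - v) ^+ 2) <= M ^+ 2 * (2 * (u ^+ 2 / p) + 2 * (v ^+ 2 / q)).
    by rewrite ler_wpM2l ?sqr_ge0//; lra.
  have -> : M ^+ 2 * (1 + (u - v) ^+ 2) = M ^+ 2 + (U - V) ^+ 2 by rewrite /U /V; ring.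
  have -> : M ^+ 2 * (2 * (u ^+ 2 / p) + 2 * (v ^+ 2 / q)) =
    2 * (U ^+ 2 / p) + 2 * (V ^+ 2 / q) by rewrite /U /V; ring.
  lra.
have coef (x r : R) : 0 < r -> r <= 1 -> 0 <= x -> x <= r ^+ 2 ->
    2 * (x ^+ 2 / r) - x ^+ 2 <= 2 * r ^+ 3 - r ^+ 4.
  move=> r0 r1 x0 xr.
  have -> : 2 * (x ^+ 2 / r) - x ^+ 2 = x ^+ 2 * (2 / r - 1) by ring.
  have -> : 2 * r ^+ 3 - r ^+ 4 = (r ^+ 2) ^+ 2 * (2 / r - 1) by field; exact: lt0r_neq0.
  apply: ler_wpM2r; last exact: le_sq.
  by rewrite subr_ge0 ler_pdivlMr// mul1r; lra.
have c1 := coef U p p0 p1 U0 Mu.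
have c2 := coef V q q0 q1 V0 Mv.
have UV : U * V <= p ^+ 2 * q ^+ 2 by apply: ler_pM.
(* The value at [U = p^2], [V = q^2], rewritten with [p + q = 1]; it tends to 1 as the law becomes
   one-sided. *)
have M2 : M ^+ 2 <= 1 - 2 * p * q.
  have -> : 1 - 2 * p * q = (2 * p ^+ 3 - p ^+ 4) + (2 * q ^+ 3 - q ^+ 4) + 2 * (p ^+ 2 * q ^+ 2).
    by rewrite (_ : q = 1 - p); [ring|lra].
  have : (U - V) ^+ 2 = U ^+ 2 - 2 * (U * V) + V ^+ 2 by ring.
  lra.
have : M ^+ 2 <= 1 ^+ 2 by rewrite expr1n (le_trans M2)// lerBlDr lerDl !mulr_ge0 ?ltW.
by rewrite ler_pXn2r// ?nnegrE ?ler01// ltW.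
Qed.

Lemma two_sided_exponential_bound_ereal (R : realType) (M p q u v A B : \bar R)
    (e1 e2 c : R) :
  M \is a fin_num -> p \is a fin_num -> q \is a fin_num -> u \is a fin_num ->
  v \is a fin_num -> A \is a fin_num -> B \is a fin_num ->
  (0 < M -> 0 < p -> 0 < q -> 0 <= u -> 0 <= v -> p + q = 1 ->
   M * u <= p * p -> M * v <= q * q -> p * A <= u * u -> q * B <= v * v ->
   u = v + e1%:E -> A + B = (e2 / 2 + c)%:E -> 0 <= c%:E -> (1 + e1 ^+ 2 <= e2)%R ->
   M <= 1)%E.
Proof.
case: M => [M| |]//; case: p => [p| |]//; case: q => [q| |]//; case: u => [u| |]//.
case: v => [v| |]//; case: A => [A| |]//; case: B => [B| |]// _ _ _ _ _ _ _.
rewrite -!EFinM -!EFinD !lee_fin !lte_fin.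
move=> M0 p0 q0 u0 v0 [] pq H1 H2 H3 H4 [] ue [] AB c0 e12.
apply: (@two_sided_exponential_bound _ M p q u v A B) => //; rewrite ?expr2//.
have -> : u - v = e1 by rewrite ue; ring.
rewrite -expr2; lra.
Qed.

Section anticoncentration_bound.
Context {R : realType} dO (Omega : measurableType dO) (P : probability Omega R).
Variables (d : nat) (X : {RV P >-> d.-tuple R}).
Hypotheses (lcX : logconcave_vector X) (covX : identity_covariance X).

(** The left-hand side is [2 / g] times the smoothed density at 0, and the Laplace variable only
    adds to the variance. The negative half-line is reached through the direction [- theta]. *)
Lemma expectation_expR_abs_dot (g : R) (theta : 'I_d -> R) :
  0 < g -> 1 <= \sum_i theta i ^+ 2 ->
  (\int[P]_w (expR (- (g * `|dot theta (X w)|)))%:E <= (2 / g)%:E)%E.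
Proof.
move=> g0 theta1.
pose v w := dot theta (X w).
have mv : measurable_fun setT v by apply: measurableT_comp => //; exact: measurable_dot.
have mk (k : R -> R) : measurable_fun setT k ->
    measurable_fun setT (fun w => (k (v w))%:E) /\
    measurable_fun setT (fun w => (k (- v w))%:E).
  move=> mk; split; apply/measurable_EFinP; apply: measurableT_comp => //.
  exact: measurable_funN.
have dotN w : dot (fun i => - theta i) (X w) = - v w.
  by rewrite /v /dot -sumrN; apply: eq_bigr => i _; rewrite mulNr.
pose E k := (\int[P]_w (k (v w))%:E)%E.
pose E' k := (\int[P]_w (k (- v w))%:E)%E.
have [H1 H2] := laplace_tail_moments g0 lcX theta.
have [H1' H2'] := laplace_tail_moments g0 lcX (fun i => - theta i).
rewrite -/(E _) -/(E _) -/(E _) in H1; rewrite -/(E _) -/(E _) -/(E _) in H2.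
have dN k : (\int[P]_w (k (dot (fun i => - theta i) (X w)))%:E)%E = E' k.
  by apply: eq_integral => w _; rewrite dotN.
rewrite !dN in H1' H2'.
have E00 : E' (laplace0 g) = E (laplace0 g).
  by apply: eq_integral => w _; rewrite !laplace0E normrN.
rewrite E00 in H1'.
have [e1 [e2 [iv ve1 ve2 e12]]] := dot_moments covX theta.
have m0 := measurable_laplace0 g.
have m1 := measurable_laplace1 g.
have m2 := measurable_laplace2 g.
have m3 : measurable_fun setT (laplace3 g).
  rewrite (_ : laplace3 g = fun y => if y <= 0 then (2 * g ^+ 2)^-1 * expR (g * y)
    else y ^+ 2 / 2 + g ^- 2 - (2 * g ^+ 2)^-1 * expR (- g * y)); last first.
    by apply/funext => y; rewrite /laplace3 !(mulrC (2 * g ^+ 2)^-1).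
  apply: measurable_fun_ifT.
  - exact: (@measurable_fun_ler _ _ _ _ (fun y : R => y) (cst 0)).
  - by apply: continuous_measurable_fun; exact: continuous_expRM.
  - apply: measurable_funB; last by apply: continuous_measurable_fun; exact: continuous_expRM.
    apply: continuous_measurable_fun => y; apply: cvgD; last exact: cvg_cst.
    by apply: cvgM; [exact: exprn_continuous|exact: cvg_cst].
have p0 y := laplace0_gt0 g0 y.
have p1 y := laplace1_gt0 g0 y.
have p2 y := laplace2_ge0 g0 y.
have p3 y : 0 <= laplace3 g y.
  rewrite -lee_fin -(integral_laplace2 g0); apply: integral_ge0 => u _.
  by rewrite lee_fin.
have ge0E (k : R -> R) : (forall y, 0 <= k y) -> (0 <= E k)%E /\ (0 <= E' k)%E.
  by move=> k0; split; apply: integral_ge0 => w _; rewrite lee_fin.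
have [E1_ge0 E1'_ge0] := ge0E _ (fun y => ltW (p1 y)).
have [E2_ge0 E2'_ge0] := ge0E _ p2.
have [E3_ge0 E3'_ge0] := ge0E _ p3.
have sum1 : (E (laplace1 g) + E' (laplace1 g) = 1)%E.
  rewrite /E /E' -ge0_integralD//; [|by move=> w _; rewrite lee_fin ltW|exact: (mk _ m1).1
    |by move=> w _; rewrite lee_fin ltW|exact: (mk _ m1).2].
  under eq_integral do rewrite -EFinD laplace1D//.
  by rewrite integral_cst// mul1e; exact: probability_setT.
have sum3 : (E (laplace3 g) + E' (laplace3 g) = (e2 / 2 + g ^- 2)%:E)%E.
  rewrite /E /E' -ge0_integralD//; [|by move=> w _; rewrite lee_fin|exact: (mk _ m3).1
    |by move=> w _; rewrite lee_fin|exact: (mk _ m3).2].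
  under eq_integral do rewrite -EFinD laplace3D// EFinD.
  have msq : measurable_fun setT (fun w => (v w ^+ 2 / 2)%:E).
    by apply/measurable_EFinP; apply: measurable_funM => //; exact: measurable_funX.
  rewrite ge0_integralD//; last 2 first.
  - by move=> w _; rewrite lee_fin divr_ge0// sqr_ge0.
  - by move=> w _; rewrite lee_fin invr_ge0 sqr_ge0.
  rewrite integral_cst// [X in (_ + _ * X)%E]probability_setT mule1 EFinD; congr (_ + _)%E.
  under eq_integral do rewrite mulrC EFinM.
  rewrite ge0_integralZl_EFin//; last 2 first.
  - by move=> w _; rewrite lee_fin sqr_ge0.
  - by apply/measurable_EFinP; exact: measurable_funX.
  by rewrite ve2 -EFinM mulrC.
have fin2 (a b : \bar R) (c : R) : (0 <= a)%E -> (0 <= b)%E -> (a + b = c%:E)%E ->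
    (a \is a fin_num) && (b \is a fin_num).
  by case: a => [a| |]; case: b.
have /andP[f1 f1'] := fin2 _ _ _ E1_ge0 E1'_ge0 sum1.
have /andP[f3 f3'] := fin2 _ _ _ E3_ge0 E3'_ge0 sum3.
have f0 : E (laplace0 g) \is a fin_num.
  have := integral_kernel_fin_num X m0 p0 (laplace0_le g0) theta 0.
  by rewrite /E /v; under eq_integral do rewrite subr0.
have pos (k : R -> R) (B : R) : measurable_fun setT k -> (forall y, 0 < k y) -> (forall y, k y <= B) ->
    (0 < E k)%E /\ (0 < E' k)%E.
  move=> mk0 k0 kB; split.
    have := integral_kernel_gt0 X mk0 k0 theta 0.
    by rewrite /E /v; under eq_integral do rewrite subr0.
  have := integral_kernel_gt0 X mk0 k0 (fun i => - theta i) 0.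
  by rewrite -dN; under eq_integral do rewrite subr0.
have [E0_gt0 _] := pos _ _ m0 p0 (laplace0_le g0).
have [E1_gt0 E1'_gt0] := pos _ _ m1 p1 (laplace1_le g0).
(* An infinite value would violate [H1], as the density at 0 is positive and the mass finite. *)
have f2 : E (laplace2 g) \is a fin_num.
  rewrite ge0_fin_numE// ltey; apply/eqP => E2oo; move: H1.
  by rewrite E2oo gt0_muley// leye_eq -(fineK f1) -EFinM.
have f2' : E' (laplace2 g) \is a fin_num.
  rewrite ge0_fin_numE// ltey; apply/eqP => E2oo; move: H1'.
  by rewrite E2oo gt0_muley// leye_eq -(fineK f1') -EFinM.
have diff2 : (E (laplace2 g) = E' (laplace2 g) + e1%:E)%E.
  rewrite -ve1 /E /E' -integralD//.
    apply: eq_integral => w _; rewrite -EFinD; congr EFin.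
    by rewrite -[RHS]/(laplace2 g (- v w) + v w); have := laplace2B g (v w); lra.
  apply/integrableP; split; first exact: (mk _ m2).2.
  rewrite (_ : \int[P]_w _ = E' (laplace2 g))%E; first by rewrite -ge0_fin_numE.
  by apply: eq_integral => w _; rewrite gee0_abs// lee_fin.
have EE : (\int[P]_w (expR (- (g * `|dot theta (X w)|)))%:E =
    (2 / g)%:E * E (laplace0 g))%E.
  rewrite -ge0_integralZl_EFin//; first last.
  - by rewrite divr_ge0// ltW.
  - exact: (mk _ m0).1.
  - by move=> w _; rewrite lee_fin ltW.
  apply: eq_integral => w _; rewrite laplace0E -EFinM mulrA (_ : 2 / g * (g / 2) = 1) ?mul1r//.
  by field; exact: lt0r_neq0.
rewrite EE -[leRHS]mule1; apply: lee_wpmul2l; first by rewrite lee_fin divr_ge0// ltW.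
apply: (two_sided_exponential_bound_ereal f0 f1 f1' f2 f2' f3 f3' E0_gt0 E1_gt0
  E1'_gt0 E2_ge0 E2'_ge0 sum1 H1 H1' H2 H2' diff2 sum3).
  by rewrite lee_fin invr_ge0 sqr_ge0.
by rewrite -e12 in theta1; lra.
Qed.

End anticoncentration_bound.

(** * Branch-and-bound trees *)

Lemma pairwise_all_rem (T : eqType) (r : rel T) (s : seq T) (x : T) :
  symmetric r -> pairwise r s -> x \in s -> all (r x) (rem x s).
Proof.
move=> sym; elim: s => //= y s IH /andP[ys ps]; rewrite inE eq_sym.
have [<- _|yx /= xs] := eqVneq y x; first by [].
by rewrite IH// andbT sym (allP ys).
Qed.

Lemma mem_rem_neq (T : eqType) (s : seq T) (x y : T) :
  x \in s -> x != y -> x \in rem y s.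
Proof.
move=> xs xy; have [ys|yNs] := boolP (y \in s); last by rewrite rem_id.
by have := perm_mem (perm_to_rem ys) x; rewrite inE (negbTE xy) xs => /esym.
Qed.

Section branch_and_bound.
Context {R : realType} {m n : nat}.
Variables (A : 'M[R]_(m, n)) (b : 'cV[R]_m) (c : 'cV[R]_n).
Implicit Types (N : node (n := n)) (x y : 'cV[R]_n).

(** The form taken by incomparability in the tree: opposite decisions where two paths part.
    Descendants inherit it. *)
Definition node_conflict : rel (node (n := n)) :=
  fun N N' => has (fun h => (h.1, ~~ h.2) \in N') N.

Lemma node_conflict_sym : symmetric node_conflict.
Proof.
have half N N' : node_conflict N N' -> node_conflict N' N.
  move=> /hasP[[i be] hN /= hN']; apply/hasP; exists (i, ~~ be) => //=.
  by rewrite negbK.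
by move=> N N'; apply/idP/idP; exact: half.
Qed.

Lemma node_conflict_disjoint N N' x :
  node_conflict N N' -> LP_feasible A b N x -> ~ LP_feasible A b N' x.
Proof.
move=> /hasP[[i be] hN /= hN'] [_ _ xN] [_ _ xN'].
have := xN _ _ hN; rewrite (xN' _ _ hN') => /eqP; rewrite eqr_nat.
by case: be {hN hN'}.
Qed.

Lemma LP_feasible_cons h N x : LP_feasible A b (h :: N) x -> LP_feasible A b N x.
Proof.
by move=> [cx sx hx]; split => // i be iN; apply: hx; rewrite inE iN orbT.
Qed.

Lemma LP_feasible_nil N x : LP_feasible A b N x -> LP_feasible A b [::] x.
Proof. by move=> [cx sx _]; split. Qed.

Lemma node_value_ge N x : LP_feasible A b N x ->
  ((objective c x)%:E <= node_value A b c N)%E.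
Proof. by move=> Nx; apply: ereal_sup_ubound; exists x. Qed.

Lemma optimal_node_value N x : optimal_basic_solution A b c N x ->
  node_value A b c N = (objective c x)%:E.
Proof.
move=> [Nx opt _]; apply/eqP; rewrite eq_le node_value_ge// andbT.
by apply: ge_ereal_sup => _ [y Ny <-]; rewrite lee_fin opt.
Qed.

Lemma best_value_cons x S :
  (best_value c (x :: S) = maxe (objective c x)%:E (best_value c S))%E.
Proof. by rewrite /best_value big_cons. Qed.

(* Distinct branched nodes have distinct LP solutions: the solution branched on
   at a node is infeasible for both its children, and nodes none of which is an
   ancestor of another are infeasible for each other's solutions. *)
Lemma bb_reachable_invariant y s : IP_feasible A b y -> bb_reachable A b c s ->
  exists L : seq 'cV[R]_n,
  [/\ uniq L /\ size (bb_tree s) = (size L).*2.+1,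
      forall x, x \in L -> [/\ LP_feasible A b [::] x,
        objective c y <= objective c x & \rank (tight_constraints A b x) = n],
      pairwise node_conflict (bb_unprocessed s),
      forall x N, x \in L -> N \in bb_unprocessed s -> ~ LP_feasible A b N x
    & ((objective c y)%:E <= best_value c (bb_solutions s))%E \/
      exists2 N, N \in bb_unprocessed s & LP_feasible A b N y].
Proof.
move=> [biny saty]; elim => [|s1 s2 _ [L [[uL sL] LP pU LU opt]] step].
  exists [::]; split => //; right; exists [::] => //; split => // i.
  by case: (biny i) => ->; rewrite ?lexx ?ler01.
case: step sL pU LU opt => [T U S N|T U S N x|T U S N x i] sel.
- move=> prune /= sL pU LU opt; exists L; split => //.
  + by apply: subseq_pairwise pU; exact: rem_subseq.
  + by move=> x M xL /mem_rem; exact: LU.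
  case: opt => [?|[M MU My]]; [by left|].
  have [MN|MN] := eqVneq M N; last by right; exists M => //; exact: mem_rem_neq.
  left; case: prune => [N0|]; first by move: My; rewrite MN N0.
  by apply: le_trans; rewrite -MN; exact: node_value_ge.
- move=> Nfeas Nbest optN binx /= sL pU LU opt; exists L; split => //.
  + by apply: subseq_pairwise pU; exact: rem_subseq.
  + by move=> z M zL /mem_rem; exact: LU.
  rewrite best_value_cons le_max.
  case: opt => [->|[M MU My]]; first by left; rewrite orbT.
  have [MN|MN] := eqVneq M N; last by right; exists M => //; exact: mem_rem_neq.
  left; apply/orP; left; rewrite -(optimal_node_value optN) -MN.
  exact: node_value_ge.
- move=> Nfeas Nbest optN xi /= sL pU LU opt.
  have [Nx _ rkx] := optN.
  have [NU selN] := sel.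
  exists (x :: L); split => /=.
  + rewrite uL andbT; split; first by apply/negP => /LU /(_ NU); apply.
    by rewrite sL doubleS.
  + move=> z; rewrite inE => /orP[/eqP->|]; last exact: LP.
    split=> //; first exact: LP_feasible_nil Nx.
    rewrite -lee_fin -(optimal_node_value optN).
    (* Best bound enters here: either the incumbent is as good as [y] and the unpruned node beats
       it, or [y] lies in an unprocessed node, whose value the selected one dominates. *)
    case: opt => [yS|[M MU My]]; first exact: le_trans (ltW Nbest).
    by apply: le_trans (selN _ MU); exact: node_value_ge.
  + have pN := pairwise_all_rem node_conflict_sym pU NU.
    rewrite (subseq_pairwise (rem_subseq _ _) pU) andbT.
    rewrite -andbA; apply/and3P; split; first by apply/orP; left; rewrite inE eqxx.
      by apply/allP => M /(allP pN) /hasP[h hN hM]; apply/orP; right; apply/hasP; exists h.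
    by apply/allP => M /(allP pN) /hasP[h hN hM]; apply/orP; right; apply/hasP; exists h.
  + move=> z M; rewrite !inE => zL.
    have child be : ~ LP_feasible A b ((i, be) :: N) z.
      move=> zN; have := zL => /orP[/eqP zx|zL']; last exact: LU zL' NU (LP_feasible_cons zN).
      case: zN => _ _ /(_ i be); rewrite inE eqxx zx => /(_ isT) xE.
      by move: xi; rewrite xE; case: (be); rewrite ?ltxx ?andbF.
    move=> /or3P[/eqP->|/eqP->|MU]; [exact: child..|].
    move: zL => /orP[/eqP->|zL]; last exact: LU zL (mem_rem MU).
    have pN := pairwise_all_rem node_conflict_sym pU NU.
    exact: node_conflict_disjoint (allP pN _ MU) Nx.
  + case: opt => [yS|[M MU My]]; [by left|right].
    have [MN|MN] := eqVneq M N; last first.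
      by exists M => //; rewrite !inE (mem_rem_neq MU MN) !orbT.
    have : exists be : bool, y i 0 = be%:R.
      by case: (biny i) => ->; [exists false|exists true].
    case=> be yE; exists ((i, be) :: N).
      by case: (be); rewrite !inE eqxx ?orbT.
    rewrite MN in My; case: My => cy sy hy; split => // j be'.
    by rewrite inE => /orP[/eqP[-> ->]|/hy].
Qed.

End branch_and_bound.

(** * Linear programming duality *)

(** Elimination of one functional. If the others do not suffice, some [z1] has [a0 z1 = 1],
    [c z1 > 0] and all others nonpositive; replacing each [f] by [f - f z1 * a0] amounts to
    projecting along [z1] onto the kernel of [a0]. *)
Lemma farkas (R : realFieldType) (V : lmodType R) (N : nat)
    (a : 'I_N -> {scalar V}) (c : {scalar V}) :
  (forall z, (forall i, a i z <= 0) -> c z <= 0) ->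
  exists2 y : 'I_N -> R, forall i, 0 <= y i & forall z, c z = \sum_i y i * a i z.
Proof.
elim: N a c => [|N IH] a c H.
  exists (fun=> 0) => // z; rewrite big_ord0; apply/eqP; rewrite eq_le.
  rewrite H => [|[]//]; have := H (- z); rewrite linearN oppr_le0; apply=> -[]//.
have [P|/existsNP[z0 /not_implyP[az0 /negP cz0]]] := pselect
    (forall z, (forall i, a (lift ord0 i) z <= 0) -> c z <= 0).
  have [y y0 cE] := IH _ _ P.
  exists (fun i => oapp y 0 (unlift ord0 i)).
    by move=> i; case: (unlift ord0 i).
  move=> z; rewrite big_ord_recl unlift_none mul0r add0r cE.
  by apply: eq_bigr => i _; rewrite liftK.
rewrite -ltNge in cz0.
set a0 := a ord0.
have a0z0 : 0 < a0 z0.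
  rewrite ltNge; apply/negP => a0z0; move: cz0; rewrite ltNge H// => i.
  by case: (unliftP ord0 i) => [j ->|->].
pose z1 := (a0 z0)^-1 *: z0.
have a0z1 : a0 z1 = 1 by rewrite linearZ/= mulVf// gt_eqF.
have cz1 : 0 < c z1 by rewrite linearZ/= mulr_gt0// invr_gt0.
have az1 i : a (lift ord0 i) z1 <= 0.
  by rewrite linearZ/= pmulr_rle0// invr_gt0.
have red (f : {scalar V}) : exists g : {scalar V}, forall z, g z = f z - f z1 * a0 z.
  exists (f \- f z1 \*: a0)%R.
  by move=> z.
have /choice[a' a'E] : forall i, exists g : {scalar V}, forall z,
    g z = a (lift ord0 i) z - a (lift ord0 i) z1 * a0 z by move=> i; exact: red.
have [c' c'E] := red c.
have [z az|y y0 c'y] := IH a' c'.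
  have e (f : {scalar V}) : f (z - a0 z *: z1) = f z - f z1 * a0 z.
    by rewrite linearB linearZ/= mulrC.
  rewrite c'E -e; apply: H => i; case: (unliftP ord0 i) => [j ->|->].
    by rewrite e -a'E.
  by rewrite e -/a0 a0z1 mul1r subrr.
(* The coefficient of [a0] is forced by evaluation at [z1], and the signs there make it
   nonnegative. *)
exists (fun i => oapp y (c z1 - \sum_j y j * a (lift ord0 j) z1) (unlift ord0 i)).
  move=> i; case: (unlift ord0 i) => //=.
  rewrite subr_ge0 (le_trans _ (ltW cz1))//; apply: sumr_le0 => j _.
  by rewrite mulr_ge0_le0.
move=> z; rewrite big_ord_recl unlift_none/= -/a0.
have := c'y z; rewrite c'E => /eqP; rewrite subr_eq => /eqP->.
have -> : \sum_i y i * a' i z = \sum_i y i * a (lift ord0 i) z -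
    (\sum_i y i * a (lift ord0 i) z1) * a0 z.
  by rewrite mulr_suml -sumrB; apply: eq_bigr => i _; rewrite a'E; ring.
have -> : \sum_(i < N) oapp y (c z1 - \sum_j y j * a (lift ord0 j) z1)
    (unlift ord0 (lift ord0 i)) * a (lift ord0 i) z = \sum_i y i * a (lift ord0 i) z.
  by apply: eq_bigr => i _; rewrite liftK.
ring.
Qed.

Lemma farkas_fin (R : realFieldType) (V : lmodType R) (I : finType)
    (a : I -> {scalar V}) (c : {scalar V}) :
  (forall z, (forall i, a i z <= 0) -> c z <= 0) ->
  exists2 y : I -> R, forall i, 0 <= y i & forall z, c z = \sum_i y i * a i z.
Proof.
move=> H.
have [z az|y y0 cE] := @farkas R V #|I| (fun j => a (enum_val j)) c.
  by apply: H => i; rewrite -(enum_rankK i).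
exists (fun i => y (enum_rank i)) => // z; rewrite cE.
rewrite (reindex (@enum_rank I)) /=; last by apply: onW_bij; exact: enum_rank_bij.
by apply: eq_bigr => i _; rewrite enum_rankK.
Qed.

Section linear_program_dual.
Context {R : realType} {m n : nat}.
Variables (A : 'M[R]_(m, n)) (b : 'cV[R]_m) (c : 'cV[R]_n).
Implicit Types (u : 'cV[R]_m) (x : 'cV[R]_n).

Definition reduced_cost u (i : 'I_n) : R := c i 0 - \sum_k A k i * u k 0.

Definition dual_objective u : R :=
  \sum_k u k 0 * b k 0 + \sum_i Num.max 0 (reduced_cost u i).

Lemma objectiveE x : objective c x = \sum_i c i 0 * x i 0.
Proof. by rewrite /objective mxE; apply: eq_bigr => i _; rewrite mxE. Qed.

Lemma objective_reduced_cost u x : objective c x =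
  \sum_k u k 0 * (A *m x) k 0 + \sum_i reduced_cost u i * x i 0.
Proof.
rewrite objectiveE.
under [X in _ = X + _]eq_bigr do rewrite mxE mulr_sumr.
rewrite exchange_big -big_split/=; apply: eq_bigr => i _.
rewrite /reduced_cost mulrBl mulr_suml addrC -addrA.
rewrite (_ : - _ + _ = 0) ?addr0//; apply/eqP; rewrite addrC subr_eq0; apply/eqP.
by apply: eq_bigr => k _; ring.
Qed.

(** Keeps the slack of the box constraints: on [[0, 1]], [max(0, r) - r * x] equals [|r| * |x -
    [r > 0]|]. *)
Lemma weak_duality u x : (forall k, 0 <= u k 0) -> LP_feasible A b [::] x ->
  objective c x + \sum_i `|reduced_cost u i| * `|x i 0 - (0 < reduced_cost u i)%R%:R|
    <= dual_objective u.
Proof.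
move=> u0 [cubex Axb _].
rewrite (objective_reduced_cost u) -addrA -big_split/= lerD//.
  by apply: ler_sum => k _; rewrite ler_wpM2l.
apply: ler_sum => i _; set r := reduced_cost u i.
have /andP[x0 x1] := cubex i.
have [r0|r0] := ltP 0 r; rewrite /=.
  rewrite (gtr0_norm r0) ler0_norm ?subr_le0//; lra.
rewrite ler0_norm// subr0 ger0_norm//; lra.
Qed.

(** Farkas applied to the homogenised program in [(x, t)], with [A x <= t b] and [0 <= x <= t]. A
    coordinate of [x] gives [0 <= t], and at [t = 0] the box forces [x = 0]. *)
Lemma strong_duality (v : R) : (0 < n)%N ->
  (forall x, LP_feasible A b [::] x -> objective c x <= v) ->
  exists2 u : 'cV[R]_m, forall k, 0 <= u k 0 & dual_objective u <= v.
Proof.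
move=> n0 ub.
pose V := ('cV[R]_n * R^o)%type : lmodType R.
have mkf (l : 'cV[R]_n) (s : R) : exists f : {scalar V}, forall z,
    f z = \sum_i l i 0 * z.1 i 0 - s * z.2.
  pose f (z : V) : R := \sum_i l i 0 * z.1 i 0 - s * z.2.
  have lf : scalar f.
    move=> k [x t] [y t']; rewrite /f /= mulrBr mulr_sumr.
    rewrite (_ : (k *: t + t' : R^o) = k * t + t' :> R)//.
    under eq_bigr do rewrite !mxE mulrDr.
    rewrite big_split/= mulrDr (_ : \sum_i _ = \sum_i k * (l i 0 * x i 0)); first by ring.
    by apply: eq_bigr => i _; ring.
  pose F := GRing.isLinear.Build _ _ _ _ f lf.
  by exists (HB.pack_for {scalar V} f F).
have /choice[fA fAE] : forall k, exists f : {scalar V}, forall z,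
    f z = \sum_i A k i * z.1 i 0 - b k 0 * z.2.
  move=> k; have [f fE] := mkf (\col_i A k i) (b k 0); exists f => z.
  by rewrite fE; congr (_ - _); apply: eq_bigr => i _; rewrite mxE.
have delta i (z : V) (s : R) : \sum_j (s *: delta_mx i 0 : 'cV[R]_n) j 0 * z.1 j 0 = s * z.1 i 0.
  rewrite (bigD1 i)//= big1 ?addr0; first by rewrite !mxE !eqxx mulr1.
  by move=> j ji; rewrite !mxE (negbTE ji) mulr0 mul0r.
have /choice[fl flE] : forall i, exists f : {scalar V}, forall z, f z = - z.1 i 0.
  move=> i; have [f fE] := mkf (-1 *: delta_mx i 0) 0; exists f => z.
  by rewrite fE delta mul0r subr0 mulN1r.
have /choice[fu fuE] : forall i, exists f : {scalar V}, forall z, f z = z.1 i 0 - z.2.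
  move=> i; have [f fE] := mkf (1 *: delta_mx i 0) 1; exists f => z.
  by rewrite fE delta !mul1r.
have [fc fcE] := mkf c v.
pose a (j : 'I_m + ('I_n + 'I_n)) := match j with
  | inl k => fA k | inr (inl i) => fl i | inr (inr i) => fu i end.
have [[x t] az|y y0 cE] := @farkas_fin R V _ a fc.
  have xA k : \sum_i A k i * x i 0 <= b k 0 * t.
    by have := az (inl k); rewrite /= fAE/= subr_le0.
  have x0 i : 0 <= x i 0 by have := az (inr (inl i)); rewrite /= flE/= oppr_le0.
  have xt i : x i 0 <= t by have := az (inr (inr i)); rewrite /= fuE/= subr_le0.
  have : 0 <= t by exact: le_trans (x0 (Ordinal n0)) (xt _).
  rewrite fcE /= le_eqVlt => /orP[/eqP t0|t0].
    rewrite -t0 mulr0 subr0 big1// => i _.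
    by rewrite (_ : x i 0 = 0) ?mulr0//; apply/eqP; rewrite eq_le x0 andbT [leRHS]t0.
  have : objective c (t^-1 *: x) <= v.
    apply: ub; split => //.
    - move=> i; rewrite mxE; rewrite mulr_ge0 ?invr_ge0 ?(ltW t0)//=.
      by rewrite mulrC ler_pdivrMr// mul1r.
    - by move=> k; rewrite -scalemxAr !mxE mulrC ler_pdivrMr.
  have -> : objective c (t^-1 *: x) = t^-1 * \sum_i c i 0 * x i 0.
    by rewrite objectiveE mulr_sumr; apply: eq_bigr => i _; rewrite mxE mulrCA.
  by rewrite mulrC ler_pdivrMr// -subr_le0 (mulrC v).
exists (\col_k y (inl k)) => [k|]; first by rewrite mxE.
have sumE z : fc z = \sum_k y (inl k) * fA k z +
    (\sum_i y (inr (inl i)) * fl i z + \sum_i y (inr (inr i)) * fu i z).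
  by rewrite cE big_sumType/= big_sumType.
(* Evaluation of the Farkas identity at [(0, 1)] gives the dual value, and at the unit vectors the
   dual equations. *)
have at1 : v = \sum_k y (inl k) * b k 0 + \sum_i y (inr (inr i)).
  have := sumE (0, 1); rewrite fcE/= mulr1 big1 ?sub0r => [|i _]; last by rewrite mxE mulr0.
  rewrite [X in _ = _ + (X + _)]big1 ?add0r => [|i _]; last by rewrite flE/= mxE oppr0 mulr0.
  rewrite (_ : \sum_k y (inl k) * fA k (0, 1) = - \sum_k y (inl k) * b k 0); last first.
    rewrite -sumrN; apply: eq_bigr => k _; rewrite fAE/= mulr1 big1 ?sub0r ?mulrN// => i _.
    by rewrite mxE mulr0.
  rewrite (_ : \sum_i y (inr (inr i)) * fu i (0, 1) = - \sum_i y (inr (inr i))); last first.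
    by rewrite -sumrN; apply: eq_bigr => i _; rewrite fuE/= mxE sub0r mulrN1.
  by move=> /eqP; rewrite -opprD eqr_opp => /eqP.
have sdelta (l : 'I_n -> R) i : \sum_j l j * (delta_mx i 0 : 'cV[R]_n) j 0 = l i.
  rewrite (bigD1 i)//= big1 ?addr0; first by rewrite mxE !eqxx mulr1.
  by move=> j ji; rewrite mxE (negbTE ji) mulr0.
have atd i : c i 0 = \sum_k y (inl k) * A k i - y (inr (inl i)) + y (inr (inr i)).
  have := sumE (delta_mx i 0, 0); rewrite fcE/= mulr0 subr0 sdelta => ->.
  rewrite -addrA; congr (_ + (_ + _)).
  - by apply: eq_bigr => k _; rewrite fAE/= mulr0 subr0 sdelta.
  - transitivity (\sum_j (- y (inr (inl j))) * (delta_mx i 0 : 'cV[R]_n) j 0); last by rewrite sdelta.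
    by apply: eq_bigr => j _; rewrite flE/= mulrN mulNr.
  - transitivity (\sum_j (y (inr (inr j))) * (delta_mx i 0 : 'cV[R]_n) j 0); last by rewrite sdelta.
    by apply: eq_bigr => j _; rewrite fuE/= subr0.
rewrite at1 /dual_objective; apply: lerD.
  by apply: ler_sum => k _; rewrite mxE.
apply: ler_sum => i _; rewrite ge_max y0/= /reduced_cost atd.
have -> : \sum_k A k i * (\col_k y (inl k)) k 0 = \sum_k y (inl k) * A k i.
  by apply: eq_bigr => k _; rewrite mxE mulrC.
have := y0 (inr (inl i)); lra.
Qed.

(** The affine functions of [u] whose zeros bound the feasible set or the linear pieces of the dual
    objective; those of the first kind may have either sign. *)
Definition dual_slack u (j : 'I_n + 'I_m) : R :=
  match j with inl i => reduced_cost u i | inr k => u k 0 end.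

Definition dual_slope (w : 'cV[R]_m) (j : 'I_n + 'I_m) : R :=
  match j with inl i => - \sum_k A k i * w k 0 | inr k => w k 0 end.

Lemma dual_slack_line u w t j :
  dual_slack (u + t *: w) j = dual_slack u j + t * dual_slope w j.
Proof.
case: j => [i|k] /=; last by rewrite !mxE.
rewrite /reduced_cost mulrN -addrA -opprD; congr (_ - _).
by rewrite mulr_sumr -big_split/=; apply: eq_bigr => k _; rewrite !mxE; ring.
Qed.

Definition tight_duals u : 'M[R]_(n + m, m) :=
  col_mx (\matrix_(i < n, k < m) (if reduced_cost u i == 0 then A k i else 0))
         (diag_mx (\row_(k < m) (u k 0 == 0)%:R)).

Lemma tight_duals_kernel u w : tight_duals u *m w = 0 ->
  forall j, dual_slack u j = 0 -> dual_slope w j = 0.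
Proof.
rewrite mul_col_mx -col_mx0 => /eq_col_mx[E1 E2] [i|k] /= H.
  have := congr1 (fun M : 'cV[R]_n => M i 0) E1; rewrite !mxE => E.
  apply/eqP; rewrite oppr_eq0 -[X in _ == X]E; apply/eqP/eq_bigr => k _.
  by rewrite mxE H eqxx.
have := congr1 (fun M : 'cV[R]_m => M k 0) E2; rewrite mul_diag_mx !mxE H eqxx.
by rewrite mul1r.
Qed.

(* Moving a dual minimiser both ways along a direction that keeps its zero
   slacks, up to the first sign change of a slack, leaves the piecewise linear
   dual objective constant, and one of the two moves creates a new zero slack. *)
Lemma dual_vertex_step (v : R) u :
  (forall u', (forall k, 0 <= u' k 0) -> v <= dual_objective u') ->
  (forall k, 0 <= u k 0) -> dual_objective u <= v ->
  \rank (tight_duals u) != m ->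
  exists u' : 'cV[R]_m, [/\ forall k, 0 <= u' k 0, dual_objective u' <= v &
    (#|[pred j | dual_slack u' j != 0%R]| < #|[pred j | dual_slack u j != 0%R]|)%N].
Proof.
move=> lbv u0 uv rk.
have [w wN0 Qw] : exists2 w : 'cV[R]_m, w != 0 & tight_duals u *m w = 0.
  have kN0 : kermx (tight_duals u)^T != 0.
    by rewrite -mxrank_eq0 mxrank_ker mxrank_tr subn_eq0 -ltnNge ltn_neqAle rk rank_leq_col.
  have /rowV0Pn[r /sub_kermxP rQ rN0] := kN0; exists r^T.
    by rewrite -(inj_eq trmx_inj) trmxK trmx0.
  by apply: trmx_inj; rewrite trmx_mul trmxK rQ trmx0.
have Jw := tight_duals_kernel Qw.
have [k wk] : exists k, w k 0 != 0.
  apply: contrapT => /forallNP H; move/eqP: wN0; apply; apply/matrixP => k j.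
  by rewrite ord1 mxE; apply/eqP; have := H k; move/negP; rewrite negbK.
pose J := [pred j | (dual_slope w j != 0) && (dual_slack u j != 0)].
have Jk : J (inr k) by rewrite /J /= wk; apply: contraNneq wk => uk; apply/eqP; exact: (Jw (inr k)).
(* The distance at which slack [j] vanishes along [w] or [- w]; [Jk] guarantees that there is one to
   minimise. *)
pose ratio j := `|dual_slack u j| / `|dual_slope w j|.
have [j0 /andP[sj0 lj0] minj] := arg_minP ratio Jk.
pose t := ratio j0.
have tle j : `|t * dual_slope w j| <= `|dual_slack u j|.
  have [sj|sj] := eqVneq (dual_slope w j) 0; first by rewrite sj mulr0 normr0.
  have [lj|lj] := eqVneq (dual_slack u j) 0; first by rewrite (Jw j) ?mulr0 ?normr0.
  have sj' : 0 < `|dual_slope w j| by rewrite normr_gt0.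
  rewrite normrM ger0_norm ?divr_ge0// -ler_pdivlMr//.
  by apply: minj; rewrite /J /= sj lj.
have pm0 (x e : R) : `|e| <= `|x| -> 0 <= x -> 0 <= x + e /\ 0 <= x - e.
  by move=> ex x0; rewrite (ger0_norm x0) ler_norml in ex; case/andP: ex => *; split; lra.
have pm_max (x e : R) : `|e| <= `|x| ->
    Num.max 0 (x + e) + Num.max 0 (x - e) = 2 * Num.max 0 x.
  move=> ex; have [x0|x0] := leP 0 x.
    by have [h1 h2] := pm0 _ _ ex x0; rewrite !max_r//; ring.
  have [h1 h2] : 0 <= - x + e /\ 0 <= - x - e by apply: pm0; rewrite ?normrN// oppr_ge0 ltW.
  by rewrite !max_l; lra.
have feas s : `|s| = t -> forall k, 0 <= (u + s *: w) k 0.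
  move=> st k'; have := dual_slack_line u w s (inr k'); rewrite /= => ->.
  have := tle (inr k') => /=; rewrite normrM ger0_norm ?divr_ge0// -st -normrM => h.
  by have [] := pm0 _ _ h (u0 k').
have t0 : 0 <= t by rewrite divr_ge0.
have Dsum : dual_objective (u + t *: w) + dual_objective (u + - t *: w) =
    2 * dual_objective u.
  rewrite /dual_objective addrACA -!big_split/= mulrDr !mulr_sumr.
  congr (_ + _); apply: eq_bigr => i _; first by rewrite !mxE; ring.
  have := dual_slack_line u w t (inl i); have := dual_slack_line u w (- t) (inl i).
  by rewrite /= mulNr => -> ->; apply: pm_max; exact: tle (inl i).
have Nt : `|- t| = t by rewrite normrN ger0_norm.
have Pt : `|t| = t by rewrite ger0_norm.
(* Both ends have dual value at least [v] and their mean is at most [v], so either end may be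
   chosen. *)
have Dp := lbv _ (feas _ Pt).
have Dm := lbv _ (feas _ Nt).
have [s st s0] : exists2 s, `|s| = t & dual_slack u j0 + s * dual_slope w j0 = 0.
  exists (- dual_slack u j0 / dual_slope w j0).
    by rewrite normrM normrN normfV.
  by rewrite divfK// subrr.
exists (u + s *: w); split; first exact: feas.
  have : s = t \/ s = - t.
    rewrite -st; have [hs|hs] := leP 0 s; first by left; rewrite ger0_norm.
    by right; rewrite ltr0_norm ?opprK.
  by case=> ->; lra.
apply: proper_card; apply/properP; split.
  apply/fintype.subsetP => j; rewrite !inE dual_slack_line; apply: contraNneq => lj.
  by rewrite lj (Jw j lj) mulr0 addr0.
by exists j0; rewrite !inE ?dual_slack_line ?s0 ?eqxx.
Qed.

Lemma dual_vertex (v : R) u :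
  (forall u', (forall k, 0 <= u' k 0) -> v <= dual_objective u') ->
  (forall k, 0 <= u k 0) -> dual_objective u <= v ->
  exists u' : 'cV[R]_m, [/\ forall k, 0 <= u' k 0, dual_objective u' <= v
    & \rank (tight_duals u') = m].
Proof.
move=> lbv; have [N] := ubnP #|[pred j | dual_slack u j != 0%R]|.
elim: N u => // N IH u cardN u0 uv.
have [rk|rk] := eqVneq (\rank (tight_duals u)) m; first by exists u.
have [u' [u'0 u'v lt]] := dual_vertex_step lbv u0 uv rk.
by apply: (IH u') => //; exact: leq_trans lt _.
Qed.

(** The equations a dual vertex can satisfy: a vanishing reduced cost for each column of [A], then a
    vanishing coordinate [u k]. *)
Definition dual_rows : 'M[R]_(n + m, m) := col_mx A^T 1%:M.
Definition dual_rhs : 'cV[R]_(n + m) := col_mx c 0.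

(** Defined for singular systems too, where [invmx] returns its argument: the expectation bound then
    holds for every [beta], and [dual_basis] retains the meaningful ones. *)
Definition basic_dual (beta : {ffun 'I_m -> 'I_(n + m)}) : 'cV[R]_m :=
  invmx (rowsub beta dual_rows) *m rowsub beta dual_rhs.

Definition dual_basis (beta : {ffun 'I_m -> 'I_(n + m)}) : bool :=
  (rowsub beta dual_rows \in unitmx) && [forall k, 0 <= basic_dual beta k 0].

(** Full rank provides [m] independent rows of [tight_duals u]. None of them is zero, so they are
    rows of [dual_rows] whose equations [u] satisfies. *)
Lemma tight_duals_basic u : (forall k, 0 <= u k 0) -> \rank (tight_duals u) = m ->
  exists2 beta, dual_basis beta & basic_dual beta = u.
Proof.
move=> u0 rk.
have full : row_full (tight_duals u) by rewrite /row_full rk.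
pose beta := [ffun k => fullrankfun full k].
have ubeta : rowsub beta (tight_duals u) \in unitmx.
  rewrite (_ : rowsub beta _ = rowsub (fullrankfun full) (tight_duals u)).
    by rewrite -row_full_unit; exact: fullrowsub_full.
  by apply/matrixP => i j; rewrite !mxE ffunE.
have rowN0 i : row i (rowsub beta (tight_duals u)) != 0.
  apply/eqP => r0; have : row i 1%:M = 0 :> 'rV[R]_m.
    by rewrite -(mulmxV ubeta) row_mul r0 mul0mx.
  move=> /(congr1 (fun M : 'rV[R]_m => M 0 i)); rewrite !mxE eqxx => /eqP.
  by rewrite oner_eq0.
have tight j : row j (tight_duals u) != 0 ->
    row j (tight_duals u) = row j dual_rows /\ row j (dual_rows *m u) = row j dual_rhs.
  rewrite -[j]splitK; case: (fintype.split j) => /= [i|k].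
    rewrite /tight_duals /dual_rows /dual_rhs mul_col_mx !rowKu.
    have [r0|rN0] := eqVneq (reduced_cost u i) 0; last first.
      by rewrite (_ : row i _ = 0) ?eqxx//; apply/rowP => l; rewrite !mxE (negbTE rN0).
    move=> _; split; first by apply/rowP => l; rewrite !mxE r0 eqxx.
    apply/rowP => l; rewrite !mxE ord1; move/eqP: r0; rewrite subr_eq0 => /eqP->.
    by apply: eq_bigr => l' _; rewrite mxE.
  rewrite /tight_duals /dual_rows /dual_rhs mul_col_mx !rowKd mul1mx.
  have [r0|rN0] := eqVneq (u k 0) 0; last first.
    by rewrite (_ : row k _ = 0) ?eqxx//; apply/rowP => l; rewrite !mxE (negbTE rN0) mul0rn.
  move=> _; split; first by apply/rowP => l; rewrite !mxE r0 eqxx.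
  by apply/rowP => l; rewrite !mxE ord1 r0.
have rowE i (M : 'M[R]_(n + m, m)) : row i (rowsub beta M) = row (beta i) M.
  by apply/rowP => l; rewrite !mxE.
have E1 : rowsub beta (tight_duals u) = rowsub beta dual_rows.
  apply/row_matrixP => i; rewrite !rowE; have [|->//] := tight (beta i).
  by rewrite -rowE.
have E2 : rowsub beta dual_rows *m u = rowsub beta dual_rhs.
  apply/matrixP => i j; have [|_ H] := tight (beta i); first by rewrite -rowE.
  have := congr1 (fun M : 'rV[R]_1 => M 0 j) H; rewrite !mxE => <-.
  by apply: eq_bigr => l _; rewrite !mxE.
have bu : basic_dual beta = u by rewrite /basic_dual -E2 mulmxA mulVmx ?mul1mx// -E1.
exists beta => //; rewrite /dual_basis bu -E1 ubeta /=.
exact/fintype.forallP.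
Qed.

End linear_program_dual.

(** * Near-optimal vertices *)

Section integer_program_facts.
Context {R : realType} {m n : nat}.
Variables (A : 'M[R]_(m, n)) (b : 'cV[R]_m) (c : 'cV[R]_n).
Implicit Types (x y : 'cV[R]_n) (beta : {ffun 'I_m -> 'I_(n + m)}).

Lemma dual_basis_ge0 beta : dual_basis A c beta -> forall k, 0 <= basic_dual A c beta k 0.
Proof. by move=> /andP[_ /fintype.forallP]. Qed.

Lemma val_LP_le_dual beta : dual_basis A c beta ->
  (val_LP A b c <= (dual_objective A b c (basic_dual A c beta))%:E)%E.
Proof.
move=> /dual_basis_ge0 u0; apply: ge_ereal_sup => _ [x xF <-]; rewrite lee_fin.
by apply: le_trans (weak_duality c u0 xF); rewrite lerDl sumr_ge0// => i _; rewrite mulr_ge0.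
Qed.

Lemma val_LP_eq_dual : (0 < n)%N -> LP_feasible A b [::] !=set0 ->
  exists2 beta, dual_basis A c beta &
    val_LP A b c = (dual_objective A b c (basic_dual A c beta))%:E.
Proof.
move=> n_gt0 feas; have [x0 x0F] := feas.
have ub x : LP_feasible A b [::] x -> objective c x <= \sum_i `|c i 0|.
  move=> [cx _ _]; rewrite objectiveE; apply: ler_sum => i _.
  have /andP[xi0 xi1] := cx i.
  by rewrite (le_trans (ler_norm _))// normrM (ger0_norm xi0) ler_piMr.
have fin : val_LP A b c \is a fin_num.
  rewrite fin_numE; apply/andP; split.
    by rewrite -ltNye (lt_le_trans _ (node_value_ge c x0F))// ltNyr.
  rewrite -ltey (@le_lt_trans _ _ (\sum_i `|c i 0|)%:E) ?ltry//.
  by apply: ge_ereal_sup => _ [x xF <-]; rewrite lee_fin ub.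
pose v := fine (val_LP A b c).
have vE : (val_LP A b c = v%:E)%E by rewrite fineK.
have objv x : LP_feasible A b [::] x -> objective c x <= v.
  by move=> xF; rewrite -lee_fin -vE; exact: node_value_ge.
have [u u0 uv] := strong_duality n_gt0 objv.
have lbv (u' : 'cV[R]_m) : (forall k, 0 <= u' k 0) -> v <= dual_objective A b c u'.
  move=> u'0; rewrite -lee_fin -vE; apply: ge_ereal_sup => _ [x xF <-]; rewrite lee_fin.
  by apply: le_trans (weak_duality c u'0 xF); rewrite lerDl sumr_ge0// => i _; rewrite mulr_ge0.
have [u' [u'0 u'v rk]] := dual_vertex lbv u0 uv.
have [beta bb bu] := tight_duals_basic u'0 rk.
exists beta => //; rewrite bu vE; congr EFin; apply/eqP.
by rewrite eq_le u'v lbv.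
Qed.

(** Indexing binary points by a finite type makes the gap event a finite union. *)
Definition binary_col (s : {ffun 'I_n -> bool}) : 'cV[R]_n := \col_i (s i)%:R.

Lemma binary_vector_col x : binary_vector x -> exists s, x = binary_col s.
Proof.
move=> bx; exists [ffun i => x i 0 == 1]; apply/matrixP => i j; rewrite ord1 !mxE ffunE.
by case: (bx i) => ->; rewrite ?eqxx// eq_sym oner_eq0.
Qed.

Lemma binary_col_binary s : binary_vector (binary_col s).
Proof. by move=> i; rewrite mxE; case: (s i); [right|left]. Qed.

Lemma IP_feasible_LP x : IP_feasible A b x -> LP_feasible A b [::] x.
Proof.
move=> [bx sx]; split => // i.
by case: (bx i) => ->; rewrite ?lexx ?ler01.
Qed.

(** With the converse that follows, a small gap is witnessed by finitely many candidates, a binary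
    point and a dual basis. Measurability of the gap rests on this. *)
Lemma IPGAP_lt_exists (G : R) : (0 < n)%N -> (IPGAP A b c < G%:E)%E ->
  exists s, IP_feasible A b (binary_col s) /\
   exists2 beta, dual_basis A c beta &
    val_LP A b c = (dual_objective A b c (basic_dual A c beta))%:E /\
    dual_objective A b c (basic_dual A c beta) - objective c (binary_col s) < G.
Proof.
rewrite /IPGAP => n_gt0; case: ifPn => [/asboolP[x xF]|_]; last by rewrite ltNge leey.
have [beta bb vE] := val_LP_eq_dual n_gt0 (ex_intro _ x (IP_feasible_LP xF)).
rewrite vE lte_subel_addr//.
rewrite addeC -lte_subel_addr// -EFinB => /ereal_sup_gt[_ [y yF <-]]; rewrite lte_fin => lt.
have [s ys] := binary_vector_col yF.1; exists s; rewrite -ys; split => //.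
by exists beta => //; split => //; lra.
Qed.

Lemma exists_IPGAP_lt (G : R) s beta : satisfies_constraints A b (binary_col s) ->
  dual_basis A c beta ->
  dual_objective A b c (basic_dual A c beta) - objective c (binary_col s) < G ->
  (IPGAP A b c < G%:E)%E.
Proof.
move=> ss bb lt.
have sF : IP_feasible A b (binary_col s) by split => //; exact: binary_col_binary.
rewrite /IPGAP ifT; last by apply/asboolP; exists (binary_col s).
have le1 := val_LP_le_dual bb.
have le2 : ((objective c (binary_col s))%:E <= val_IP A b c)%E.
  by apply: ereal_sup_ubound; exists (binary_col s).
by apply: le_lt_trans (leeB le1 le2) _; rewrite -EFinB lte_fin.
Qed.

Definition frac x : {set 'I_n} := [set i | (x i 0 != 0) && (x i 0 != 1)]%SET.

Definition tight_rows x : {set 'I_m} := [set k | (A *m x) k 0 == b k 0]%SET.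

(** The tight rows of [A] contribute rank at most [m], and the diagonal block at most the number of
    integral coordinates, through which it factors. *)
Lemma card_frac x : \rank (tight_constraints A b x) = n -> (#|frac x| <= m)%N.
Proof.
move=> rk.
have : (n <= m + #|~: frac x|)%N.
  rewrite -{1}rk /tight_constraints; set U := \matrix_(k, j) _; set D := diag_mx _.
  rewrite -addsmxE (leq_trans (mxrank_adds_leqif _ _))// leq_add// ?rank_leq_row//.
  pose E : 'M[R]_(n, #|~: frac x|) := \matrix_(i, j) (i == enum_val j)%:R.
  have -> : D = E *m E^T.
    apply/matrixP => i j; rewrite !mxE.
    have [iF|iF] := boolP (i \in frac x).
      rewrite big1 => [|l _].
        have := iF; rewrite inE => /andP[/negbTE-> /negbTE->].
        by rewrite mul0rn.
      rewrite !mxE; case: eqP => [il|]; last by rewrite mul0r.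
      by have := enum_valP l; rewrite -il inE iF.
    have iC : i \in ~: frac x by rewrite inE.
    rewrite (bigD1 (enum_rank_in iC i))//= !mxE enum_rankK_in// eqxx mul1r.
    rewrite big1 ?addr0 => [|l lN]; last first.
      rewrite !mxE; case: eqP => [il|]; last by rewrite mul0r.
      by move/eqP: lN => []; apply: enum_val_inj; rewrite enum_rankK_in.
    have := iF; rewrite inE negb_and !negbK => ->.
    by rewrite eq_sym.
  exact: mulmx_max_rank.
by have := cardsC (frac x); rewrite card_ord; lia.
Qed.

(** The tight matrix of [x] annihilates [x - x'], and full column rank makes it injective. *)
Lemma tight_constraints_inj x x' : \rank (tight_constraints A b x) = n ->
  tight_rows x = tight_rows x' -> (forall i, i \notin frac x -> x i 0 = x' i 0) ->
  x = x'.
Proof.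
move=> rk xT xF; apply/eqP; rewrite -subr_eq0; apply/eqP.
have full : row_full (tight_constraints A b x) by rewrite /row_full rk.
apply: (row_full_inj full); rewrite mulmx0 mul_col_mx.
rewrite (_ : _ *m _ = 0) 1?(_ : diag_mx _ *m _ = 0) ?col_mx0//.
  apply/matrixP => i j; rewrite ord1 mul_diag_mx !mxE.
  have [iF|iF] := boolP (i \in frac x).
    by have := iF; rewrite inE => /andP[/negbTE-> /negbTE->]; rewrite mul0r.
  by rewrite (xF _ iF) subrr mulr0.
apply/matrixP => k j; rewrite ord1 mxE [RHS]mxE.
have [kT|kT] := boolP (k \in tight_rows x); last first.
  by rewrite big1// => l _; rewrite [X in X * _]mxE; have := kT; rewrite inE => /negbTE->; rewrite mul0r.
have kT' : k \in tight_rows x' by rewrite -xT.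
have := kT; have := kT'; rewrite !inE => /eqP E' /eqP E.
have E0 : (A *m (x - x')) k 0 = 0 by rewrite mulmxBr mxE E mxE E' subrr.
by rewrite -[RHS]E0 [RHS]mxE; apply: eq_bigr => l _; rewrite [X in X * _ = _]mxE E eqxx.
Qed.

(* Where a vertex x disagrees with the integral optimum of the Lagrangean
   relaxation at u. *)
Definition flips (u : 'cV[R]_m) x : {ffun 'I_n -> bool} :=
  [ffun i => (i \notin frac x) && (x i 0 != (0 < reduced_cost A c u i)%R%:R)].

(** A flipped coordinate is at distance exactly 1 from the Lagrangean optimum, so [weak_duality]
    charges it [|r_i|] in full. *)
Lemma flips_cost (u : 'cV[R]_m) x (G : R) : (forall k, 0 <= u k 0) ->
  LP_feasible A b [::] x -> dual_objective A b c u - objective c x <= G ->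
  \sum_i (flips u x i)%:R * `|reduced_cost A c u i| <= G.
Proof.
move=> u0 xF DG; have H := weak_duality c u0 xF.
apply: (@le_trans _ _ (\sum_i `|reduced_cost A c u i| *
  `|x i 0 - (0 < reduced_cost A c u i)%R%:R|)); last by lra.
apply: ler_sum => i _; rewrite mulrC ler_wpM2l// ffunE inE.
set r := (0 < _); case: andP => [[]|_]; last exact: normr_ge0.
rewrite negb_and !negbK => xi xr.
by move: xi xr => /orP[/eqP->|/eqP->]; case: r; rewrite ?eqxx// ?sub0r ?subr0 ?normrN normr1.
Qed.

Lemma flips_inj (u : 'cV[R]_m) x x' : \rank (tight_constraints A b x) = n ->
  frac x = frac x' -> tight_rows x = tight_rows x' -> flips u x = flips u x' -> x = x'.
Proof.
move=> rk xF xT xf; apply: tight_constraints_inj => // i iF.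
have := congr1 (fun f : {ffun _ -> _} => f i) xf; rewrite !ffunE -xF iF /=.
have iF' : i \notin frac x' by rewrite -xF.
move: iF iF'; rewrite !inE !negb_and !negbK.
case: (0 < _)%R => /orP[/eqP->|/eqP->] /orP[/eqP->|/eqP->] //;
  by rewrite ?eqxx ?(eq_sym 0 1) ?oner_eq0.
Qed.

Lemma card_small_sets : (#|[set F : {set 'I_n} | (#|F| <= m)%N]%SET| <= n.+1 ^ m)%N.
Proof.
(* [None] pads the sets with fewer than [m] elements, whence [n.+1] choices per position. *)
pose g (h : {ffun 'I_m -> option 'I_n}) : {set 'I_n} := [set i | [exists j, h j == Some i]]%SET.
have sub : [set F : {set 'I_n} | (#|F| <= m)%N]%SET \subset (g @: [set: {ffun 'I_m -> option 'I_n}])%SET.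
  apply/fintype.subsetP => F; rewrite inE => Fm; apply/imsetP.
  exists [ffun j : 'I_m => onth (enum F) j]; first by rewrite inE.
  apply/setP => i; rewrite inE -mem_enum; apply/onthP/existsP => [[k ki]|[j]].
    have kF : (k < #|F|)%N by rewrite cardE -onthTE ki.
    by exists (Ordinal (leq_trans kF Fm)); rewrite ffunE /= ki.
  by rewrite ffunE => /eqP E; exists j.
apply: leq_trans (subset_leq_card sub) _; apply: leq_trans (leq_imset_card _ _) _.
by rewrite cardsT card_ffun card_option !card_ord.
Qed.

End integer_program_facts.

(** * Counting branched nodes by weighted sets of columns *)

Section tree_size.
Context {R : realType} {m n : nat}.
Implicit Types beta : {ffun 'I_m -> 'I_(n + m)}.

Definition basis_columns beta : {set 'I_n} := [set i | [exists k, beta k == lshift m i]]%SET.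

Variables (A : 'M[R]_(m, n)) (b : 'cV[R]_m) (c : 'cV[R]_n).

(** Columns of the system [beta] determine the dual solution and are not independent of it. The
    weight 1 dominates the exponential and costs a factor 2 per such column. *)
Definition flip_weight (g : R) beta (i : 'I_n) : R :=
  if i \in basis_columns beta then 1
  else expR (- (g * `|reduced_cost A c (basic_dual A c beta) i|)).

Lemma flip_weight_gt0 g beta i : 0 < flip_weight g beta i.
Proof. by rewrite /flip_weight; case: ifPn => // _; exact: expR_gt0. Qed.

(** Exponential Markov bound: each counted set has [1 <= expR (g * G - g * cost)], and the sum over
    all sets factorises over the columns. *)
Lemma card_flips (g G : R) beta : 0 <= g ->
  #|[set f : {ffun 'I_n -> bool} | \sum_i (f i)%:R *
      `|reduced_cost A c (basic_dual A c beta) i| <= G]%SET|%:R <=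
  expR (g * G) * \prod_i (1 + flip_weight g beta i).
Proof.
move=> g0; set r := fun i => `|reduced_cost A c (basic_dual A c beta) i|.
rewrite -sum1_card natr_sum.
have -> : \prod_i (1 + flip_weight g beta i) =
    \sum_(f : {ffun 'I_n -> bool}) \prod_i (if f i then flip_weight g beta i else 1).
  rewrite -(bigA_distr_bigA (fun i (s : bool) => if s then flip_weight g beta i else 1)).
  apply: eq_bigr => i _.
  by rewrite big_bool /= addrC.
rewrite mulr_sumr big_mkcond /=; apply: ler_sum => f _; rewrite inE.
have pos : 0 <= \prod_i (if f i then flip_weight g beta i else 1).
  by apply: prodr_ge0 => i _; case: (f i) => //; exact/ltW/flip_weight_gt0.
case: ifPn => [fG|_]; last by rewrite mulr_ge0// expR_ge0.
apply: (@le_trans _ _ (expR (g * G) * \prod_i expR (- (g * ((f i)%:R * r i))))).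
  rewrite -expR_sum -expRD -[leLHS]expR0 ler_expR sumrN -mulr_sumr subr_ge0.
  exact: ler_wpM2l.
rewrite ler_pM2l ?expR_gt0//; apply: ler_prod => i _; rewrite expR_ge0/=.
rewrite /flip_weight; case: (f i); last by rewrite mul0r mulr0 oppr0 expR0.
rewrite mul1r; case: ifPn => // _.
by rewrite -[leRHS]expR0 ler_expR oppr_le0 mulr_ge0// normr_ge0.
Qed.

Lemma bb_tree_size_bound (g G : R) s : (0 < n)%N -> 0 <= g -> (IPGAP A b c < G%:E)%E ->
  bb_reachable A b c s ->
  (size (bb_tree s))%:R <= 1 + 2 * ((n.+1 ^ m * 2 ^ m)%:R *
    (expR (g * G) * \sum_beta \prod_i (1 + flip_weight g beta i))).
Proof.
move=> n_gt0 g0 gapG sreach.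
have [s0 [s0F [beta bb [vE DG]]]] := IPGAP_lt_exists n_gt0 gapG.
have [L [[uL ->] LP _ _ _]] := bb_reachable_invariant s0F sreach.
pose u := basic_dual A c beta.
have u0 : forall k, 0 <= u k 0 := dual_basis_ge0 bb.
pose S := [set f : {ffun 'I_n -> bool} | \sum_i (f i)%:R * `|reduced_cost A c u i| <= G]%SET.
pose small := [set F : {set 'I_n} | (#|F| <= m)%N]%SET.
pose X := finset.setX (finset.setX small [set: {set 'I_m}]%SET) S.
pose e x := (frac x, tight_rows A b x, flips A c u x).
have eX x : x \in L -> e x \in X.
  move=> /LP[xF xy rk]; rewrite !inE /= (card_frac rk) /=.
  by apply: flips_cost xF _ => //; lra.
have einj : {in L &, injective e}.
  move=> x x' /LP[_ _ rk] _ [E1 E2 E3]; exact: flips_inj rk E1 E2 E3.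
have sizeL : (size L <= n.+1 ^ m * 2 ^ m * #|S|)%N.
  apply: (@leq_trans #|X|).
    rewrite -(size_map e) cardE; apply: uniq_leq_size.
      by rewrite map_inj_in_uniq.
    by move=> _ /mapP[x xL ->]; rewrite mem_enum; exact: eX.
  rewrite !cardsX leq_mul2r; apply/orP; right; apply: leq_mul.
    exact: card_small_sets.
  by rewrite -powersetT card_powerset cardsT card_ord.
rewrite -addn1 natrD addrC lerD2l -muln2 mulnC natrM ler_wpM2l//.
have : (size L)%:R <= (n.+1 ^ m * 2 ^ m * #|S|)%:R :> R by rewrite ler_nat.
move=> /le_trans; apply; rewrite natrM ler_wpM2l//.
apply: le_trans (card_flips G beta g0) _; rewrite ler_wpM2l ?expR_ge0//.
(* The optimal [beta] varies with the data; the sum over all systems removes this dependence. *)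
rewrite [leRHS](bigD1 beta)//= lerDl sumr_ge0// => beta' _.
by apply: prodr_ge0 => i _; rewrite addr_ge0// ltW// flip_weight_gt0.
Qed.

End tree_size.

(** * Independent columns *)

Section boxes.
Context d (T : measurableType d) (n : nat).

Definition boxes : set (set (n.-tuple T)) :=
  [set D | exists2 B : 'I_n -> set T, forall j, measurable (B j) &
    D = [set v | forall j, B j (tnth v j)]].

Lemma measurable_boxes : boxes `<=` measurable.
Proof.
move=> _ [B mB ->].
rewrite (_ : [set v | _] = \bigcap_(j in [set: 'I_n]) (fun v => tnth v j) @^-1` B j).
  apply: fin_bigcap_measurable => // j _.
  by rewrite -[X in measurable X]setTI; exact: measurable_tnth.
by apply/seteqP; split=> [v Bv j _|v Bv j]; [exact: Bv|exact: (Bv j)].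
Qed.

Lemma setI_closed_boxes : setI_closed boxes.
Proof.
move=> _ _ [B mB ->] [B' mB' ->]; exists (fun j => B j `&` B' j).
  by move=> j; exact: measurableI.
apply/seteqP; split => [v [Bv B'v] j|v BB']; first by split.
by split => j; have [] := BB' j.
Qed.

Lemma boxes_setT : boxes setT.
Proof. by exists (fun=> setT) => //; apply/seteqP; split. Qed.

Lemma measurable_tuple_boxes (D : set (n.-tuple T)) : measurable D -> <<s boxes >> D.
Proof.
move: D; apply: smallest_sub; first exact: smallest_sigma_algebra.
move=> D; rewrite -bigcup_seq /= => -[i _ [B mB <-]].
apply: sub_sigma_algebra; exists (fun j => if j == i then B else setT).
  by move=> j; case: ifPn.
rewrite setTI; apply/seteqP; split => [v Bv j|v H].
  by have [->|] := eqVneq j i.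
by have := H i; rewrite eqxx.
Qed.

Lemma boxes_measure_unique (R : realType) (m1 m2 : {measure set (n.-tuple T) -> \bar R}) :
  (m1 setT < +oo)%E -> (forall D, boxes D -> m1 D = m2 D) ->
  forall D, measurable D -> m1 D = m2 D.
Proof.
move=> fin m12 D /measurable_tuple_boxes.
apply: (g_sigma_algebra_measure_unique boxes measurable_boxes (fun=> setT)) => //.
- by move=> _; exact: boxes_setT.
- exact: bigcup_const.
- exact: setI_closed_boxes.
Qed.

End boxes.

Section independence.
Context {R : realType} dO (Omega : measurableType dO) (P : probability Omega R).
Variables (d n : nat) (W : 'I_n -> {RV P >-> d.-tuple R}).
Hypothesis indW : mutually_independent W.

Definition joint (w : Omega) : n.-tuple (d.-tuple R) := [tuple W j w | j < n].

(** Column [i] is overwritten by a constant, not dropped, so that functions of all the columns still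
    apply to the remaining data. *)
Definition joint_erase (i : 'I_n) (w : Omega) : n.-tuple (d.-tuple R) :=
  [tuple if j == i then [tuple 0 | _ < d] else W j w | j < n].

Lemma measurable_joint_erase i : measurable_fun setT (joint_erase i).
Proof.
apply/measurable_fun_tnthP => j.
rewrite (_ : _ \o _ = fun w => if j == i then [tuple 0 | _ < d] else W j w); last first.
  by apply/funext => w /=; rewrite tnth_mktuple.
by case: (j == i).
Qed.

(** For fixed [C] both sides are finite measures in [D], and boxes, a pi-system generating the
    sigma-algebra, decide their equality. *)
Lemma joint_erase_independent i (D : set (n.-tuple (d.-tuple R))) C :
  measurable D -> measurable C ->
  P (joint_erase i @^-1` D `&` W i @^-1` C) = (P (joint_erase i @^-1` D) * P (W i @^-1` C))%E.
Proof.
move=> mD mC.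
have mWC : measurable (W i @^-1` C).
  by rewrite -[X in measurable X]setTI; exact: measurable_funP.
have fC : P (W i @^-1` C) \is a fin_num by exact: fin_num_measure.
have C0 : 0 <= fine (P (W i @^-1` C)) by exact: fine_ge0.
pose m1 : {measure set (n.-tuple (d.-tuple R)) -> \bar R} :=
  pushforward (mrestr P mWC) (joint_erase i).
pose m2 : {measure set (n.-tuple (d.-tuple R)) -> \bar R} :=
  mscale (NngNum C0) (pushforward P (joint_erase i)).
have mV := measurable_joint_erase i.
rewrite -[LHS]/(m1 mV D) muleC.
transitivity (m2 mV D); last by rewrite /m2 /= /mscale /= fineK.
apply: boxes_measure_unique mD.
  rewrite /m1 /= /pushforward /mrestr preimage_setT setTI ltey_eq.
  by rewrite fin_num_measure.
move=> _ [B mB ->]; rewrite /m1 /m2 /= /mscale /= /pushforward /mrestr fineK//.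
(* Side [i] of the box only sees the constant zero: it either empties the preimage or imposes
   nothing, and [C] can take its place. *)
have [B0|B0] := pselect (B i [tuple 0 | _ < d]); last first.
  rewrite (_ : _ @^-1` _ = set0) ?set0I ?measure0 ?mule0//.
  apply/seteqP; split => // w /= /(_ i); rewrite tnth_mktuple eqxx; exact: B0.
pose B' j := if j == i then C else B j.
have mB' j : measurable (B' j) by rewrite /B'; case: ifPn.
have E1 : joint_erase i @^-1` [set v | forall j, B j (tnth v j)] =
    \bigcap_(j in [set` [set~ i]%SET]) (W j @^-1` B' j).
  apply/seteqP; split => [w /= H j /=|w H j /=].
    rewrite !inE => ji; have := H j; rewrite tnth_mktuple /B' (negbTE ji).
    exact.
  rewrite tnth_mktuple; case: ifPn => [/eqP->//|ji].
  by have := H j; rewrite /= !inE /B' (negbTE ji); exact.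
have E2 : joint_erase i @^-1` [set v | forall j, B j (tnth v j)] `&` W i @^-1` C =
    \bigcap_(j in [set` [set: 'I_n]%SET]) (W j @^-1` B' j).
  rewrite E1; apply/seteqP; split => [w [H Ci] j _|w H].
    have [->|ji] := eqVneq j i; first by rewrite /B' eqxx.
    by apply: H; rewrite /= !inE.
  split; first by move=> j _; apply: H; rewrite /= inE.
  by have := H i; rewrite /= inE /B' eqxx; exact.
have Bi : B' i = C by rewrite /B' eqxx.
transitivity (\prod_(j in [set: 'I_n]%SET) P (W j @^-1` B' j))%E; first by rewrite E2 indW.
rewrite E1 indW// (bigD1 i) ?inE//= Bi; congr (_ * _)%E.
by apply: eq_bigl => j; rewrite !inE.
Qed.

Lemma expectation_joint_erase i (F : n.-tuple (d.-tuple R) * d.-tuple R -> \bar R) :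
  measurable_fun setT F -> (forall x, 0 <= F x)%E ->
  (\int[P]_w F (joint_erase i w, W i w) =
   \int[P]_w \int[P]_w' F (joint_erase i w, W i w'))%E.
Proof.
move=> mF F0.
have mV := measurable_joint_erase i.
have mWi : measurable_fun setT (W i) by exact: measurable_funP.
pose Vf : {mfun Omega >-> n.-tuple (d.-tuple R)} :=
  HB.pack (joint_erase i) (isMeasurableFun.Build _ _ _ _ _ mV).
pose m1 : probability _ R := distribution P (Vf : {RV P >-> _}).
pose m2 : probability _ R := distribution P (W i).
have mVW : measurable_fun setT (fun w => (joint_erase i w, W i w)).
  exact/measurable_fun_pair.
pose m12 : {measure set (n.-tuple (d.-tuple R) * d.-tuple R) -> \bar R} :=
  pushforward P (fun w => (joint_erase i w, W i w)).
have mE X : measurable X -> (m1 \x m2)%E X = m12 mVW X.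
  apply: product_measure_unique => D C mD mC.
  exact: joint_erase_independent.
transitivity (\int[m12 mVW]_x F x)%E.
  by rewrite ge0_integral_pushforward// preimage_setT.
rewrite (eq_measure_integral (m1 \x m2)%E); last by move=> X mX _; exact/esym/mE.
rewrite fubini_tonelli1// /fubini_F.
rewrite (@ge0_integral_distribution _ _ _ _ _ P (Vf : {RV P >-> _}))//.
- apply: eq_integral => w _ /=.
  rewrite (@ge0_integral_distribution _ _ _ _ _ P (W i))//.
  by apply: measurableT_comp => //; exact: measurable_pair1.
- exact: (measurable_fun_fubini_tonelli_F (m2 := m2)).
- by move=> v; exact: integral_ge0.
Qed.

End independence.

(** * Expected product over the columns outside a basis *)

Section product_expectation.
Context {R : realType} dO (Omega : measurableType dO) (P : probability Omega R).
Variables (d n : nat) (W : 'I_n -> {RV P >-> d.-tuple R}).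
Hypotheses (indW : mutually_independent W) (lcW : forall j, logconcave_vector (W j))
  (covW : forall j, identity_covariance (W j)).
Variables (g : R) (theta : n.-tuple (d.-tuple R) -> 'I_d -> R) (B : {set 'I_n}).
Hypotheses (g0 : 0 < g)
  (mtheta : forall k, measurable_fun setT (fun v => theta v k))
  (thetaB : forall v v', (forall j, j \in B -> tnth v j = tnth v' j) ->
    theta v = theta v')
  (theta1 : forall v, 1 <= \sum_k theta v k ^+ 2).

Let e v (y : d.-tuple R) := 1 + expR (- (g * `|dot (theta v) y|)).

Let e_ge0 v y : 0 <= e v y.
Proof. by rewrite addr_ge0// expR_ge0. Qed.

Let me : measurable_fun setT (fun p : n.-tuple (d.-tuple R) * d.-tuple R => e p.1 p.2).
Proof.
apply: measurable_funD => //; apply: measurableT_comp => //; apply: measurable_funN.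
apply: measurable_funM => //; apply: measurableT_comp => //.
apply: measurable_sum => k; apply: measurable_funM.
  exact: (measurableT_comp (mtheta k) measurable_fst).
exact: (measurableT_comp (measurable_tnth k) measurable_snd).
Qed.

(** Columns are integrated out one at a time. Column [i] affects neither [theta], as [i] is outside
    [B], nor the other factors, so its factor contributes at most [1 + 2 / g]. *)
Lemma expectation_prod_le (s : seq 'I_n) : uniq s -> {in s, forall i, i \notin B} ->
  (\int[P]_w (\prod_(i <- s) e (joint W w) (W i w))%:E <= ((1 + 2 / g) ^+ size s)%:E)%E.
Proof.
have bg : 0 <= 1 + 2 / g by rewrite addr_ge0// divr_ge0// ltW.
have mprod (t : seq 'I_n) :
    measurable_fun setT (fun v : n.-tuple (d.-tuple R) => \prod_(j <- t) e v (tnth v j)).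
  apply: measurable_prod => j _.
  apply: (measurableT_comp me (g := fun v => (v, tnth v j))).
  by apply/measurable_fun_pair => //; exact: measurable_tnth.
have mjoint : measurable_fun setT (joint W).
  apply/measurable_fun_tnthP => j; rewrite (_ : _ \o _ = W j)//.
  by apply/funext => w /=; rewrite tnth_mktuple.
elim: s => [_ _|i s IH /=/andP[iNs us] sB].
  under eq_integral do rewrite big_nil.
  by rewrite integral_cst// mul1e expr0 [leLHS]probability_setT.
pose F (p : n.-tuple (d.-tuple R) * d.-tuple R) :=
  (\prod_(j <- s) e p.1 (tnth p.1 j) * e p.1 p.2)%:E.
have prod_ge0 v : 0 <= \prod_(j <- s) e v (tnth v j).
  by rewrite big_seq; apply: prodr_ge0.
have mF : measurable_fun setT F.
  apply/measurable_EFinP; apply: measurable_funM => //.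
  exact: (measurableT_comp (mprod s) measurable_fst).
have F0 p : (0 <= F p)%E by rewrite lee_fin mulr_ge0.
have thetaE w : theta (joint_erase W i w) = theta (joint W w).
  apply: thetaB => j jB; rewrite !tnth_mktuple ifN//.
  by apply: contraTneq jB => ->; rewrite sB// inE eqxx.
have prodE w : \prod_(j <- s) e (joint_erase W i w) (tnth (joint_erase W i w) j) =
    \prod_(j <- s) e (joint W w) (W j w).
  apply: eq_big_seq => j js; rewrite /e thetaE tnth_mktuple ifN//.
  by apply: contraNneq iNs => <-.
have -> : (\int[P]_w (\prod_(j <- i :: s) e (joint W w) (W j w))%:E =
    \int[P]_w F (joint_erase W i w, W i w))%E.
  apply: eq_integral => w _; rewrite big_cons mulrC -prodE.
  by congr (_ * _)%:E; rewrite /e /= thetaE.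
rewrite (expectation_joint_erase indW i mF F0).
have mprodW : measurable_fun setT (fun w => (\prod_(j <- s) e (joint W w) (W j w))%:E).
  under eq_fun do rewrite -prodE.
  apply/measurable_EFinP; apply: (measurableT_comp (mprod s)).
  exact: measurable_joint_erase.
apply: (@le_trans _ _ (\int[P]_w ((\prod_(j <- s) e (joint W w) (W j w))%:E * (1 + 2 / g)%:E))%E).
  apply: ge0_le_integral => //.
  - by move=> w _; apply: integral_ge0 => w' _; exact: F0.
  - have -> : (fun w => \int[P]_w' F (joint_erase W i w, W i w'))%E =
        (fun v => \int[distribution P (W i)]_y F (v, y))%E \o joint_erase W i.
      apply/funext => w /=.
      rewrite (@ge0_integral_distribution _ _ _ _ _ P (W i))//.
      by apply: measurableT_comp => //; exact: measurable_pair1.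
    apply: measurableT_comp; last exact: measurable_joint_erase.
    exact: (measurable_fun_fubini_tonelli_F (m2 := distribution P (W i))).
  - by apply: emeasurable_funM => //; exact: measurable_cst.
  move=> w _; rewrite -prodE.
  under eq_integral do rewrite /F /= EFinM.
  rewrite ge0_integralZl_EFin//; last 2 first.
  - by move=> w' _; rewrite lee_fin.
  - apply/measurable_EFinP.
    apply: (measurableT_comp me (g := fun w' => (joint_erase W i w, W i w'))).
    by apply/measurable_fun_pair => //; exact: measurable_cst.
  apply: lee_wpmul2l; first by rewrite lee_fin.
  rewrite /e; under eq_integral do rewrite EFinD.
  have mh : measurable_fun setT
      (fun w' => (expR (- (g * `|dot (theta (joint_erase W i w)) (W i w')|)))%:E).
    apply/measurable_EFinP; apply: measurableT_comp => //; apply: measurable_funN.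
    apply: measurable_funM => //; apply: measurableT_comp => //.
    by apply: measurableT_comp => //; exact: measurable_dot.
  rewrite (ge0_integralD P measurableT _ _ _ mh)//.
  rewrite integral_cst// mul1e [X in (X + _)%E]probability_setT.
  rewrite EFinD leeD2l//.
  exact: expectation_expR_abs_dot.
rewrite ge0_integralZr//; last by move=> w _; rewrite lee_fin -prodE.
rewrite exprSr EFinM; apply: lee_wpmul2r; first by rewrite lee_fin.
by apply: IH => // j js; apply: sB; rewrite inE js orbT.
Qed.

End product_expectation.

(** * Measurability of the dual data *)

Section measurable_matrices.
Context d (T : measurableType d) (R : realType).

Definition measurable_mx p q (M : T -> 'M[R]_(p, q)) : Prop :=
  forall i j, measurable_fun setT (fun t => M t i j).

Lemma measurable_invr : measurable_fun setT (@GRing.inv R).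
Proof.
(* Squaring makes the base of the power nonnegative, and the leading factor [x] gives the
   conventional value 0 at 0. *)
rewrite (_ : @GRing.inv R = fun x => x * (x ^+ 2) `^ (- 1)).
  apply: measurable_funM => //.
  apply: (@measurableT_comp _ _ _ _ _ _ (@powR R ^~ (- 1)) _ (fun x : R => x ^+ 2)).
    exact: measurable_powR.
  exact: measurable_funX.
apply/funext => x; rewrite powR_inv1 ?sqr_ge0//.
have [->|x0] := eqVneq x 0; first by rewrite invr0 mul0r.
by field.
Qed.

Lemma measurable_mx_mul p q r (M : T -> 'M[R]_(p, q)) (N : T -> 'M[R]_(q, r)) :
  measurable_mx M -> measurable_mx N -> measurable_mx (fun t => M t *m N t).
Proof.
move=> mM mN i j; under eq_fun do rewrite mxE.
by apply: measurable_sum => k; exact: measurable_funM.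
Qed.

Lemma measurable_det p (M : T -> 'M[R]_p) :
  measurable_mx M -> measurable_fun setT (fun t => \det (M t)).
Proof.
move=> mM; rewrite /determinant; apply: measurable_sum => s.
apply: measurable_funM => //; apply: measurable_prod => i _; exact: mM.
Qed.

Lemma measurable_unitmx p (M : T -> 'M[R]_p) :
  measurable_mx M -> measurable_fun setT (fun t => M t \in unitmx).
Proof.
move=> mM; under eq_fun do rewrite unitmxE unitfE.
apply: measurable_neg; apply: measurable_fun_eqr => //; exact: measurable_det.
Qed.

Lemma measurable_mx_inv p (M : T -> 'M[R]_p) :
  measurable_mx M -> measurable_mx (fun t => invmx (M t)).
Proof.
move=> mM i j.
(* Adjugate formula, with the default value of [invmx] on singular matrices. *)
rewrite (_ : (fun t => invmx (M t) i j) = fun t => if M t \in unitmx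
    then (\det (M t))^-1 * cofactor (M t) j i else M t i j); last first.
  by apply/funext => t; rewrite /invmx; case: ifPn => //; rewrite !mxE.
apply: measurable_fun_ifT.
- exact: measurable_unitmx.
- apply: measurable_funM.
    by apply: (measurableT_comp measurable_invr); exact: measurable_det.
  apply: measurable_funM => //; apply: measurable_det => k l.
  by under eq_fun do rewrite !mxE; exact: mM.
- exact: mM.
Qed.

Lemma measurable_mx_rowsub p q r (f : 'I_r -> 'I_p) (M : T -> 'M[R]_(p, q)) :
  measurable_mx M -> measurable_mx (fun t => rowsub f (M t)).
Proof. by move=> mM i j; under eq_fun do rewrite mxE; exact: mM. Qed.

Lemma measurable_mx_col p q r (M : T -> 'M[R]_(p, q)) (N : T -> 'M[R]_(r, q)) :
  measurable_mx M -> measurable_mx N -> measurable_mx (fun t => col_mx (M t) (N t)).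
Proof.
move=> mM mN i j; rewrite -[i]splitK; case: (fintype.split i) => k /=.
  by under eq_fun do rewrite col_mxEu; exact: mM.
by under eq_fun do rewrite col_mxEd; exact: mN.
Qed.

Lemma measurable_set_le (f h : T -> R) : measurable_fun setT f -> measurable_fun setT h ->
  measurable [set t | f t <= h t].
Proof.
move=> mf mh; rewrite -[X in measurable X]setTI.
exact: measurable_fun_le.
Qed.

Lemma measurable_set_lt (f h : T -> R) : measurable_fun setT f -> measurable_fun setT h ->
  measurable [set t | f t < h t].
Proof.
move=> mf mh.
rewrite (_ : [set t | f t < h t] = ~` [set t | h t <= f t]).
  by apply: measurableC; exact: measurable_set_le.
by apply/seteqP; split => t /=; rewrite ltNge => /negP.
Qed.

Variables (m n : nat) (A : T -> 'M[R]_(m, n)) (b : 'cV[R]_m) (c : T -> 'cV[R]_n).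
Hypotheses (mA : measurable_mx A) (mc : measurable_mx c).
Implicit Types beta : {ffun 'I_m -> 'I_(n + m)}.

Lemma measurable_dual_rows : measurable_mx (fun t => dual_rows (A t)).
Proof.
apply: measurable_mx_col => [i j|i j]; last exact: measurable_cst.
by under eq_fun do rewrite mxE; exact: mA.
Qed.

Lemma measurable_basic_dual beta : measurable_mx (fun t => basic_dual (A t) (c t) beta).
Proof.
apply: measurable_mx_mul.
  by apply: measurable_mx_inv; apply: measurable_mx_rowsub; exact: measurable_dual_rows.
apply: measurable_mx_rowsub; apply: measurable_mx_col => // i j; exact: measurable_cst.
Qed.

Lemma measurable_reduced_cost (u : T -> 'cV[R]_m) i : measurable_mx u ->
  measurable_fun setT (fun t => reduced_cost (A t) (c t) (u t) i).
Proof.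
move=> mu; apply: measurable_funB; first exact: mc.
by apply: measurable_sum => k; apply: measurable_funM; [exact: mA|exact: mu].
Qed.

Lemma measurable_dual_objective (u : T -> 'cV[R]_m) : measurable_mx u ->
  measurable_fun setT (fun t => dual_objective (A t) b (c t) (u t)).
Proof.
move=> mu; apply: measurable_funD.
  by apply: measurable_sum => k; apply: measurable_funM => //; exact: mu.
apply: measurable_sum => i; apply: measurable_maxr => //.
exact: measurable_reduced_cost.
Qed.

Lemma measurable_flip_weight g beta i :
  measurable_fun setT (fun t => flip_weight (A t) (c t) g beta i).
Proof.
rewrite /flip_weight; case: (i \in basis_columns beta) => //.
apply: measurableT_comp => //; apply: measurable_funN; apply: measurable_funM => //.
apply: measurableT_comp => //; apply: measurable_reduced_cost.
exact: measurable_basic_dual.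
Qed.

(** The complement is a finite union, over binary points and systems, of sets defined by finitely
    many measurable conditions, which avoids the suprema in [IPGAP]. *)
Lemma measurable_IPGAP_ge (G : R) : (0 < n)%N ->
  measurable [set t | (G%:E <= IPGAP (A t) b (c t))%E].
Proof.
move=> n_gt0.
pose U (p : {ffun 'I_n -> bool} * {ffun 'I_m -> 'I_(n + m)}) : set T :=
  [set t | forall k, (A t *m binary_col p.1) k 0 <= b k 0] `&`
  ([set t | rowsub p.2 (dual_rows (A t)) \in unitmx] `&`
   ([set t | forall k, 0 <= basic_dual (A t) (c t) p.2 k 0] `&`
    [set t | dual_objective (A t) b (c t) (basic_dual (A t) (c t) p.2)
       - objective (c t) (binary_col p.1) < G])).
rewrite (_ : [set t | _] = ~` \bigcup_(p in setT) U p); last first.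
  rewrite predeqE => t; split => /= [GI [[s beta] _ [/= h1 [h2 [h3 h4]]]]|H].
    move: GI; apply/negP; rewrite -ltNge; apply: (exists_IPGAP_lt (s := s) (beta := beta)) => //.
    by apply/andP; split => //; exact/fintype.forallP.
  rewrite leNgt; apply/negP => /(IPGAP_lt_exists n_gt0)[s [[_ ss] [beta bb [_ DG]]]].
  apply: H; exists (s, beta) => //; split => //; split; last split => //.
    by case/andP: bb.
  exact: dual_basis_ge0.
apply: measurableC; apply: fin_bigcup_measurable => [|[s beta] _].
  exact: finite_finset.
have mall (I : finType) (f h : I -> T -> R) : (forall k, measurable_fun setT (f k)) ->
    (forall k, measurable_fun setT (h k)) -> measurable [set t | forall k, f k t <= h k t].
  move=> mf mh.
  rewrite (_ : [set t | _] = \bigcap_(k in [set: I]) [set t | f k t <= h k t]).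
    by apply: fin_bigcap_measurable => [|k _]; [exact: finite_finset|exact: measurable_set_le].
  by apply/seteqP; split => [t H k _|t H k]; [exact: H|exact: (H k)].
apply: measurableI.
  apply: (mall _ (fun k t => (A t *m binary_col s) k 0) (fun k _ => b k 0)) => k //.
  by apply: measurable_mx_mul => // i j; exact: measurable_cst.
apply: measurableI.
  rewrite -[X in measurable X]setTI.
  apply: (measurable_unitmx (M := fun t => rowsub beta (dual_rows (A t)))) => //.
  by apply: measurable_mx_rowsub; exact: measurable_dual_rows.
apply: measurableI.
  apply: (mall _ (fun _ _ => 0) (fun k t => basic_dual (A t) (c t) beta k 0)) => k //.
  exact: measurable_basic_dual.
apply: measurable_set_lt => //; apply: measurable_funB.
  by apply: measurable_dual_objective; exact: measurable_basic_dual.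
under eq_fun do rewrite objectiveE.
by apply: measurable_sum => i; apply: measurable_funM => //; exact: mc.
Qed.

End measurable_matrices.

(** * Reduced costs as linear forms of the columns *)

Section dual_direction.
Context {R : realType} {m n : nat}.
Implicit Types (v : n.-tuple (m.+1.-tuple R)) (beta : {ffun 'I_m -> 'I_(n + m)}).

Definition tuple_objective v : 'cV[R]_n := objective_of (fun j => tnth v j).
Definition tuple_constraints v : 'M[R]_(m, n) := constraints_of (fun j => tnth v j).

Definition tuple_dual beta v : 'cV[R]_m :=
  basic_dual (tuple_constraints v) (tuple_objective v) beta.

(* The direction (1, -u), along which the reduced cost of a column is its
   inner product. *)
Definition dual_direction beta v (k : 'I_m.+1) : R :=
  oapp (fun l => - tuple_dual beta v l 0) 1 (unlift ord0 k).

Lemma dot_dual_direction beta v i : dot (dual_direction beta v) (tnth v i) =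
  reduced_cost (tuple_constraints v) (tuple_objective v) (tuple_dual beta v) i.
Proof.
rewrite /dot big_ord_recl /dual_direction unlift_none/= mul1r /reduced_cost.
congr (_ + _); first by rewrite mxE.
by rewrite -sumrN; apply: eq_bigr => k _; rewrite liftK/= !mxE; ring.
Qed.

Lemma dual_direction_norm beta v : 1 <= \sum_k dual_direction beta v k ^+ 2.
Proof.
rewrite big_ord_recl {1}/dual_direction unlift_none/= expr1n lerDl sumr_ge0// => k _.
exact: sqr_ge0.
Qed.

(** The linear system [beta] reads only the columns it selects; its remaining rows come from the
    identity block and have right-hand side 0. *)
Lemma dual_direction_local beta v v' :
  (forall j, j \in basis_columns beta -> tnth v j = tnth v' j) ->
  dual_direction beta v = dual_direction beta v'.
Proof.
move=> H; apply/funext => k; rewrite /dual_direction /tuple_dual.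
suff -> : basic_dual (tuple_constraints v) (tuple_objective v) beta =
  basic_dual (tuple_constraints v') (tuple_objective v') beta by [].
have E (l : 'I_m) (i : 'I_n) : beta l = lshift m i -> tnth v i = tnth v' i.
  by move=> bl; apply: H; rewrite inE; apply/fintype.existsP; exists l; rewrite bl.
rewrite /basic_dual; congr (invmx _ *m _); apply/matrixP => l j; rewrite !mxE;
  case: splitP => i bi; rewrite ?mxE//; rewrite (E l i)//; exact/val_inj.
Qed.

Lemma measurable_dual_direction beta k :
  measurable_fun setT (fun v => dual_direction beta v k).
Proof.
rewrite /dual_direction; case: (unlift ord0 k) => [l|] /=; last exact: measurable_cst.
have mt (j : 'I_n) (i : 'I_m.+1) :
    measurable_fun setT (fun v : n.-tuple (m.+1.-tuple R) => tnth (tnth v j) i).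
  exact: (measurableT_comp (measurable_tnth i) (measurable_tnth j)).
apply: measurable_funN; apply: measurable_basic_dual => i j;
  by under eq_fun do rewrite mxE; exact: mt.
Qed.

Lemma card_basis_columns beta : (#|basis_columns beta| <= m)%N.
Proof.
rewrite -(card_imset _ (@lshift_inj n m)).
apply: (@leq_trans #|(beta @: [set: 'I_m])%SET|).
  apply: subset_leq_card; apply/fintype.subsetP => _ /imsetP[i + ->].
  by rewrite inE => /fintype.existsP[k /eqP<-]; apply: imset_f.
by rewrite (leq_trans (leq_imset_card _ _))// cardsT card_ord.
Qed.

End dual_direction.

Section expected_weight.
Context {R : realType} dO (Omega : measurableType dO) (P : probability Omega R).
Variables (m n : nat) (W : 'I_n -> {RV P >-> m.+1.-tuple R}).
Hypotheses (indW : mutually_independent W) (lcW : forall j, logconcave_vector (W j))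
  (covW : forall j, identity_covariance (W j)).
Local Notation c w := (objective_of (fun j => W j w)).
Local Notation A w := (constraints_of (fun j => W j w)).

Let tupleE w : tuple_objective (joint W w) = c w /\ tuple_constraints (joint W w) = A w.
Proof. by split; apply/matrixP => i j; rewrite !mxE tnth_mktuple. Qed.

Let mW j k : measurable_fun setT (fun w => tnth (W j w) k).
Proof. by apply: (measurableT_comp (measurable_tnth k)). Qed.

Lemma measurable_mx_objective : measurable_mx (fun w => c w).
Proof. by move=> i j; under eq_fun do rewrite mxE; exact: mW. Qed.

Lemma measurable_mx_constraints : measurable_mx (fun w => A w).
Proof. by move=> i j; under eq_fun do rewrite mxE; exact: mW. Qed.

(** At most [m] basis columns contribute a factor 2 each; the others are inner products with a
    direction of norm at least 1 that depends on the basis columns alone. *)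
Lemma expectation_flip_weight g beta : 0 < g ->
  (\int[P]_w (\prod_i (1 + flip_weight (A w) (c w) g beta i))%:E <=
   (2 ^+ m * (1 + 2 / g) ^+ n)%:E)%E.
Proof.
move=> g0; pose B := basis_columns beta.
pose s := enum (~: B)%SET.
have sB : {in s, forall i, i \notin B} by move=> i; rewrite mem_enum finset.in_setC.
have := expectation_prod_le indW lcW covW g0 (measurable_dual_direction (R := R) beta)
  (@dual_direction_local R m n beta) (dual_direction_norm beta) (enum_uniq _) sB.
have bg : 1 <= 1 + 2 / g by rewrite lerDl divr_ge0// ltW.
have prodE w : \prod_i (1 + flip_weight (A w) (c w) g beta i) = 2 ^+ #|B| *
    \prod_(i <- s) (1 + expR (- (g * `|dot (dual_direction beta (joint W w)) (W i w)|))).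
  rewrite (bigID (mem B))/=; congr (_ * _).
    rewrite -prodr_const; apply: eq_bigr => i iB; rewrite /flip_weight ifT//.
  rewrite /s big_enum/=; apply: eq_big => [i|i iB]; first by rewrite finset.in_setC.
  rewrite /flip_weight (negbTE iB); have := dot_dual_direction beta (joint W w) i.
  rewrite /tuple_dual; have [-> ->] := tupleE w.
  by rewrite tnth_mktuple => ->.
move=> H; under eq_integral do rewrite prodE EFinM.
have mp : measurable_fun setT (fun w => (\prod_(i <- s)
    (1 + expR (- (g * `|dot (dual_direction beta (joint W w)) (W i w)|))))%:E).
  (* Measurability is read off the full product, of which this partial one is a constant
     multiple. *)
  rewrite (_ : (fun w => _) = fun w => (2 ^- #|B| *
    \prod_i (1 + flip_weight (A w) (c w) g beta i))%:E); last first.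
    by apply/funext => w; rewrite prodE mulKf ?expf_neq0 ?pnatr_eq0.
  apply/measurable_EFinP; apply: measurable_funM => //; apply: measurable_prod => i _.
  apply: measurable_funD => //; apply: measurable_flip_weight.
    exact: measurable_mx_constraints.
  exact: measurable_mx_objective.
have p0 w : (0 <= (\prod_(i <- s)
    (1 + expR (- (g * `|dot (dual_direction beta (joint W w)) (W i w)|))))%:E)%E.
  by rewrite lee_fin; apply: prodr_ge0 => i _; rewrite addr_ge0// expR_ge0.
rewrite ge0_integralZl_EFin//.
rewrite EFinM; apply: lee_pmul => //.
- by apply: integral_ge0 => w _; exact: p0.
- by rewrite lee_fin ler_weXn2l// ?ler1n// card_basis_columns.
- apply: le_trans H _; rewrite lee_fin ler_weXn2l// /s -cardE.
  by rewrite (leq_trans (max_card _))// card_ord.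
Qed.

End expected_weight.

(** * Tree size bound *)

(** The factors count, in order: the root and the two children per branching, the fractional sets,
    the tight row sets, the systems [beta], and the weights of basis columns. Their product is at
    most [(48 * n ^ 2) ^ m], and [48 <= n ^ 3]. *)
Lemma tree_prefactor_le (m n : nat) : (1 <= m)%N -> (100 * (m + 1) <= n)%N ->
  (3 * (n.+1 ^ m * 2 ^ m) * ((n + m) ^ m * 2 ^ m) <= n ^ (5 * m))%N.
Proof.
move=> m1 mn.
have le3 : (3 <= 3 ^ m)%N by rewrite -{1}(expn1 3) leq_exp2l.
apply: (@leq_trans (3 ^ m * (n.+1 ^ m * 2 ^ m) * ((n + m) ^ m * 2 ^ m))).
  by rewrite !leq_mul2r le3 !orbT.
rewrite -!expnMn expnM leq_exp2r// -!mulnA.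
have n1 : (n.+1 <= 2 * n)%N by lia.
have n2 : (n + m <= 2 * n)%N by lia.
apply: (@leq_trans (3 * (2 * n * (2 * (2 * n * 2))))).
  by rewrite leq_mul2l /= leq_mul// leq_mul2l /= leq_mul2r n2.
have -> : (3 * (2 * n * (2 * (2 * n * 2))) = 48 * n ^ 2)%N by lia.
rewrite (_ : 5%N = (3 + 2)%N)// expnD leq_mul2r; apply/orP; right.
apply: (@leq_trans (100 ^ 3)%N) => //; rewrite leq_exp2r//; lia.
Qed.

(** The choice of [g] that balances the two terms [g * G] and [2 * n / g], whose product does not
    depend on [g]. *)
Lemma optimal_exponent (R : realType) (n : nat) (G : R) : (0 < n)%N -> 0 < G ->
  exists2 g : R, 0 < g & g * G = Num.sqrt (2 * n%:R * G) /\
    n%:R * (2 / g) = Num.sqrt (2 * n%:R * G).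
Proof.
move=> n0 G0; have n0' : 0 < n%:R :> R by rewrite ltr0n.
have nG0 : 0 < 2 * n%:R * G by rewrite !mulr_gt0.
have s0 : 0 < Num.sqrt (2 * n%:R * G) by rewrite sqrtr_gt0.
have s2 : Num.sqrt (2 * n%:R * G) ^+ 2 = 2 * n%:R * G by rewrite sqr_sqrtr// ltW.
exists (Num.sqrt (2 * n%:R * G) / G); first by rewrite divr_gt0.
split; first by rewrite divfK// gt_eqF.
set s := Num.sqrt _ in s0 s2 *.
rewrite (_ : n%:R * (2 / (s / G)) = 2 * n%:R * G / s); first by rewrite -s2 expr2 mulfK// gt_eqF.
by field; rewrite !gt_eqF.
Qed.

Lemma markov_complement (R : realType) dO (Omega : measurableType dO)
    (P : probability Omega R) (S : Omega -> R) (M delta : R) :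
  measurable_fun setT S -> (forall w, 0 <= S w) -> 0 < M -> 0 < delta ->
  (\int[P]_w (S w)%:E <= M%:E)%E -> (P [set w | (M / delta <= S w)%R] <= delta%:E)%E.
Proof.
move=> mS S0 M0 d0 SM.
have a0 : 0 < M / delta by rewrite divr_gt0.
have mS' : measurable_fun setT (EFin \o S) by exact/measurable_EFinP.
have := le_integral_abse P measurableT mS' a0.
rewrite setTI.
have -> : [set w | ((M / delta)%:E <= `|(EFin \o S) w|)%E] = [set w | M / delta <= S w].
  by apply/seteqP; split => w /=; rewrite lee_fin ger0_norm.
have -> : (\int[P]_w `|(EFin \o S) w| = \int[P]_w (S w)%:E)%E.
  by apply: eq_integral => w _; rewrite gee0_abs//= lee_fin.
move=> /le_trans /(_ SM).
rewrite -lee_pdivlMl// -EFinM => /le_trans; apply; rewrite lee_fin.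
by rewrite invf_div divfK// gt_eqF.
Qed.

(* The event that branch-and-bound produces a small tree is bounded below in
   inner probability, i.e. through a measurable event E contained in it. *)
Theorem theorem3 (R : realType) :
  exists2 K : R, 0 < K &
  forall (m n : nat), (1 <= m)%N -> (100 * (m + 1) <= n)%N ->
  forall (b : 'cV[R]_m)
    (dO : measure_display) (Omega : measurableType dO)
    (P : probability Omega R)
    (W : 'I_n -> {RV P >-> m.+1.-tuple R}),
  mutually_independent W ->
  (forall j, logconcave_vector (W j)) ->
  (forall j, identity_covariance (W j)) ->
  let c w := objective_of (fun j => W j w) in
  let A w := constraints_of (fun j => W j w) in
  forall (G delta : R), 0 <= G -> 0 < delta < 1 ->
  exists E : set Omega,
    [/\ measurable E,
        E `<=` [set w | bb_tree_size_le (A w) b (c w)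
                  (n%:R `^ (K * m%:R) * expR (2 * Num.sqrt (2 * n%:R * G))
                   / delta)]
      & (1 - P [set w | G%:E <= IPGAP (A w) b (c w)] - delta%:E
           - (expR (- (n%:R / 5)))%:E <= P E)%E].
Proof.
exists 5 => // m n m1 mn b dO Omega P W indW lcW covW c A G delta G0 /andP[d0 d1].
have n0 : (0 < n)%N by lia.
have mA : measurable_mx A := measurable_mx_constraints W.
have mc : measurable_mx c := measurable_mx_objective W.
pose H := [set w | (G%:E <= IPGAP (A w) b (c w))%E].
have mH : measurable H by exact: measurable_IPGAP_ge.
have e0 : 0 < expR (- (n%:R / 5)) :> R by exact: expR_gt0.
have PHfin : P H \is a fin_num by exact: fin_num_measure.
(* At [G = 0] no [g] balances the terms. The gap is never negative, so the claimed lower bound on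
   the probability is negative and the empty event suffices. *)
have [G00|GN0] := eqVneq G 0.
  have HT : H = setT.
    apply/seteqP; split => // w _; rewrite /H /= leNgt; apply/negP.
    move=> /(IPGAP_lt_exists n0)[s [sF [beta bb [vE]]]].
    rewrite G00 subr_lt0 ltNge => /negP; apply.
    rewrite -lee_fin -vE; apply: node_value_ge; exact: IP_feasible_LP.
  exists set0; split => //.
  rewrite measure0 -/H HT probability_setT subee// sub0e -EFinN -EFinB lee_fin.
  by lra.
have {GN0}G0 : 0 < G by rewrite lt_neqAle eq_sym GN0.
have [g g0 [gG ng]] := optimal_exponent n0 G0.
pose S w : R := \sum_(beta : {ffun 'I_m -> 'I_(n + m)})
  \prod_i (1 + flip_weight (A w) (c w) g beta i).
have prod0 w beta : 0 <= \prod_i (1 + flip_weight (A w) (c w) g beta i).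
  by apply: prodr_ge0 => i _; rewrite addr_ge0// ltW// flip_weight_gt0.
have mprod beta : measurable_fun setT
    (fun w => \prod_i (1 + flip_weight (A w) (c w) g beta i)).
  apply: measurable_prod => i _; apply: measurable_funD => //.
  exact: measurable_flip_weight.
have mS : measurable_fun setT S by apply: measurable_sum => beta; exact: mprod.
have S0 w : 0 <= S w by exact: sumr_ge0.
(* There are [(n + m) ^ m] systems, [2 ^ m] pays for the basis columns, and the exponential
   dominates [(1 + 2 / g) ^+ n]. *)
pose M : R := ((n + m) ^ m * 2 ^ m)%:R * expR (Num.sqrt (2 * n%:R * G)).
have nm0 : (0 < (n + m) ^ m * 2 ^ m)%N by rewrite muln_gt0 !expn_gt0 addn_gt0 n0.
have M0 : 0 < M by rewrite mulr_gt0 ?expR_gt0// ltr0n.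
have SM : (\int[P]_w (S w)%:E <= M%:E)%E.
  under eq_integral do rewrite /S -sumEFin.
  have mp beta : measurable_fun setT
      (fun w => (\prod_i (1 + flip_weight (A w) (c w) g beta i))%:E).
    by apply/measurable_EFinP; exact: mprod.
  rewrite (ge0_integral_sum P measurableT mp); last by move=> beta w _; rewrite lee_fin.
  apply: (@le_trans _ _ (\sum_(beta : {ffun 'I_m -> 'I_(n + m)})
      (2 ^+ m * (1 + 2 / g) ^+ n)%:E)%E).
    by apply: lee_sum => beta _; exact: expectation_flip_weight.
  rewrite sumEFin lee_fin sumr_const card_ffun !card_ord /M natrM -[leLHS]mulr_natl -[leRHS]mulrA.
  apply: ler_wpM2l => //; rewrite natrX; apply: ler_wpM2l; first exact: exprn_ge0.
  rewrite -ng expRM_natl ler_pXn2r// ?nnegrE ?expR_ge0//.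
    exact: expR_ge1Dx.
  by rewrite addr_ge0// divr_ge0// ltW.
have markovS := markov_complement mS S0 M0 d0 SM.
pose F := [set w | M / delta <= S w].
have mF : measurable F by exact: measurable_set_le.
have PFfin : P F \is a fin_num by exact: fin_num_measure.
(* Both failures, a large gap and a large weight sum, are measurable events; outside them the size
   bound holds for every run. *)
exists (~` (H `|` F)); split.
- by apply: measurableC; exact: measurableU.
- move=> w /= /not_orP[wH /negP]; rewrite -ltNge => wF s sreach.
  have gapG : (IPGAP (A w) b (c w) < G%:E)%E by rewrite ltNge; exact/negP.
  apply: le_trans (bb_tree_size_bound n0 (ltW g0) gapG sreach) _.
  rewrite -/(S w) gG; set r := Num.sqrt (2 * n%:R * G).
  pose Y : R := (n.+1 ^ m * 2 ^ m)%:R * (expR r * (M / delta)).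
  have er1 : 1 <= expR r by rewrite -expR0 ler_expR sqrtr_ge0.
  have M1 : 1 <= M by rewrite /M -/r mulr_ege1// ler1n.
  have Md1 : 1 <= M / delta by rewrite ler_pdivlMr// mul1r (le_trans (ltW d1)).
  have Y1 : 1 <= Y.
    rewrite /Y mulr_ege1//; last exact: mulr_ege1.
    by rewrite ler1n muln_gt0 !expn_gt0.
  (* Since [1 <= Y], the root of the tree is absorbed: [1 + 2 * Y <= 3 * Y]. *)
  apply: (@le_trans _ _ (3 * Y)).
    have : (n.+1 ^ m * 2 ^ m)%:R * (expR r * S w) <= Y.
      by rewrite /Y ler_wpM2l// ler_wpM2l ?expR_ge0// ltW.
    by move: Y1; set y := _ * (_ * S w); lra.
  have -> : 3 * Y = (3 * (n.+1 ^ m * 2 ^ m) * ((n + m) ^ m * 2 ^ m))%:R *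
      expR (2 * r) / delta.
    have -> : expR (2 * r) = expR r * expR r by rewrite -expRD mulrDl mul1r.
    by rewrite /Y /M -/r !natrM; ring.
  rewrite ler_wpM2r ?invr_ge0 ?(ltW d0)// ler_wpM2r ?expR_ge0//.
  rewrite -natrM powR_mulrn// -natrX ler_nat; exact: tree_prefactor_le.
- rewrite probability_setC; last exact: measurableU.
  have PU : (P (H `|` F) <= P H + P F)%E by exact: measureU2.
  have PUfin : P (H `|` F) \is a fin_num.
    by apply: fin_num_measure; exact: measurableU.
  rewrite -/H; move: PU markovS.
  rewrite -/F -(fineK PHfin) -(fineK PFfin) -(fineK PUfin) -EFinD !lee_fin => PU mS'.
  by lra.
Qed.
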